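(* Let $\phi:\Lambda\to\mathbb{R}$ be Hölder continuous with $\sup\phi-\inf\phi<\frac{\log\omega}{2}$, and let $\lambda$ be the spectral radius of the transfer operator $\mathcal{L}_\phi$. Then there exist a Borel probability measure $\nu$ on $\Lambda$ and a positive function $h:\Lambda\to\mathbb{R}$, $h\in C(\Lambda)$, such that $$\mathcal{L}_\phi^{*}\nu=\lambda\nu\qquad\text{and}\qquad \mathcal{L}_\phi h=\lambda h.$$
   Context: Fix parameters $0<\rho<1/3$, $0<\sigma<1/3$, and put $\alpha=\rho^{-1}$, $\omega=\frac{1+\sqrt5}{2}$. Let $f:[0,1]\to[0,1]$ be the increasing homeomorphism $f(y)=\frac{1}{1-(1-1/y)e^{-1}}$ for $y>0$, $f(0)=0$; let $g_0=f^{-1}$ and $g_1(y)=1-\sigma^{-1}y$. In $\mathbb{R}^3$ (Euclidean metric) let $R_1=[0,\rho]\times[0,1]\times\{0\}$, $R_2=[3/4-\rho,3/4]\times[0,\sigma]\times\{0\}$, $R_3=[0,\rho]\times[0,1]\times\{5/6\}$. Define $G$ on $R_1\cup R_2\cup R_3$ by $G(x,y,z)=(\alpha x,g_0(y),0)$ on $R_1$ and on $R_3$, and $G(x,y,z)=(\alpha(3/4-x),g_1(y),5/6)$ on $R_2$. Let $\Lambda=\bigcap_{n\ge0}G^{-n}(R_1\cup R_2\cup R_3)$, the compact set of points all of whose forward iterates are defined and stay in $R_1\cup R_2\cup R_3$; $G$ also denotes the restriction $G:\Lambda\to\Lambda$. $C(\Lambda)$ is the space of real continuous functions on $\Lambda$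 with the sup norm. The transfer (Ruelle–Perron–Frobenius) operator $\mathcal{L}_\phi:C(\Lambda)\to C(\Lambda)$ is $\mathcal{L}_\phi\psi(x)=\sum_{y\in G^{-1}(x)}e^{\phi(y)}\psi(y)$. Its dual $\mathcal{L}_\phi^{*}$ acts on finite Borel measures on $\Lambda$ by $\int\psi\,d\mathcal{L}_\phi^{*}\eta=\int\mathcal{L}_\phi\psi\,d\eta$ for all $\psi\in C(\Lambda)$. *)

(* Defs.v *)
From HB Require Import structures.
From mathcomp Require Import all_boot all_order all_algebra.
From mathcomp Require Import all_classical all_reals all_analysis.
From mathcomp.real_closed Require Import complex.

Set Implicit Arguments.
Unset Strict Implicit.
Unset Printing Implicit Defensive.

Import Order.TTheory GRing.Theory Num.Theory.
Import numFieldNormedType.Exports.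

Local Open Scope classical_set_scope.
Local Open Scope ring_scope.

Definition golden_ratio (R : realType) : R := (1 + Num.sqrt 5) / 2.

Section horseshoe.
Context {R : realType}.

(* Only the restriction of f to [0, 1] matters. *)
Definition f (y : R) : R :=
  if y == 0 then 0 else (1 - (1 - y^-1) * (expR 1)^-1)^-1.

Definition g0 : R -> R := 'pinv_(fun=> 0) `[0, 1] f.

Variables rho sigma : R.

Definition g1 (y : R) : R := 1 - sigma^-1 * y.

Definition R1 : set (R * R * R) := `[0, rho] `*` `[0, 1] `*` [set 0].

Definition R2 : set (R * R * R) :=
  `[3 / 4 - rho, 3 / 4] `*` `[0, sigma] `*` [set 0].

Definition R3 : set (R * R * R) := `[0, rho] `*` `[0, 1] `*` [set 5 / 6].

(* The map is only meaningful on R1, R2 and R3, which are pairwise disjoint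
   when rho < 1/3; points outside their union are sent to themselves. *)
Definition G (p : R * R * R) : R * R * R :=
  let: (x, y, z) := p in
  if p \in R1 `|` R3 then (rho^-1 * x, g0 y, 0)
  else if p \in R2 then (rho^-1 * (3 / 4 - x), g1 y, 5 / 6)
  else p.

(* A point at which some iterate of the partial map is undefined has an
   iterate outside the union of the rectangles, so the values given to G
   there do not affect this set. *)
Definition Lambda : set (R * R * R) :=
  \bigcap_(n in setT) (iter n G @^-1` (R1 `|` R2 `|` R3)).

Lemma f_eq0 (y : R) : y \in `[0, 1] -> f y = 0 -> y = 0.
Proof.
rewrite in_itv/= => /andP[y0 y1]; rewrite /f; case: eqVneq => // yN0 /eqP.
have {}y0 : 0 < y by rewrite lt_neqAle eq_sym yN0.
rewrite invr_eq0 gt_eqF// subr_gt0 (le_lt_trans _ ltr01)//.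
by rewrite mulr_le0_ge0 ?invr_ge0 ?expR_ge0// subr_le0 invf_ge1.
Qed.

Lemma g0_0 : g0 0 = 0.
Proof.
have f0 : (f @` `[0, 1]) 0.
  by exists 0; [rewrite /= in_itv/= lexx ler01 | rewrite /f eqxx].
apply: f_eq0; first exact: (@funS _ _ _ _ ('pinv_(fun=> 0) `[0, 1] f) _ f0).
by apply: pinvK; exact/mem_set.
Qed.

Lemma Lambda_0 : 0 <= rho -> Lambda (0, 0, 0).
Proof.
move=> rho0; have R10 : R1 (0, 0, 0).
  by do !split; rewrite /= in_itv/= lexx ?rho0 ?ler01.
have G0 : G (0, 0, 0) = (0, 0, 0).
  by rewrite /G ifT ?mulr0 ?g0_0//; apply/mem_set; left.
by move=> n _ /=; elim: n => [|n IHn]; [do 2 left|rewrite iterSr G0].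
Qed.

Lemma Lambda_G (p : R * R * R) : Lambda p -> Lambda (G p).
Proof. by move=> Lp n _ /=; rewrite -iterSr; exact: Lp. Qed.

End horseshoe.

(* The bounds on rho are carried by the type because measurable structures
   are defined on pointed types, and (0, 0, 0) belongs to Lambda only when
   rho is nonnegative. *)
Definition LambdaT (R : realType) (rho sigma : R) of 0 < rho < 3^-1 : Type :=
  set_type (Lambda rho sigma).
Arguments LambdaT {R rho} sigma hrho.

Section transfer_operator.
Context {R : realType} {rho sigma : R} {hrho : 0 < rho < 3^-1}.
Local Notation T := (LambdaT sigma hrho).

HB.instance Definition _ := Topological.copy T (set_type (Lambda rho sigma)).

Definition LambdaT_point : T :=
  exist _ (0, 0, 0)
    (mem_set (Lambda_0 sigma (ltW (proj1 (andP hrho))))).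

HB.instance Definition _ := isPointed.Build T LambdaT_point.

Definition GL (p : T) : T :=
  exist _ (G rho sigma (val p)) (mem_set (Lambda_G (set_mem (valP p)))).

Definition euclidean_dist (p q : R * R * R) : R :=
  Num.sqrt ((p.1.1 - q.1.1) ^+ 2 + (p.1.2 - q.1.2) ^+ 2 + (p.2 - q.2) ^+ 2).

Definition holder_continuous (phi : T -> R) : Prop :=
  exists C a : R, [/\ 0 <= C, 0 < a <= 1 &
    forall p q : T,
      `|phi p - phi q| <= C * euclidean_dist (val p) (val q) `^ a].

(* The fibres of GL have at most two elements, so that this sum over a finite
   support is the sum over the whole fibre. *)
Definition transfer (phi psi : T -> R) : T -> R :=
  fun x => \sum_(y \in GL @^-1` [set x]) expR (phi y) * psi y.

Definition borel : Type := g_sigma_algebraType (@open T).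

HB.instance Definition _ := Measurable.on borel.

(* mu is the image of eta under the dual of the transfer operator *)
Definition dual_transfer (phi : T -> R)
    (eta mu : {finite_measure set borel -> \bar R}) : Prop :=
  forall psi : T -> R, continuous psi ->
    (\int[mu]_x (psi x)%:E = \int[eta]_x (transfer phi psi x)%:E)%E.

End transfer_operator.

Arguments borel {R rho} sigma hrho.

Section spectrum.
Context {R : realType} {X : topologicalType}.

(* The spectrum of an operator L on the real Banach space C(X), X compact, is
   that of its complexification, which acts on C(X; R[i]) separately on real
   and imaginary parts. The inverse of a bijective bounded operator between
   Banach spaces is bounded, so non-invertibility is failure of bijectivity. *)
Definition complex_continuous : set (X -> R[i]) :=
  [set u | continuous (fun x => complex.Re (u x)) /\
           continuous (fun x => complex.Im (u x))].

Definition complexify (L : (X -> R) -> (X -> R)) (u : X -> R[i]) : X -> R[i] :=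
  fun x => Complex (L (fun y => complex.Re (u y)) x)
                   (L (fun y => complex.Im (u y)) x).

Definition spectrum (L : (X -> R) -> (X -> R)) : set R[i] :=
  [set z | ~ set_bij complex_continuous complex_continuous
                (fun u x => complexify L u x - z * u x)].

Definition spectral_radius (L : (X -> R) -> (X -> R)) : R :=
  sup [set complex.Re `|z| | z in spectrum L].

End spectrum.

(* Main.v *)
Require Import Defs.
From HB Require Import structures.
From mathcomp Require Import all_boot all_order all_algebra.
From mathcomp Require Import all_classical all_reals all_analysis.
From mathcomp.real_closed Require Import complex.
From mathcomp Require Import measurable_realfun ring lra.
Import Order.TTheory GRing.Theory Num.Theory.
Import numFieldNormedType.Exports.

(** The set Lambda splits into a ground level (z = 0) and an upper level
(z = 5/6), and G has three inverse branches: two from the ground level, beta1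
into the ground level and beta3 into the upper level, and one from the upper
level, beta2, into the ground level. So the transfer operator is
L u p = W(b1 p) u(b1 p) + W(b3 p) u(b3 p) on the ground and W(b2 p) u(b2 p)
above, with W = exp phi. In the z direction this is the golden mean shift.

All branches contract x, but beta1 and beta3 act on y by the Moebius map
f(y) = e y / (1 + (e - 1) y), which expands by the factor e at 0; the map G is
therefore not uniformly expanding. Two facts make up for it. The map f preserves
the cross ratio of {y, w} with {0, 1}, and the flip y -> sigma (1 - y) in beta2
contracts it, by a uniform factor as long as y stays away from 1. Hence in the
gauge |dx|^a + |dy|^b cross_ratio^(a-b) a step along a branch expands by at most
e^b, which is as close to 1 as desired, and a flip made fewer than k0 steps after
the previous one contracts by some t < 1 ([gauge_b1], [gauge_b3], [gauge_b2]).

Branches that never contract are those with long runs between flips, and a long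
run has hardly any choice, because leaving the ground forces a flip at the
next step. So the operator that counts them, restricted to words with few
contractions, grows at most like (sup W)^n up to a factor x^n with x close to 1
([memory_op_growth]), while L^n 1 grows like lam^n with
lam >= golden_ratio * inf W ([golden_growth]), since Fibonacci numbers count the
words of length n. The assumption on the oscillation of phi gives sup W < lam, and
an interpolation between the two growth rates ([memory_op_interpolation]) yields
a bounded weight U >= 1 with c K U <= beta lam U and beta < 1, K being the operator
that records contractions ([exists_memory_supersolution]). This is a
Doeblin-Fortet inequality: iterating L / lam improves the regularity measured in
the gauge up to a bounded error.

The eigenfunction is obtained from the partial sums of the resolvent,
r_N = sum over n <= N of s^-n L^n 1, for s slightly larger than lam. They are large
because lam is the growth rate, and after normalization they are equi-Lipschitz by
the inequality above and satisfy L r = lam r up to a small error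
([approximate_eigenfunction]); a limit along an ultrafilter is a nonzero
eigenfunction h >= 0 ([eigenfunction_of_approximate]). Comparing L^n h at two
points of the same level, with an error that is small with respect to lam^n, shows
that h vanishes nowhere ([eigenfunction_positivity]).

Once h > 0 is known, |u| <= C h gives |L^n u| <= C lam^n h for every continuous u.
Limits of the Cesaro means of lam^-n L^n u at one point define a positive linear
functional l with l (L u) = lam l(u) ([exists_eigenfunctional]), which is the
integral against a probability measure ([riesz_representation]). The same bound
makes the Neumann series of L - z converge when |z| > lam, so that the spectral
radius is lam ([spectral_radius_eigenvalue]). *)

Set Implicit Arguments.
Unset Strict Implicit.
Unset Printing Implicit Defensive.
Local Open Scope classical_set_scope.
Local Open Scope ring_scope.

(** * Continuous functions on a compact space *)

Lemma continuous_compact_bounded {R : realType} {X : topologicalType}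
    (u : X -> R) : compact [set: X] -> continuous u ->
  exists2 C, 0 < C & forall x, `|u x| <= C.
Proof.
move=> cX cu; have /compact_bounded[M [_ /(_ (`|M| + 1))]] : compact (u @` setT).
  by apply: continuous_compact => //; exact: continuous_subspaceT.
have MM : M < `|M| + 1 by rewrite (le_lt_trans (ler_norm M))// ltrDl.
move=> /(_ MM) H; exists (`|M| + 1) => [|x]; first by rewrite ltr_wpDl.
by apply: H; exists x.
Qed.

Lemma positive_continuous_ge {R : realType} {X : topologicalType}
    (u : X -> R) : compact [set: X] -> continuous u -> (forall x, 0 < u x) ->
  exists2 c, 0 < c & forall x, c <= u x.
Proof.
move=> cX cu u0.
have cV : continuous (fun x => (u x)^-1).
  by move=> x; apply: cvgV; [rewrite gt_eqF|exact: cu].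
have [C C0 HC] := continuous_compact_bounded cX cV.
exists C^-1 => [|x]; first by rewrite invr_gt0.
by rewrite -(invrK (u x)) lef_pV2 ?posrE ?invr_gt0// (le_trans (ler_norm _)).
Qed.

(** * The Riesz representation theorem *)

Lemma continuous_borel_measurable {R : realType} {X : ptopologicalType}
    (u : X -> R) : continuous u ->
  measurable_fun setT (u : g_sigma_algebraType (@open X) -> R).
Proof.
move=> cu; apply: (measurability _ (RGenOpens.measurableE R)).
move=> _ [_ [a [b ->] <-]]; rewrite setTI; apply: sub_sigma_algebra.
by apply: open_comp => // x _; exact: cu.
Qed.

Lemma continuous_integrable {R : realType} {X : ptopologicalType}
    (mu : {finite_measure set (g_sigma_algebraType (@open X)) -> \bar R})
    (u : X -> R) : compact [set: X] -> continuous u ->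
  mu.-integrable setT (EFin \o u).
Proof.
move=> cX cu; have [C C0 uC] := continuous_compact_bounded cX cu.
apply: measurable_bounded_integrable => //.
- by rewrite ltey_eq fin_num_measure.
- exact: continuous_borel_measurable.
- exists C; split; first exact: num_real.
  by move=> M CM x _; exact: le_trans (uC x) (ltW CM).
Qed.

Lemma integrable_mscale d (T : measurableType d) (R : realType)
    (m : {measure set T -> \bar R}) (k : {nonneg R}) (f : T -> \bar R) :
  m.-integrable setT f ->
  (\int[mscale k m]_x f x = k%:num%:E * \int[m]_x f x)%E.
Proof.
move=> fi; have mf := measurable_int m fi.
have mp : measurable_fun setT (f^\+)%E by exact: measurable_funepos.
have mn : measurable_fun setT (f^\-)%E by exact: measurable_funeneg.
rewrite (integralE (mscale k m) _ f) (integralE m _ f) ge0_integral_mscale//.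
rewrite ge0_integral_mscale//.
have fn : (\int[m]_x f^\- x)%E \is a fin_num by exact: integrable_neg_fin_num.
by rewrite [in RHS]muleBr// fin_num_adde_defl// fin_numN.
Qed.

(** The measure comes from the outer measure that l gives to a set A: the infimum
of the sums of l(u_i) over the countable families of nonnegative continuous
functions whose sum is at least 1 on A. When every open set is the positivity set
of a continuous function g, truncations of n g split any such family between the
open set and its complement, so open sets, and then Borel sets, are
Caratheodory measurable. *)
Section riesz.
Context {R : realType} {X : ptopologicalType}.
Hypothesis X_compact : compact [set: X].
Hypothesis open_cozero : forall U : set X, open U ->
  exists2 g : X -> R, continuous g /\ (forall x, 0 <= g x) &
    U = [set x | 0 < g x].

Variable l : (X -> R) -> R.
Hypothesis lD : forall u v : X -> R, continuous u -> continuous v ->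
  l (fun x => u x + v x) = l u + l v.
Hypothesis lZ : forall (c : R) (u : X -> R), continuous u ->
  l (fun x => c * u x) = c * l u.
Hypothesis l_ge0 : forall u : X -> R, continuous u -> (forall x, 0 <= u x) ->
  0 <= l u.

Lemma functional_le (u v : X -> R) : continuous u -> continuous v ->
  (forall x, u x <= v x) -> l u <= l v.
Proof.
move=> cu cv uv.
have cNu : continuous (fun x => (-1) * u x).
  by move=> x; apply: cvgM; [exact: cvg_cst|exact: cu].
have cvu : continuous (fun x => v x + (-1) * u x).
  by move=> x; apply: cvgD; [exact: cv|exact: cNu].
have : 0 <= l (fun x => v x + (-1) * u x).
  by apply: l_ge0 => // x; rewrite mulN1r subr_ge0.
by rewrite lD// lZ// mulN1r subr_ge0.
Qed.

Lemma functional0 : l (fun=> 0) = 0.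
Proof.
have c0 : continuous (fun _ : X => 0 : R) by move=> x; exact: cvg_cst.
have <- : (fun _ : X => 0 * 0 : R) = (fun=> 0).
  by apply/funext => x; rewrite mul0r.
by rewrite (lZ 0 c0) mul0r.
Qed.

Lemma continuous_sum (I : Type) (r : seq I) (u : I -> X -> R) :
  (forall i, continuous (u i)) -> continuous (fun x => \sum_(i <- r) u i x).
Proof.
move=> cu; elim: r => [|i r IH] x.
  under eq_fun do rewrite big_nil; exact: cvg_cst.
under eq_fun do rewrite big_cons; by apply: cvgD; [exact: cu|exact: IH].
Qed.

Lemma functional_sum (I : Type) (r : seq I) (u : I -> X -> R) :
  (forall i, continuous (u i)) ->
  l (fun x => \sum_(i <- r) u i x) = \sum_(i <- r) l (u i).
Proof.
move=> cu; elim: r => [|i r IH].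
  by under eq_fun do rewrite big_nil; rewrite big_nil functional0.
under eq_fun do rewrite big_cons.
by rewrite big_cons lD ?IH//; exact: continuous_sum.
Qed.

Definition nonneg_continuous (u : X -> R) :=
  continuous u /\ forall x, 0 <= u x.

Definition function_cover (A : set X) : set (nat -> X -> R) :=
  [set u | (forall i, nonneg_continuous (u i)) /\
    forall x, A x -> (1 <= \sum_(i <oo) (u i x)%:E)%E].

Definition riesz_outer (A : set X) : \bar R :=
  ereal_inf [set (\sum_(i <oo) (l (u i))%:E)%E | u in function_cover A].

Lemma nonneg_functional (u : X -> R) : nonneg_continuous u -> (0 <= (l u)%:E)%E.
Proof. by case=> cu u0; rewrite lee_fin l_ge0. Qed.

Lemma riesz_outer_ge0 A : (0 <= riesz_outer A)%E.
Proof.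
apply: le_ereal_inf_tmp => _ [u [cu _] <-]; apply: nneseries_ge0 => i _ _.
exact: nonneg_functional.
Qed.

Lemma nneseries_pairing (a : nat -> nat -> \bar R) (f : nat -> nat * nat) :
  (forall i j, (0 <= a i j)%E) -> set_bij setT setT f ->
  (\sum_(k <oo) a (f k).1 (f k).2 = \sum_(i <oo) \sum_(j <oo) a i j)%E.
Proof.
move=> a0 bf; rewrite nneseries_esumT//.
rewrite -(@reindex_esum _ _ _ setT setT f (fun p => a p.1 p.2))//.
rewrite [RHS]nneseries_esumT//; last by move=> i; exact: nneseries_ge0.
under [RHS]eq_esum => i _ do rewrite nneseries_esumT//.
rewrite esum_esum//; congr esum.
by apply/seteqP; split => // -[].
Qed.

(** A doubly indexed family is a countable family, by a bijection of nat * nat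
with nat. *)
Lemma riesz_outer_le_double (A : set X) (u : nat -> nat -> X -> R) :
  (forall i j, nonneg_continuous (u i j)) ->
  (forall x, A x -> (1 <= \sum_(i <oo) \sum_(j <oo) (u i j x)%:E)%E) ->
  (riesz_outer A <= \sum_(i <oo) \sum_(j <oo) (l (u i j))%:E)%E.
Proof.
move=> cu uA; have /card_esym/ppcard_eqP[f] := card_nat2.
have bf : set_bij setT setT f by exact: bij.
apply: ereal_inf_lbound; exists (fun k => u (f k).1 (f k).2).
  split=> [k|x Ax]; first exact: cu.
  rewrite (nneseries_pairing (a := fun i j => (u i j x)%:E))//; first exact: uA.
  by move=> i j; rewrite lee_fin; exact: (cu i j).2.
rewrite (nneseries_pairing (a := fun i j => (l (u i j))%:E))// => i j.
exact: nonneg_functional.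
Qed.

Lemma riesz_outer0 : riesz_outer set0 = 0%E.
Proof.
apply/eqP; rewrite eq_le riesz_outer_ge0 andbT.
apply: ereal_inf_lbound; exists (fun _ _ => 0).
  split=> [i|x []]; split=> // x; exact: cvg_cst.
by rewrite functional0 eseries0.
Qed.

Lemma riesz_outer_mono : {homo riesz_outer : A B / A `<=` B >-> (A <= B)%E}.
Proof.
move=> A B AB; apply: ereal_inf_le_tmp => _ [u [cu uB] <-].
by exists u => //; split=> // x /AB; exact: uB.
Qed.

Lemma riesz_outer_subadditive : sigma_subadditive riesz_outer.
Proof.
move=> A; have [[i ioo]|] := pselect (exists i, riesz_outer (A i) = +oo%E).
  rewrite (eseries_pinfty _ _ ioo) ?leey// => n _.
  by rewrite -ltNye (lt_le_trans _ (riesz_outer_ge0 _)).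
rewrite -forallNE => Aoo; apply/lee_addgt0Pr => e e0.
rewrite (le_trans _ (epsilon_trick _ _ (ltW e0)))//; last first.
  by move=> n; exact: riesz_outer_ge0.
have [u Pu] : {u : nat -> nat -> X -> R & forall n, function_cover (A n) (u n) /\
    (\sum_(i <oo) (l (u n i))%:E <= riesz_outer (A n) + (e / (2 ^ n.+1)%:R)%:E)%E}.
  apply: (@choice _ _ (fun n v => function_cover (A n) v /\
    (\sum_(i <oo) (l (v i))%:E <=
       riesz_outer (A n) + (e / (2 ^ n.+1)%:R)%:E)%E)) => n.
  have en : 0 < e / (2 ^ n.+1)%:R by rewrite divr_gt0// ltr0n expn_gt0.
  have fA : riesz_outer (A n) \is a fin_num.
    rewrite ge0_fin_numE ?riesz_outer_ge0// lt_neqAle leey andbT.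
    exact/eqP/Aoo.
  have [_ [v vA <-] /ltW vl] := lb_ereal_inf_adherent en fA.
  by exists v.
apply: (@le_trans _ _ (\sum_(i <oo) \sum_(j <oo) (l (u i j))%:E)%E); last first.
  apply: lee_nneseries => [i _ _|i _]; last exact: (Pu i).2.
  by apply: nneseries_ge0 => j _ _; apply/nonneg_functional/(Pu i).1.1.
apply: riesz_outer_le_double => [i j|x [n _ Anx]]; first exact: (Pu i).1.1.
have u0 i j : (0 <= (u i j x)%:E)%E by rewrite lee_fin; exact: ((Pu i).1.1 j).2.
apply: le_trans ((Pu n).1.2 x Anx) _.
have U0 i : (0 <= \sum_(j <oo) (u i j x)%:E)%E by exact: nneseries_ge0.
rewrite (@nneseriesD1 _ (fun i => \sum_(j <oo) (u i j x)%:E)%E n xpredT)//.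
by rewrite leeDl//; exact: nneseries_ge0.
Qed.

HB.instance Definition _ := isOuterMeasure.Build R X riesz_outer
  riesz_outer0 riesz_outer_ge0 riesz_outer_mono riesz_outer_subadditive.

Lemma nonneg_continuousM (u v : X -> R) :
  nonneg_continuous u -> nonneg_continuous v ->
  nonneg_continuous (fun x => u x * v x).
Proof.
move=> [cu u0] [cv v0]; split=> x; last exact: mulr_ge0.
by apply: cvgM; [exact: cu|exact: cv].
Qed.

Lemma nonneg_continuousB (u v : X -> R) : continuous u -> continuous v ->
  (forall x, v x <= u x) -> nonneg_continuous (fun x => u x - v x).
Proof.
move=> cu cv vu; split=> x; last by rewrite subr_ge0.
by apply: cvgB; [exact: cu|exact: cv].
Qed.

Definition truncation (g : X -> R) (n : nat) (x : X) : R :=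
  Num.min 1 (n%:R * g x).

Lemma truncation_continuous (g : X -> R) n : continuous g ->
  continuous (truncation g n).
Proof.
move=> cg x; apply: (@continuous_min _ _ (fun=> 1) (fun x => n%:R * g x)).
  exact: cvg_cst.
by apply: cvgM; [exact: cvg_cst|exact: cg].
Qed.

(** With t_n = min(1, n g), a family (u_i) covering A splits into the functions
u_i (t_{n+1} - t_n), which cover the part of A where g > 0 since t_n reaches 1
there, and the functions u_i (1 - t_n), which cover the rest since t_n vanishes
there. *)
Lemma open_caratheodory (U : set X) : open U -> riesz_outer.-caratheodory U.
Proof.
move=> /open_cozero[g [cg g0] ->] {U}; apply: le_caratheodory_measurable => A.
apply: le_ereal_inf_tmp => _ [u [cu uA] <-].
pose t := truncation g.
have ct n : continuous (t n) by exact: truncation_continuous.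
have t_nd x n : t n x <= t n.+1 x.
  by rewrite /t /truncation le_min !ge_min lexx/= ler_wpM2r ?orbT// ler_nat.
have t0 x : t 0%N x = 0 by rewrite /t /truncation mul0r min_r.
have tge0 n x : 0 <= t n x by rewrite /t /truncation le_min ler01 mulr_ge0.
have t1 n x : t n x <= 1 by rewrite /t /truncation ge_min lexx.
pose v i n x := u i x * (t n.+1 x - t n x).
have cv i n : nonneg_continuous (v i n).
  by apply: nonneg_continuousM => //; exact: nonneg_continuousB.
have cw i n : nonneg_continuous (fun x => u i x * (1 - t n x)).
  apply: nonneg_continuousM => //; apply: nonneg_continuousB => // x.
  exact: cvg_cst.
have v_sum i n x : \sum_(0 <= k < n) v i k x = u i x * t n x.
  by rewrite -mulr_sumr telescope_sumr// t0 subr0.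
have lv0 i n : (0 <= (l (v i n))%:E)%E by exact: nonneg_functional.
have innerU : (riesz_outer (A `&` [set x | (0 < g x)%R]) <=
    \sum_(n <oo) \sum_(i <oo) (l (v i n))%:E)%E.
  apply: (riesz_outer_le_double (u := fun n i => v i n)) => // x [Ax /= gx].
  have v0 i n : (0 <= (v i n x)%:E)%E by rewrite lee_fin; exact: (cv i n).2.
  rewrite nneseries_interchange//; apply: le_trans (uA _ Ax) _.
  apply: lee_nneseries => [i _ _|i _]; first by rewrite lee_fin; exact: (cu i).2.
  (* the truncations reach 1 at x after finitely many steps *)
  pose N := Num.trunc (g x)^-1.
  apply: (@le_trans _ _ (\sum_(0 <= n < N.+1) (v i n x)%:E)%E); last first.
    exact: nneseries_lim_ge.
  rewrite sumEFin v_sum lee_fin /t /truncation min_l ?mulr1//.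
  by rewrite -ler_pdivrMr// mul1r ltW// truncnS_gt.
have outerU n : (riesz_outer (A `&` ~` [set x | (0 < g x)%R]) <=
    \sum_(i <oo) (l (fun x => u i x * (1 - t n x)))%:E)%E.
  apply: ereal_inf_lbound; exists (fun i x => u i x * (1 - t n x)) => //.
  split=> // x [Ax /= /negP]; rewrite -leNgt => gx0.
  have gx : g x = 0 by apply/eqP; rewrite eq_le gx0 g0.
  apply: le_trans (uA _ Ax) _; apply: lee_nneseries => [i _ _|i _].
    by rewrite lee_fin; exact: (cu i).2.
  by rewrite lee_fin /t /truncation gx mulr0 min_r// subr0 mulr1.
have split_sum N : (\sum_(0 <= n < N) \sum_(i <oo) (l (v i n))%:E +
    riesz_outer (A `&` ~` [set x | (0 < g x)%R]) <= \sum_(i <oo) (l (u i))%:E)%E.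
  apply: le_trans (leeD2l _ (outerU N)) _.
  rewrite -nneseries_sum_nat// -nneseriesD//; last 2 first.
  - by move=> i _ _; exact: sume_ge0.
  - by move=> i _ _; exact: nonneg_functional.
  apply: lee_nneseries => [i _ _|i _].
    by apply: adde_ge0; [exact: sume_ge0|exact: nonneg_functional].
  rewrite sumEFin -functional_sum; last by move=> n; exact: (cv i n).1.
  have cs : continuous (fun x => \sum_(0 <= n < N) v i n x).
    by apply: continuous_sum => n; exact: (cv i n).1.
  rewrite -EFinD -lD//; last exact: (cw i N).1.
  have -> // : (fun x => \sum_(0 <= n < N) v i n x + u i x * (1 - t N x)) = u i.
  by apply/funext => x; rewrite v_sum -mulrDr addrC subrK mulr1.
apply: le_trans (leeD2r _ innerU) _.
have [aoo|afin] := eqVneq (riesz_outer (A `&` ~` [set x | (0 < g x)%R])) +oo%E.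
  have := split_sum 0%N; rewrite aoo big_geq// add0e leye_eq => /eqP ->.
  by rewrite leey.
have af : riesz_outer (A `&` ~` [set x | (0 < g x)%R]) \is a fin_num.
  by rewrite ge0_fin_numE ?riesz_outer_ge0// lt_neqAle afin leey.
rewrite -leeBrDr//; apply: lime_le.
  by apply: is_cvg_nneseries => n _ _; exact: nneseries_ge0.
by apply: nearW => N; rewrite leeBrDr.
Qed.

(** As in Dini's theorem: by compactness finitely many of the u_i already sum to
more than 1 - e everywhere. *)
Lemma functional_le_cover (u : nat -> X -> R) : function_cover setT u ->
  ((l (fun=> 1))%:E <= \sum_(i <oo) (l (u i))%:E)%E.
Proof.
move=> [cu u1].
have c1 : continuous (fun _ : X => 1 : R) by move=> x; exact: cvg_cst.
have l1 : 0 <= l (fun=> 1) by apply: l_ge0.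
suff H e : 0 < e -> e < 1 ->
    (((1 - e) * l (fun=> 1))%:E <= \sum_(i <oo) (l (u i))%:E)%E.
  apply/lee_addgt0Pr => d d0; pose e := Num.min (1 / 2) (d / (l (fun=> 1) + 1)).
  have l10 : 0 < l (fun=> 1) + 1 by rewrite ltr_wpDl.
  have e0 : 0 < e by rewrite /e lt_min divr_gt0 //= divr_gt0.
  have e1 : e < 1 by rewrite /e gt_min; apply/orP; left; lra.
  apply: le_trans (leeD2r _ (H _ e0 e1)).
  rewrite -EFinD lee_fin mulrBl mul1r -addrA lerDl addrC subr_ge0.
  apply: (@le_trans _ _ (d / (l (fun=> 1) + 1) * l (fun=> 1))).
    by rewrite ler_wpM2r// /e ge_min lexx orbT.
  by rewrite mulrAC ler_pdivrMr// ler_wpM2l ?ltW// ltrDl.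
move=> e0 e1.
pose O n := [set x | 1 - e < \sum_(0 <= i < n) u i x].
have cs n : continuous (fun x => \sum_(0 <= i < n) u i x).
  by apply: continuous_sum => i; exact: (cu i).1.
have oO n : open (O n).
  apply: (@open_comp _ _ _ [set y | 1 - e < y]); last exact: open_gt.
  by move=> x _; exact: cs.
have O_nd m n x : (m <= n)%N -> O m x -> O n x.
  move=> mn /lt_le_trans; apply; rewrite (big_cat_nat (leq0n m) mn)/= lerDl.
  by apply: sumr_ge0 => i _; exact: (cu i).2.
have cover_n : \forall n \near \oo, [set: X] `<=` O n.
  have /compact_near_coveringP cX := X_compact.
  apply: cX => x _.
  have [n On] : exists n, O n x.
    apply: contrapT => /forallNP nO; have := u1 x I; apply/negP; rewrite -ltNge.
    apply: (@le_lt_trans _ _ (1 - e)%:E); last by rewrite lte_fin; lra.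
    apply: lime_le.
      by apply: is_cvg_nneseries => i _ _; rewrite lee_fin; exact: (cu i).2.
    apply: nearW => n; rewrite sumEFin lee_fin leNgt; apply/negP; exact: nO.
  have On' : nbhs x (O n) by exact: open_nbhs_nbhs.
  near=> y m => /=; apply: (@O_nd n m); last by near: y.
  near: m; exact: nbhs_infty_ge.
have [n On] : exists n, [set: X] `<=` O n.
  by case: cover_n => n _ /(_ n (leqnn n)); exists n.
apply: (@le_trans _ _ (\sum_(0 <= i < n) (l (u i))%:E)%E); last first.
  by apply: nneseries_lim_ge => i _ _; exact: nonneg_functional.
rewrite sumEFin lee_fin -functional_sum; last by move=> i; exact: (cu i).1.
rewrite -lZ//; apply: functional_le => //.
  by move=> x; apply: cvgM; [exact: cvg_cst|exact: c1].
by move=> x; rewrite mulr1 ltW//; exact: On.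
Unshelve. all: by end_near. Qed.

Lemma riesz_outerT : riesz_outer setT = (l (fun=> 1))%:E.
Proof.
have c1 : continuous (fun _ : X => 1 : R) by move=> x; exact: cvg_cst.
have c0 : continuous (fun _ : X => 0 : R) by move=> x; exact: cvg_cst.
apply/eqP; rewrite eq_le; apply/andP; split; last first.
  by apply: le_ereal_inf_tmp => _ [u /functional_le_cover + <-].
have l1 : 0 <= l (fun=> 1) by apply: l_ge0.
pose u n : X -> R := if n is 0%N then fun=> 1 else fun=> 0.
apply: ereal_inf_lbound; exists u.
  split=> [[|i]|x _]; first by split.
    by split.
  rewrite nneseries_recl//=; last by case.
  by rewrite leeDl//; apply: nneseries_ge0 => -[|i] _ _.
rewrite nneseries_recl//= => [|[|i]//]; last by rewrite functional0.
by rewrite eseries_cond eseries0 ?adde0// => -[|i]//= _ _; rewrite functional0.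
Qed.

Definition riesz_measure : set (g_sigma_algebraType (@open X)) -> \bar R :=
  riesz_outer.

Lemma borel_caratheodory (A : set (g_sigma_algebraType (@open X))) :
  measurable A -> riesz_outer.-caratheodory A.
Proof.
apply: smallest_sub; last exact: open_caratheodory.
split; first exact: caratheodory_measurable_set0.
  by move=> B mB; rewrite setTD; exact: caratheodory_measurable_setC.
exact: caratheodory_measurable_bigcup.
Qed.

Lemma riesz_measure_sigma_additive : semi_sigma_additive riesz_measure.
Proof.
move=> F mF tF mUF; apply: caratheodory_measure_sigma_additive => //.
  by move=> i; exact: borel_caratheodory.
exact: borel_caratheodory.
Qed.

HB.instance Definition _ := isMeasure.Build _ _ _ riesz_measure
  riesz_outer0 riesz_outer_ge0 riesz_measure_sigma_additive.

Lemma riesz_outer_le1 (A : set X) (u : X -> R) : nonneg_continuous u ->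
  (forall x, A x -> 1 <= u x) -> (riesz_outer A <= (l u)%:E)%E.
Proof.
move=> cu uA; pose v n : X -> R := if n is 0%N then u else fun=> 0.
apply: ereal_inf_lbound; exists v.
  split=> [[|i]|x Ax]; first exact: cu.
    by split => // x; exact: cvg_cst.
  rewrite nneseries_recl//=; last by move=> [|i] _; rewrite lee_fin// cu.2.
  rewrite (@le_trans _ _ (u x)%:E) ?lee_fin ?uA// leeDl//.
  by apply: nneseries_ge0 => -[|i].
rewrite nneseries_recl//=; last first.
  by move=> [|i] _; [exact: nonneg_functional|rewrite functional0].
by rewrite eseries_cond eseries0 ?adde0// => -[|i]//= _ _; rewrite functional0.
Qed.

(** The inequality suffices, as it will be applied to C + u and to C - u. Cut
the range of u in slices of height d: the slice functions
v_k = min(u, (k+1) d) - min(u, k d) satisfy v_k <= d on {u >= k d} and v_k >= d on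
{u >= (k+1) d}, so the measure of each superlevel set is controlled by l of the
previous slice, at the cost of one term d l(1). *)
Lemma riesz_integral_le (u : X -> R) : nonneg_continuous u ->
  (\int[riesz_measure]_x (u x)%:E <= (l u)%:E)%E.
Proof.
move=> [cu u0]; have [C C0 uC] := continuous_compact_bounded X_compact cu.
have c1 : continuous (fun _ : X => 1 : R) by move=> x; exact: cvg_cst.
have l1 : 0 <= l (fun=> 1) by apply: l_ge0.
apply/lee_addgt0Pr => e e0.
pose d := e / (l (fun=> 1) + 1).
have l10 : 0 < l (fun=> 1) + 1 by rewrite ltr_wpDl.
have d0 : 0 < d by rewrite divr_gt0.
pose M := (Num.trunc (C / d)).+1.
pose m k x := Num.min (u x) (k%:R * d).
have cm k : continuous (m k).
  by move=> x; apply: (@continuous_min _ _ u (fun=> k%:R * d)); [exact: cu|exact: cvg_cst].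
have m_nd k x : m k x <= m k.+1 x.
  rewrite /m le_min !ge_min lexx/= ler_wpM2r ?orbT// ?ltW// ltr_nat//.
pose v k x := m k.+1 x - m k x.
have cv k : nonneg_continuous (v k) by exact: nonneg_continuousB.
have v_sum n x : \sum_(0 <= k < n) v k x = m n x.
  have m0 : m 0%N x = 0 by rewrite /m mul0r min_r.
  by rewrite (@telescope_sumr _ 0 n (fun k => m k x))// m0 subr0.
pose A k := [set x | k%:R * d <= u x].
have mA k : measurable (A k : set (g_sigma_algebraType (@open X))).
  have -> : A k = setT `&` u @^-1` [set` `[k%:R * d, +oo[].
    by rewrite setTI; apply/seteqP; split => x /=; rewrite in_itv/= andbT.
  exact: continuous_borel_measurable.
have vA k x : v k x <= d * \1_(A k) x.
  rewrite indicE; have [/set_mem/= Ax|/negP nA] := boolP (x \in A k).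
    rewrite mulr1 /v /m (min_r Ax) lerBlDr -{2}(mul1r d) -mulrDl -natr1 addrC.
    by rewrite ge_min lexx orbT.
  have {nA} /ltW nA : u x < k%:R * d.
    by rewrite ltNge; apply/negP => h; apply: nA; exact/mem_set.
  rewrite mulr0 /v /m min_l ?min_l ?subrr//; apply: le_trans nA _.
  by apply: (ler_wpM2r (ltW d0)); rewrite ler_nat.
have A_le k : (riesz_measure (A k.+1) <= (d^-1 * l (v k))%:E)%E.
  rewrite -lZ; last exact: (cv k).1.
  apply: riesz_outer_le1.
    split => [|x]; last first.
      by apply: mulr_ge0; [rewrite invr_ge0 ltW|exact: (cv k).2].
    by move=> x; apply: cvgM; [exact: cvg_cst|exact: (cv k).1].
  move=> x Ax; rewrite mulrC ler_pdivlMr// mul1r /v /m (min_r Ax) min_r; last first.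
    by apply: le_trans Ax; apply: (ler_wpM2r (ltW d0)); rewrite ler_nat.
  by rewrite -mulrBl -natr1 addrC addKr mul1r.
have uM x : u x = m M x.
  rewrite /m min_l//; apply: (le_trans (ler_norm _)); apply: (le_trans (uC x)).
  by rewrite -ler_pdivrMr// ltW// truncnS_gt.
apply: (@le_trans _ _ (\int[riesz_measure]_x
    (\sum_(k <- index_iota 0 M) (d%:E * (\1_(A k) x)%:E)))%E).
  apply: ge0_le_integral => //.
  - by move=> x _; rewrite lee_fin.
  - by apply/measurable_EFinP; exact: continuous_borel_measurable.
  - apply: emeasurable_sum => k; apply: measurable_funeM.
    by apply/measurable_EFinP; exact: measurable_indic.
  - move=> x _; rewrite uM -v_sum -sumEFin; apply: lee_sum => k _.
    by rewrite -EFinM lee_fin.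
rewrite ge0_integral_sum//; last 2 first.
- move=> k; apply: measurable_funeM.
  by apply/measurable_EFinP; exact: measurable_indic.
- by move=> k x _; rewrite -EFinM lee_fin mulr_ge0// ltW.
rewrite (eq_bigr (fun k => d%:E * riesz_measure (A k))%E); last first.
  move=> k _; rewrite ge0_integralZl_EFin ?ltW//; last first.
    by apply/measurable_EFinP; exact: measurable_indic.
  by rewrite integral_indic// setIT.
rewrite big_nat_recl//.
apply: (@le_trans _ _ (d%:E * (l (fun=> 1))%:E +
    \sum_(0 <= k < (Num.trunc (C / d))) (l (v k))%:E)%E).
  apply: leeD.
    rewrite lee_pmul2l//; rewrite -riesz_outerT.
    by apply: riesz_outer_mono.
  apply: lee_sum => k _; rewrite -(@lee_pmul2l _ (d^-1)%:E)//; last first.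
    by rewrite lte_fin invr_gt0.
  by rewrite muleA -!EFinM mulVf ?gt_eqF// mul1e; exact: A_le.
rewrite sumEFin -functional_sum; last by move=> k; exact: (cv k).1.
rewrite addeC; apply: leeD; rewrite lee_fin.
  apply: functional_le => //.
    by apply: continuous_sum => k; exact: (cv k).1.
  by move=> x; rewrite v_sum /m ge_min lexx.
by rewrite /d mulrAC ler_pdivrMr// ler_wpM2l ?ltW// ltrDl.
Qed.

Hypothesis l1 : l (fun=> 1) = 1.

Lemma riesz_measureT : riesz_measure setT = 1%E.
Proof. by rewrite [riesz_measure _]riesz_outerT l1. Qed.

HB.instance Definition _ :=
  Measure_isProbability.Build _ _ _ riesz_measure riesz_measureT.

Theorem riesz_representation :
  exists mu : probability (g_sigma_algebraType (@open X)) R,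
    forall u : X -> R, continuous u -> (\int[mu]_x (u x)%:E = (l u)%:E)%E.
Proof.
exists riesz_measure => u cu.
have [C C0 uC] := continuous_compact_bounded X_compact cu.
have c1 c : continuous (fun _ : X => c : R) by move=> x; exact: cvg_cst.
have lC c : l (fun=> c) = c.
  have <- : (fun _ : X => c * 1) = (fun=> c).
    by apply/funext => x; rewrite mulr1.
  by rewrite lZ// l1 mulr1.
have mu1 : riesz_measure setT = 1%E := riesz_measureT.
have iC : riesz_measure.-integrable setT (EFin \o cst C).
  exact: finite_measure_integrable_cst.
have iu : riesz_measure.-integrable setT (EFin \o u).
  exact: continuous_integrable.
have icst : (\int[riesz_measure]_x (C%:E) = C%:E)%E.
  by rewrite integral_cst//= [X in (_ * X)%E]mu1 mule1.
have fu : (\int[riesz_measure]_x (u x)%:E)%E \is a fin_num.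
  exact: integrable_fin_num.
apply/eqP; rewrite eq_le; apply/andP; split.
  have : (\int[riesz_measure]_x ((u x)%:E + C%:E) <= (l u)%:E + C%:E)%E.
    rewrite -EFinD.
    have -> : l u + C = l (fun x => u x + C).
      by rewrite lD// lC.
    apply: riesz_integral_le; split=> x.
      by apply: cvgD; [exact: cu|exact: c1].
    by have := uC x; rewrite ler_norml -lerBlDr sub0r => /andP[].
  by rewrite integralD// icst leeD2rE.
have : (\int[riesz_measure]_x (C%:E - (u x)%:E) <= C%:E - (l u)%:E)%E.
  rewrite -EFinB.
  have -> : C - l u = l (fun x => C - u x).
    have -> : (fun x => C - u x) = (fun x => C + (-1) * u x).
      by apply/funext => x; rewrite mulN1r.
    rewrite lD ?lZ ?lC ?mulN1r// => x.
    by apply: cvgM; [exact: c1|exact: cu].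
  apply: riesz_integral_le; apply: nonneg_continuousB => // x.
  exact: le_trans (ler_norm _) (uC x).
rewrite integralB_EFin// icst leeD2lE// => luI.
by rewrite -leeN2.
Qed.

End riesz.

(** * Two-state operators and their growth *)

Lemma exists_expr_lt {R : realType} (q c : R) : 0 <= q -> q < 1 -> 0 < c ->
  exists n, forall m, (n <= m)%N -> q ^+ m < c.
Proof.
move=> q0 q1 c0.
have /cvgrPdist_lt/(_ c c0)[n _ Hn] : q ^+ n @[n --> \oo] --> 0.
  by apply: cvg_expr; rewrite ger0_norm.
exists n => m nm; have := Hn m nm.
by rewrite /= sub0r normrN ger0_norm// exprn_ge0.
Qed.

Lemma bernoulli_ge {R : realType} (d : R) m : 0 <= d -> d <= 1 ->
  1 - m%:R * d <= (1 - d) ^+ m.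
Proof.
move=> d0 d1; elim: m => [|m IH]; first by rewrite mul0r subr0.
rewrite exprS; apply: le_trans (ler_wpM2l _ IH); last by rewrite subr_ge0.
have : 0 <= m%:R * d * d by rewrite !mulr_ge0.
by rewrite -natr1; lra.
Qed.

Lemma le_of_expr_le {R : realType} (a s c C : R) : 0 < a -> 0 < s -> 0 < c ->
  (forall n, c * a ^+ n <= C * s ^+ n) -> a <= s.
Proof.
move=> a0 s0 c0 H; rewrite leNgt; apply/negP => sa.
have C0 : 0 < C by have := H 0%N; rewrite !mulr1; exact: lt_le_trans.
have q0 : 0 <= s / a by rewrite divr_ge0 ?ltW.
have q1 : s / a < 1 by rewrite ltr_pdivrMr// mul1r.
have cC : 0 < c / C by rewrite divr_gt0.
have [n /(_ n (leqnn n))] := exists_expr_lt q0 q1 cC.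
rewrite expr_div_n ltr_pdivlMr// mulrAC ltr_pdivrMr ?exprn_gt0// => h.
by have := H n; rewrite leNgt mulrC h.
Qed.

(** The dynamics is reduced to a predicate A (the ground level) and three inverse
branches: b1 and b3 act on A, b2 on its complement. *)
Section two_state_operator.
Context {R : realType} {T : Type}.
Variables (A : T -> bool) (b1 b2 b3 : T -> T) (W : T -> R).
Hypothesis A_b1 : forall p, A p -> A (b1 p).
Hypothesis A_b2 : forall p, ~~ A p -> A (b2 p).
Hypothesis A_b3 : forall p, A p -> ~~ A (b3 p).

Definition branch_op (u : T -> R) (p : T) : R :=
  if A p then W (b1 p) * u (b1 p) + W (b3 p) * u (b3 p)
  else W (b2 p) * u (b2 p).

(** The weighted operator acting on functions of a point and of the number k of
steps since the last b2, in which a b2 made before time k0 costs a factor t. It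
bounds the growth of Lipschitz constants under [branch_op] when only these early
uses of b2 contract. *)
Definition memory_op (k0 : nat) (t : R) (u : T -> nat -> R) (p : T) (k : nat) : R :=
  if A p then W (b1 p) * u (b1 p) k.+1 + W (b3 p) * u (b3 p) k.+1
  else (if (k < k0)%N then t else 1) * (W (b2 p) * u (b2 p) 0%N).

Local Notation L := branch_op.
Local Notation K := memory_op.

Lemma branch_opZ c u p : L (fun q => c * u q) p = c * L u p.
Proof. by rewrite /branch_op; case: ifP => _; ring. Qed.

Lemma branch_opD u v p : L (fun q => u q + v q) p = L u p + L v p.
Proof. by rewrite /branch_op; case: ifP => _; ring. Qed.

Lemma iter_branch_op_eigen lam h n : (forall p, L h p = lam * h p) ->
  iter n L h = fun p => lam ^+ n * h p.
Proof.
move=> Lh; elim: n => [|n IH]; first by apply/funext => p; rewrite mul1r.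
by rewrite iterS IH; apply/funext => p; rewrite branch_opZ Lh exprSr mulrA.
Qed.

Lemma memory_opZ k0 t c u p k : K k0 t (fun q j => c * u q j) p k = c * K k0 t u p k.
Proof. by rewrite /memory_op; case: ifP => _; ring. Qed.

Lemma memory_opD k0 t u v p k :
  K k0 t (fun q j => u q j + v q j) p k = K k0 t u p k + K k0 t v p k.
Proof. by rewrite /memory_op; case: ifP => _; ring. Qed.

Lemma memory_op_sum k0 t N (u : nat -> T -> nat -> R) p k :
  K k0 t (fun q j => \sum_(0 <= n < N) u n q j) p k =
  \sum_(0 <= n < N) K k0 t (u n) p k.
Proof.
elim: N => [|N IH].
  rewrite big_geq// /memory_op !big_geq//.
  by case: ifP => _; rewrite !mulr0 ?addr0.
rewrite big_nat_recr//= -IH -memory_opD; congr memory_op.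
by apply/funext => q; apply/funext => j; rewrite big_nat_recr.
Qed.

Variables e E : R.
Hypothesis e_gt0 : 0 < e.
Hypothesis e_le_W : forall p, e <= W p.
Hypothesis W_le_E : forall p, W p <= E.

Let W_gt0 p : 0 < W p. Proof. exact: lt_le_trans e_gt0 (e_le_W p). Qed.
Let W_ge0 p : 0 <= W p. Proof. exact: ltW. Qed.
Variable p0 : T.
Let E_gt0 : 0 < E. Proof. exact: lt_le_trans (W_gt0 p0) (W_le_E p0). Qed.

Lemma branch_op_le u v : (forall p, u p <= v p) -> forall p, L u p <= L v p.
Proof.
move=> uv p; rewrite /branch_op; case: ifP => _; last exact: ler_wpM2l.
by apply: lerD; exact: ler_wpM2l.
Qed.

Lemma branch_op_ge0 u : (forall p, 0 <= u p) -> forall p, 0 <= L u p.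
Proof.
move=> u0 p; rewrite /branch_op; case: ifP => _; last exact: mulr_ge0.
by apply: addr_ge0; exact: mulr_ge0.
Qed.

Lemma iter_branch_opZ n c u : iter n L (fun q => c * u q) =
  fun p => c * iter n L u p.
Proof.
by elim: n => // n /= ->; apply/funext => p; rewrite branch_opZ.
Qed.

Lemma iter_branch_op_le n u v : (forall p, u p <= v p) ->
  forall p, iter n L u p <= iter n L v p.
Proof. by move=> uv; elim: n => //= n; exact: branch_op_le. Qed.

Lemma iter_branch_op_ge0 n u : (forall p, 0 <= u p) ->
  forall p, 0 <= iter n L u p.
Proof. by move=> u0; elim: n => //= n; exact: branch_op_ge0. Qed.

Lemma iter_branch_op_superinvariant n u c : 0 <= c ->
  (forall p, L u p <= c * u p) -> forall p, iter n L u p <= c ^+ n * u p.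
Proof.
move=> c0 Lu; elim: n => [|n IH] p; first by rewrite mul1r.
rewrite iterS; apply: le_trans (branch_op_le IH p) _.
by rewrite branch_opZ exprSr -mulrA ler_wpM2l// exprn_ge0.
Qed.

Lemma iter_branch_op_subinvariant n u c : 0 <= c ->
  (forall p, c * u p <= L u p) -> forall p, c ^+ n * u p <= iter n L u p.
Proof.
move=> c0 Lu; elim: n => [|n IH] p; first by rewrite mul1r.
rewrite iterS; apply: le_trans (branch_op_le IH p).
by rewrite branch_opZ exprSr -mulrA ler_wpM2l// exprn_ge0.
Qed.

Lemma memory_op_le k0 t u v : 0 <= t -> (forall p k, u p k <= v p k) ->
  forall p k, K k0 t u p k <= K k0 t v p k.
Proof.
move=> t0 uv p k; rewrite /memory_op; case: ifP => _; last first.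
  by apply: ler_wpM2l; [case: ifP|exact: ler_wpM2l].
by apply: lerD; exact: ler_wpM2l.
Qed.

Lemma memory_op_ge0 k0 t u : 0 <= t -> (forall p k, 0 <= u p k) ->
  forall p k, 0 <= K k0 t u p k.
Proof.
move=> t0 u0 p k; rewrite /memory_op; case: ifP => _; last first.
  by apply: mulr_ge0; [case: ifP|exact: mulr_ge0].
by apply: addr_ge0; exact: mulr_ge0.
Qed.

Lemma iter_memory_op_ge0 k0 t n u : 0 <= t -> (forall p k, 0 <= u p k) ->
  forall p k, 0 <= iter n (K k0 t) u p k.
Proof. by move=> t0 u0; elim: n => //= n; exact: memory_op_ge0. Qed.

Lemma iter_memory_op_superinvariant k0 t n u c : 0 <= t -> 0 <= c ->
  (forall p k, K k0 t u p k <= c * u p k) ->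
  forall p k, iter n (K k0 t) u p k <= c ^+ n * u p k.
Proof.
move=> t0 c0 Ku; elim: n => [|n IH] p k; first by rewrite mul1r.
rewrite iterS; apply: le_trans (memory_op_le k0 t0 IH p k) _.
by rewrite memory_opZ exprSr -mulrA ler_wpM2l// exprn_ge0.
Qed.

Lemma iter_memory_op_le k0 t n u v : 0 <= t -> (forall p k, u p k <= v p k) ->
  forall p k, iter n (K k0 t) u p k <= iter n (K k0 t) v p k.
Proof. by move=> t0 uv; elim: n => //= n; exact: memory_op_le. Qed.

Lemma iter_memory_opZ k0 t n c u : iter n (K k0 t) (fun q j => c * u q j) =
  fun p k => c * iter n (K k0 t) u p k.
Proof.
by elim: n => // n /= ->; apply/funext => p; apply/funext => k; rewrite memory_opZ.
Qed.

(** A word that uses b2 early j times has weight t^j on the left and t^(j (m+1)) in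
the last term, and t^j <= c + c^-m (t^j)^(m+1) for every c > 0, since either
t^j <= c or (t^j / c)^m >= 1. Along the induction c is divided by t at each early
use of b2. *)
Lemma memory_op_interpolation k0 t m n c p k : 0 < t -> 0 < c ->
  iter n (K k0 t) (fun _ _ => 1) p k <=
    c * iter n L (fun=> 1) p +
    c ^- m * iter n (K k0 (t ^+ m.+1)) (fun _ _ => 1) p k.
Proof.
move=> t0; elim: n c p k => [|n IH] c p k c0 /=.
  rewrite !mulr1; have [c1|c1] := leP 1 c.
    by rewrite (le_trans c1)// lerDl invr_ge0 exprn_ge0 ?ltW.
  rewrite (@le_trans _ _ (c ^- m))// ?lerDr ?(ltW c0)//.
  by rewrite invf_ge1 ?exprn_gt0// exprn_ile1 ?ltW.
rewrite {1 3}/memory_op /branch_op.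
set u := iter n (K k0 t) _; set v := iter n L _; set w := iter n (K _ _) _.
case: ifP => _.
  have H b : W b * u b k.+1 <= c * (W b * v b) + c ^- m * (W b * w b k.+1).
    apply: le_trans (ler_wpM2l (W_ge0 b) (IH c b k.+1 c0)) _.
    by rewrite mulrDr (mulrCA (W b) c) (mulrCA (W b) (c ^- m)).
  by apply: le_trans (lerD (H _) (H _)) _; rewrite le_eqVlt; apply/orP; left; apply/eqP; ring.
have H s b : 0 < s -> s * (W b * u b 0%N) <= c * (W b * v b) +
    c ^- m * (s ^+ m.+1 * (W b * w b 0%N)).
  move=> s0; have cs : 0 < c / s by rewrite divr_gt0.
  apply: le_trans (ler_wpM2l (ltW s0) (ler_wpM2l (W_ge0 b) (IH _ b 0%N cs))) _.
  rewrite le_eqVlt; apply/orP; left; apply/eqP.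
  rewrite -/v -/w exprMn exprS exprVn; field.
  by rewrite !expf_neq0// !gt_eqF.
case: ifP => _; first exact: H.
by have := H 1 (b2 p) ltr01; rewrite expr1n !mul1r.
Qed.

(** The function v equal to y^(k0-k) on A and to y^k0 times the factor of b2
outside A is superinvariant for K with factor E x: before time k0 the branch b1
contributes v / y and b3 a term with a factor t, and from time k0 on the branch b3
contributes only y^k0. *)
Lemma memory_op_growth k0 (x y t : R) : 0 < y -> y <= 1 -> 1 <= x -> 0 < t ->
  t <= 1 -> 1 + y ^+ k0 <= x * y -> 1 + t <= x * y ->
  forall n p k, iter n (K k0 t) (fun _ _ => 1) p k <=
    (E * x) ^+ n / (t * y ^+ k0).
Proof.
move=> y0 y1 x1 t0 t1 xy1 xy2 n p k.
pose tau k := if (k < k0)%N then t else 1.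
pose v p k := if A p then y ^+ (k0 - k) else tau k * y ^+ k0.
have x0 : 0 < x by rewrite (lt_le_trans ltr01).
have tau0 j : 0 < tau j by rewrite /tau; case: ifP.
have tau1 j : tau j <= 1 by rewrite /tau; case: ifP.
have ty j : y ^+ j <= 1 by rewrite exprn_ile1// ltW.
have v1 q j : v q j <= 1.
  by rewrite /v; case: ifP => _ //; rewrite mulr_ile1// ?exprn_ge0 ?ltW.
have v0 q j : t * y ^+ k0 <= v q j.
  rewrite /v; case: ifP => _.
    apply: (@le_trans _ _ (1 * y ^+ k0)); first by rewrite ler_wpM2r// exprn_ge0 ?ltW.
    by rewrite mul1r; apply: ler_wiXn2l; rewrite ?leq_subr// ltW.
  apply: ler_wpM2r; first by rewrite exprn_ge0 ?ltW.
  by rewrite /tau; case: ifP.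
have tyk : 0 < t * y ^+ k0 by rewrite mulr_gt0 ?exprn_gt0.
have Kv q j : K k0 t v q j <= E * x * v q j.
  rewrite /memory_op; case: ifP => Aq; last first.
    rewrite /v A_b2 ?Aq// subn0 -/(tau j).
    have -> : E * x * (tau j * y ^+ k0) = tau j * (E * x * y ^+ k0) by ring.
    apply: ler_wpM2l; first exact: ltW.
    apply: ler_wpM2r; first by rewrite exprn_ge0 ?ltW.
    apply: (@le_trans _ _ (E * 1)); first by rewrite mulr1.
    by rewrite ler_wpM2l// ltW.
  apply: (@le_trans _ _ (E * (v (b1 q) j.+1 + v (b3 q) j.+1))).
    have w0 b i : 0 <= v b i by apply: le_trans (v0 b i); rewrite ltW.
    by rewrite mulrDr; apply: lerD; rewrite ler_wpM2r.
  rewrite -mulrA; apply: ler_wpM2l; first exact: ltW.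
  rewrite /v A_b1// (negbTE (A_b3 Aq)) Aq /tau.
  have [k0j|jk0] := leqP k0 j.
    have -> : (k0 - j.+1 = 0)%N by apply/eqP; rewrite subn_eq0 ltnW.
    have -> : (k0 - j = 0)%N by apply/eqP; rewrite subn_eq0.
    rewrite ltnNge (leq_trans k0j)//= expr0 mul1r mulr1.
    by apply: le_trans xy1 _; rewrite -[leRHS]mulr1 ler_wpM2l// ltW.
  rewrite -(subSS j) subSn// exprS mulrA; have [jk|kj] := ltnP j.+1 k0; last first.
    have -> : (k0 - j.+1 = 0)%N by apply/eqP; rewrite subn_eq0.
    by rewrite expr0 mul1r mulr1.
  apply: (@le_trans _ _ ((1 + t) * y ^+ (k0 - j.+1))).
    rewrite mulrDl mul1r lerD2l; apply: ler_wpM2l; first exact: ltW.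
    by apply: ler_wiXn2l; rewrite ?leq_subr// ltW.
  by rewrite ler_wpM2r// exprn_ge0 ?ltW.
apply: (@le_trans _ _ (iter n (K k0 t) (fun q j => (t * y ^+ k0)^-1 * v q j) p k)).
  apply: iter_memory_op_le => [|q j]; first exact: ltW.
  by rewrite ler_pdivlMl// mulr1.
rewrite iter_memory_opZ mulrC ler_wpM2r ?invr_ge0 ?(ltW tyk)//.
have Ex0 : 0 <= E * x by rewrite mulr_ge0 ?ltW.
apply: le_trans (iter_memory_op_superinvariant n (ltW t0) Ex0 Kv p k) _.
by rewrite -[leRHS]mulr1 ler_wpM2l// exprn_ge0.
Qed.

Definition growth_bound : set R :=
  [set s | 0 < s /\ exists C, forall n p, iter n L (fun=> 1) p <= C * s ^+ n].

Definition growth_rate : R := inf growth_bound.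

Lemma golden_ratio_gt0 : 0 < golden_ratio R.
Proof. by rewrite /golden_ratio divr_gt0// ltr_wpDr// sqrtr_ge0. Qed.

Lemma golden_ratio_sqr : golden_ratio R ^+ 2 = golden_ratio R + 1.
Proof.
have : Num.sqrt (5 : R) ^+ 2 = 5 by rewrite sqr_sqrtr.
by rewrite /golden_ratio; set s := Num.sqrt _ => s2; field: s2.
Qed.

(** The function equal to 1 on A and to golden_ratio^-1 outside is an
eigenfunction of the counting operator of the golden mean shift, hence
subinvariant for L with factor e * golden_ratio. *)
Lemma golden_growth s : growth_bound s -> e * golden_ratio R <= s.
Proof.
move=> [s0 [C HC]]; set w := golden_ratio R.
have w0 : 0 < w by exact: golden_ratio_gt0.
have w1 : 1 <= w.
  by have := golden_ratio_sqr; rewrite -/w expr2 => ww; nra.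
pose v p := if A p then 1 else w^-1.
have ew0 : 0 < e * w by rewrite mulr_gt0.
have v1 p : v p <= 1 by rewrite /v; case: ifP => // _; rewrite invf_le1.
have vw p : w^-1 <= v p by rewrite /v; case: ifP => // _; rewrite invf_le1.
have Lv p : e * w * v p <= L v p.
  rewrite /v /branch_op; case: ifP => Ap.
    rewrite A_b1// (negbTE (A_b3 Ap)) !mulr1.
    have wE : w = 1 + w^-1.
      have w_neq0 : w != 0 by rewrite gt_eqF.
      by apply: (mulfI w_neq0); rewrite -expr2 golden_ratio_sqr mulrDr mulr1 divff.
    rewrite {1}wE mulrDr mulr1; apply: lerD => //.
    by rewrite ler_wpM2r// invr_ge0 ltW.
  by rewrite A_b2 ?Ap// mulr1 mulfK ?gt_eqF.
apply: (@le_of_expr_le _ _ _ w^-1 C) => //; first by rewrite invr_gt0.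
move=> n; apply: le_trans (HC n p0).
apply: (@le_trans _ _ (iter n L v p0)); last exact: iter_branch_op_le.
apply: le_trans (iter_branch_op_subinvariant n (ltW ew0) Lv p0).
by rewrite mulrC ler_wpM2l// exprn_ge0 ?ltW.
Qed.

Lemma growth_bound_crude : growth_bound (2 * E).
Proof.
split; first by rewrite mulr_gt0.
exists 1 => n p; rewrite mul1r -[leRHS]mulr1.
have E20 : 0 <= 2 * E by rewrite mulr_ge0 ?ltW.
apply: (@iter_branch_op_superinvariant n (fun=> 1)) => // q.
rewrite /branch_op !mulr1; have H b := W_le_E b.
case: ifP => _; first by have := H (b1 q); have := H (b3 q); lra.
by have := H (b2 q); have := E_gt0; lra.
Qed.

Lemma growth_rate_ge : e * golden_ratio R <= growth_rate.
Proof.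
apply: lb_le_inf; first by exists (2 * E); exact: growth_bound_crude.
exact: golden_growth.
Qed.

Let growth_has_inf : has_inf growth_bound.
Proof.
split; first by exists (2 * E); exact: growth_bound_crude.
by exists (e * golden_ratio R); exact: golden_growth.
Qed.

Lemma growth_rate_gt0 : 0 < growth_rate.
Proof.
by apply: lt_le_trans growth_rate_ge; rewrite mulr_gt0// golden_ratio_gt0.
Qed.

Lemma growth_rate_le s : growth_bound s -> growth_rate <= s.
Proof. by move=> gs; apply: ge_inf gs; case: growth_has_inf. Qed.

Lemma growth_rate_lt s : growth_rate < s ->
  exists2 C, 0 <= C & forall n p, iter n L (fun=> 1) p <= C * s ^+ n.
Proof.
move=> ls; have [t [t0 [C HC]] ts] := inf_lt growth_has_inf.1 ls.
have C0 : 0 <= C.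
  by have := HC 0%N p0; rewrite mulr1; apply: le_trans.
exists C => // n p; apply: le_trans (HC n p) _; rewrite ler_wpM2l//.
by rewrite lerXn2r ?nnegrE ?ltW// (lt_trans t0).
Qed.

Hypothesis E_lt_growth : E < growth_rate.
Local Notation lam := growth_rate.

(** Interpolation with c = g^n bounds K^n 1 by g^n L^n 1, of order (g lam)^n, plus
g^(-nm) (E x)^n up to a constant; as E < lam, both are exponentially smaller than
lam^n for x close to 1 and g < 1 close to 1. Then U is a partial sum of the
Neumann series of c K / lam, long enough for the remainder to be small, and
the strict inequality beta < 1 comes from the term of index 0, which c K / lam
shifts out of the sum. *)
Lemma exists_memory_supersolution : exists k0, forall t, 0 < t -> t < 1 ->
  exists2 c1, 1 < c1 & forall c, 0 <= c -> c <= c1 ->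
  exists U : T -> nat -> R, exists S b : R,
    [/\ forall p k, 1 <= U p k, forall p k, U p k <= S, 0 <= b < 1 &
      forall p k, c * K k0 t U p k <= b * lam * U p k].
Proof.
have lam0 : 0 < lam := growth_rate_gt0.
have E0 := E_gt0.
(* x > 1 with x E < lam, and y < 1 with x y > 1 *)
pose r := E / lam.
have r0 : 0 < r by rewrite divr_gt0.
have r1 : r < 1 by rewrite ltr_pdivrMr// mul1r.
pose x := (1 + r^-1) / 2.
have ri1 : 1 < r^-1 by rewrite invf_gt1.
have x1 : 1 < x by rewrite /x; lra.
have x0 : 0 < x by lra.
have xr : x * r < 1.
  by rewrite /x mulrAC mulrDl mul1r mulVf ?gt_eqF//; lra.
pose y := (1 + x^-1) / 2.
have xi1 : x^-1 < 1 by rewrite invf_lt1.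
have xi0 : 0 < x^-1 by rewrite invr_gt0.
have y1 : y < 1 by rewrite /y; lra.
have y0 : 0 < y by rewrite /y; lra.
have xy : x * y = (1 + x) / 2.
  by rewrite /y mulrA mulrDr mulr1 divff ?gt_eqF// addrC.
(* x y = 1 + eta, so that y ^ k0 and t ^ m.+1 have to be at most eta *)
pose eta := (x - 1) / 2.
have eta0 : 0 < eta by rewrite /eta; lra.
have [k0 /(_ k0 (leqnn _)) yk] := exists_expr_lt (ltW y0) y1 eta0.
exists k0 => t t0 t1.
have [m /(_ m.+1 (leqnSn _)) tm] := exists_expr_lt (ltW t0) t1 eta0.
have [delta dm dmE] : exists2 delta, 0 < delta &
    delta * m%:R + delta = (1 - x * r) / 2.
  exists ((1 - x * r) / (2 * m.+1%:R)).
    by rewrite divr_gt0 ?subr_gt0// mulr_gt0.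
  have : (m%:R + 1 : R) != 0 by rewrite natr1 pnatr_eq0.
  by rewrite -natr1; set M : R := m%:R => M0; field.
pose g := 1 - delta.
have dm1 : 0 <= delta * m%:R by rewrite mulr_ge0// ltW.
have xr0 : 0 < x * r by rewrite mulr_gt0.
have g1 : g < 1 by rewrite /g ltrBlDr ltrDl.
have g0 : 0 < g by rewrite /g; lra.
have gxr : x * r < g ^+ m.
  apply: lt_le_trans (bernoulli_ge _ (ltW dm) _); last by lra.
  by rewrite mulrC; lra.
(* the larger of the two exponential rates, relative to lam *)
pose G := Num.max g (x * r / g ^+ m).
have G0 : 0 < G by rewrite lt_max g0.
have G1 : G < 1 by rewrite gt_max g1 ltr_pdivrMr ?exprn_gt0// mul1r.
pose c1 := 1 + (1 - G) / 4.
have c11 : 1 < c1 by rewrite /c1; lra.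
(* one factor c1 comes from c, the other from the bound (lam c1)^n on L^n 1 *)
pose q := c1 ^+ 2 * G.
have q0 : 0 <= q by rewrite /q mulr_ge0 ?exprn_ge0 ?ltW//; lra.
have q1 : q < 1 by rewrite /q /c1 expr2; nra.
exists c1 => // c c0 cc1.
have lc1 : lam < lam * c1 by rewrite ltr_pMr.
have [C C0 HC] := growth_rate_lt lc1.
pose C' := (t ^+ m.+1 * y ^+ k0)^-1.
have C'0 : 0 < C' by rewrite invr_gt0 mulr_gt0 ?exprn_gt0.
pose Kn n p k := (c / lam) ^+ n * iter n (K k0 t) (fun _ _ => 1) p k.
have Kn_le n p k : Kn n p k <= (C + C') * q ^+ n.
  have gn0 : 0 < g ^+ n by rewrite exprn_gt0.
  have c10 : 0 <= c1 by lra.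
  apply: (@le_trans _ _ ((c1 / lam) ^+ n * (g ^+ n * (C * (lam * c1) ^+ n) +
      (g ^+ n) ^- m * ((E * x) ^+ n * C')))).
    apply: ler_pM.
    - by rewrite exprn_ge0// divr_ge0 ?(ltW lam0).
    - by apply: iter_memory_op_ge0 => //; exact: ltW.
    - by rewrite lerXn2r ?nnegrE ?divr_ge0 ?(ltW lam0)// ler_wpM2r// invr_ge0 ltW.
    apply: le_trans (memory_op_interpolation _ m _ _ _ t0 gn0) _.
    apply: lerD; first by apply: ler_wpM2l (HC n p); exact: ltW.
    apply: ler_wpM2l; first by rewrite invr_ge0 exprn_ge0 ?ltW.
    apply: memory_op_growth => //.
    - exact: ltW.
    - exact: ltW.
    - by rewrite exprn_gt0.
    - by rewrite exprn_ile1// ltW.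
    - by rewrite xy; rewrite /eta in yk; lra.
    - by rewrite xy; rewrite /eta in tm; lra.
  rewrite mulrDr [leRHS]mulrDl; apply: lerD.
    have -> : (c1 / lam) ^+ n * (g ^+ n * (C * (lam * c1) ^+ n)) =
        C * (c1 ^+ 2 * g) ^+ n.
      have -> : c1 ^+ 2 * g = c1 / lam * g * (lam * c1) by field; rewrite gt_eqF.
      by rewrite !exprMn; ring.
    have c12 : 0 <= c1 ^+ 2 by exact: exprn_ge0.
    apply: ler_wpM2l => //; apply: lerXn2r; rewrite ?nnegrE//.
      by apply: mulr_ge0 => //; exact: ltW.
    by apply: ler_wpM2l => //; rewrite /G le_max lexx.
  have -> : (c1 / lam) ^+ n * ((g ^+ n) ^- m * ((E * x) ^+ n * C')) =
      C' * (c1 * (x * r / g ^+ m)) ^+ n.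
    have -> : (g ^+ n) ^- m = ((g ^+ m)^-1) ^+ n.
      by rewrite exprVn -!exprM mulnC.
    have -> : c1 * (x * r / g ^+ m) = c1 / lam * (E * x) * (g ^+ m)^-1.
      rewrite /r; field.
      by rewrite !gt_eqF// exprn_gt0.
    by rewrite !exprMn; ring.
  apply: ler_wpM2l; first exact: ltW.
  have GG : x * r / g ^+ m <= G by rewrite /G le_max lexx orbT.
  have xg : 0 <= x * r / g ^+ m by rewrite divr_ge0 ?exprn_ge0 ?ltW.
  apply: lerXn2r; rewrite ?nnegrE//; first exact: mulr_ge0.
  apply: (@le_trans _ _ (c1 * G)); first exact: ler_wpM2l.
  rewrite /q expr2 -mulrA; apply: ler_wpM2l => //; rewrite -[leLHS]mul1r.
  by apply: ler_wpM2r; exact: ltW.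
have CC0 : 0 < C + C' by rewrite ltr_wpDl.
have h0 : 0 < (2 * (C + C'))^-1 by rewrite invr_gt0 mulr_gt0.
have [J /(_ J.+1 (leqnSn _)) qJ] := exists_expr_lt q0 q1 h0.
have Kn0 n p k : 0 <= Kn n p k.
  apply: mulr_ge0; first by rewrite exprn_ge0// divr_ge0 ?(ltW lam0).
  by apply: iter_memory_op_ge0 => //; exact: ltW.
pose U p k := 2 * \sum_(0 <= n < J.+1) Kn n p k.
pose S := 2 * (J.+1%:R * (C + C')).
have U1 p k : 2 <= U p k.
  rewrite /U big_nat_recl//= {1}/Kn mul1r mulrDr mulr1 lerDl.
  by rewrite mulr_ge0 ?sumr_ge0.
have US p k : U p k <= S.
  rewrite /U /S ler_wpM2l// mulr_natl -[in leRHS](subn0 J.+1) -sumr_const_nat.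
  apply: ler_sum => n _; apply: le_trans (Kn_le n p k) _.
  rewrite -[leRHS]mulr1; apply: ler_wpM2l; first exact: ltW.
  by rewrite exprn_ile1// ltW.
have S2 : 2 <= S by apply: le_trans (U1 p0 0%N) (US _ _).
exists U, S, (1 - S^-1); split => //.
- by move=> p k; apply: le_trans (U1 p k); rewrite ler1n.
- rewrite subr_ge0 invf_le1 ?gtrBl ?invr_gt0; lra.
move=> p k.
have KU : c * K k0 t U p k = lam * (U p k - 2 + 2 * Kn J.+1 p k).
  have KK n : c * K k0 t (Kn n) p k = lam * Kn n.+1 p k.
    rewrite /Kn memory_opZ iterS exprS; set z := c / lam.
    have -> : c = lam * z by rewrite /z mulrC divfK ?gt_eqF.
    by ring.
  rewrite memory_opZ memory_op_sum mulrCA mulr_sumr.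
  rewrite (eq_bigr (fun n => lam * Kn n.+1 p k)); last by move=> n _; exact: KK.
  rewrite -mulr_sumr mulrCA; congr (_ * _).
  have := @big_nat_recl _ 0 +%R J.+1 0 (fun n => Kn n p k) (leq0n _).
  have Kn_0 : Kn 0%N p k = 1 by rewrite /Kn expr0 mul1r.
  rewrite big_nat_recr//= Kn_0 /U => h.
  by lra.
rewrite KU mulrAC mulrC; apply: ler_wpM2r; first exact: ltW.
have KJ : Kn J.+1 p k <= 1 / 2.
  apply: le_trans (Kn_le _ _ _) _; rewrite mulrC -ler_pdivlMr//.
  by rewrite mul1r -invfM ltW.
have SU : S^-1 * U p k <= 1 by rewrite ler_pdivrMl ?mulr1//; lra.
by rewrite mulrBl mul1r; lra.
Qed.

(** * Lipschitz functions and the approximate eigenfunction *)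

(** P k p stands for a bound on the position of p that holds k steps after the last
b2; it is what makes an early b2 contract the gauge d. *)
Variables (k0 : nat) (t c C0 : R) (U : T -> nat -> R) (S b : R).
Hypothesis c_gt0 : 0 < c.
Hypothesis t_ge0 : 0 <= t.
Hypothesis t_le1 : t <= 1.
Hypothesis C0_ge0 : 0 <= C0.
Hypothesis U_ge1 : forall p k, 1 <= U p k.
Hypothesis U_le : forall p k, U p k <= S.
Hypothesis b_itv : 0 <= b < 1.
Hypothesis KU : forall p k, c * K k0 t U p k <= b * lam * U p k.
Variables (d : T -> T -> R) (P : nat -> T -> Prop).
Hypothesis d_ge0 : forall p q, 0 <= d p q.
Hypothesis P_all : forall p, P k0 p.
Hypothesis P_b1 : forall k p, A p -> P k p -> P k.+1 (b1 p).
Hypothesis P_b3 : forall k p, A p -> P k p -> P k.+1 (b3 p).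
Hypothesis P_b2 : forall p, ~~ A p -> P 0 (b2 p).
Hypothesis d_b1 : forall p q, A p -> A q -> d (b1 p) (b1 q) <= c * d p q.
Hypothesis d_b3 : forall p q, A p -> A q -> d (b3 p) (b3 q) <= c * d p q.
Hypothesis d_b2 : forall k p q, ~~ A p -> ~~ A q -> P k p -> P k q ->
  d (b2 p) (b2 q) <= c * (if (k < k0)%N then t else 1) * d p q.
Hypothesis W_lip : forall p q, A p = A q -> `|W p - W q| <= C0 * d p q.

Let lam_gt0 : 0 < lam. Proof. exact: growth_rate_gt0. Qed.
Let b_ge0 : 0 <= b. Proof. by case/andP: b_itv. Qed.
Let b_lt1 : b < 1. Proof. by case/andP: b_itv. Qed.
Let U_ge0 p k : 0 <= U p k. Proof. exact: le_trans (U_ge1 p k). Qed.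
Let S_ge1 : 1 <= S. Proof. exact: le_trans (U_ge1 p0 0%N) (U_le p0 0%N). Qed.

Lemma weighted_branch_le (u : T -> R) (m B s k : R) p q p' q' : 0 <= B -> 0 <= m ->
  0 <= s -> s <= 1 -> A p' = A q' -> d p' q' <= c * s * d p q -> 0 <= k ->
  `|u p'| <= m -> `|u p' - u q'| <= B * k * d p' q' ->
  `|W p' * u p' - W q' * u q'| <=
    (C0 * c * m + B * (c * (s * (W q' * k)))) * d p q.
Proof.
move=> B0 m0 s0 s1 App dpq k_0 um uB.
have -> : W p' * u p' - W q' * u q' =
    (W p' - W q') * u p' + W q' * (u p' - u q') by ring.
apply: le_trans (ler_normD _ _) _; rewrite !normrM (ger0_norm (W_ge0 q')).
apply: (@le_trans _ _ (C0 * d p' q' * m + W q' * (B * k * d p' q'))).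
  by apply: lerD; [apply: ler_pM => //; exact: W_lip|exact: ler_wpM2l].
apply: (@le_trans _ _ ((C0 * m + B * (W q' * k)) * (c * s * d p q))).
  have -> : C0 * d p' q' * m + W q' * (B * k * d p' q') =
    (C0 * m + B * (W q' * k)) * d p' q' by ring.
  by apply: ler_wpM2l => //; rewrite addr_ge0 ?mulr_ge0.
have -> : (C0 * c * m + B * (c * (s * (W q' * k)))) * d p q =
  C0 * m * (c * 1 * d p q) + B * (W q' * k) * (c * s * d p q) by ring.
rewrite mulrDl lerD2r; apply: ler_wpM2l; first exact: mulr_ge0.
by apply: ler_wpM2r => //; apply: ler_wpM2l => //; exact: ltW.
Qed.

(** The Doeblin-Fortet inequality. The Lipschitz constant is allowed to depend on the
time k since the last b2, and its weight U is reproduced by K with a factor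
b * lam; the variation of W costs a multiple of the sup norm. *)
Lemma branch_op_lipschitz (u : T -> R) (m B : R) : 0 <= B ->
  (forall p, `|u p| <= m) ->
  (forall k p q, A p = A q -> P k p -> P k q ->
    `|u p - u q| <= B * U q k * d p q) ->
  forall k p q, A p = A q -> P k p -> P k q ->
    `|L u p - L u q| <= (2 * C0 * c * m + B * (b * lam * U q k)) * d p q.
Proof.
move=> B0 um uB k p q App Pp Pq.
have m0 : 0 <= m by apply: le_trans (normr_ge0 _) (um p0).
apply: (@le_trans _ _ ((2 * C0 * c * m + B * (c * K k0 t U q k)) * d p q)); last first.
  by apply: ler_wpM2r => //; rewrite lerD2l ler_wpM2l.
rewrite /memory_op /branch_op -App; case: ifPn => Ap.
  have Aq : A q by rewrite -App.
  have A13 : A (b1 p) = A (b1 q) by rewrite !A_b1.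
  have A33 : A (b3 p) = A (b3 q) by rewrite (negbTE (A_b3 Ap)) (negbTE (A_b3 Aq)).
  have H1 := @weighted_branch_le u m B 1 (U (b1 q) k.+1) p q (b1 p) (b1 q) B0 m0
    ler01 (lexx _) A13.
  have H3 := @weighted_branch_le u m B 1 (U (b3 q) k.+1) p q (b3 p) (b3 q) B0 m0
    ler01 (lexx _) A33.
  rewrite !mulr1 !mul1r in H1 H3.
  have {}H1 := H1 (d_b1 Ap Aq) (U_ge0 _ _) (um _)
    (uB _ _ _ A13 (P_b1 Ap Pp) (P_b1 Aq Pq)).
  have {}H3 := H3 (d_b3 Ap Aq) (U_ge0 _ _) (um _)
    (uB _ _ _ A33 (P_b3 Ap Pp) (P_b3 Aq Pq)).
  rewrite opprD addrACA; apply: le_trans (ler_normD _ _) _.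
  by apply: le_trans (lerD H1 H3) _; rewrite le_eqVlt; apply/orP; left; apply/eqP; ring.
have Aq : ~~ A q by rewrite -App.
have A22 : A (b2 p) = A (b2 q) by rewrite !A_b2.
set s := if _ then _ else _.
have s0 : 0 <= s by rewrite /s; case: ifP.
have s1 : s <= 1 by rewrite /s; case: ifP.
have := @weighted_branch_le u m B s (U (b2 q) 0%N) p q (b2 p) (b2 q) B0 m0 s0 s1
  A22 (d_b2 Ap Aq Pp Pq) (U_ge0 _ _) (um _) (uB _ _ _ A22 (P_b2 Ap) (P_b2 Aq)).
move=> /le_trans; apply; apply: ler_wpM2r => //; rewrite lerD2r.
have : 0 <= C0 * c * m by rewrite !mulr_ge0 ?(ltW c_gt0).
lra.
Qed.

(** The sum of s^-n L^n 1 over n <= N, in the form r_{N+1} = 1 + s^-1 L r_N that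
suits induction on Lipschitz constants. *)
Fixpoint resolvent_sum (s : R) (N : nat) : T -> R :=
  if N is N'.+1 then fun p => 1 + s^-1 * L (resolvent_sum s N') p else fun=> 1.

Lemma resolvent_sumS s N : 0 < s -> forall p,
  resolvent_sum s N.+1 p =
  resolvent_sum s N p + s ^- N.+1 * iter N.+1 L (fun=> 1) p.
Proof.
move=> s0; elim: N => [|N IH] p; first by rewrite /= expr1.
transitivity (1 + s^-1 * L (resolvent_sum s N.+1) p) => //.
have -> : L (resolvent_sum s N.+1) p =
    L (resolvent_sum s N) p + s ^- N.+1 * iter N.+2 L (fun=> 1) p.
  rewrite [iter N.+2 _ _]iterS -branch_opZ -branch_opD.
  by congr branch_op; apply/funext.
by rewrite mulrDr addrA mulrA -invfM -exprS.
Qed.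

Lemma resolvent_sum_ge1 s N : 0 < s -> forall p, 1 <= resolvent_sum s N p.
Proof.
move=> s0; elim: N => [|N IH] p //=; rewrite lerDl.
apply: mulr_ge0; first by rewrite invr_ge0 ltW.
by apply: branch_op_ge0 => q; exact: le_trans (IH q).
Qed.

Lemma resolvent_sum_mono s N M : 0 < s -> (N <= M)%N -> forall p,
  resolvent_sum s N p <= resolvent_sum s M p.
Proof.
move=> s0 /subnK <- p; elim: (M - N)%N => [//|k IH].
apply: le_trans IH _; rewrite addSn resolvent_sumS// lerDl.
rewrite mulr_ge0 ?invr_ge0 ?exprn_ge0 ?(ltW s0)//.
by apply: iter_branch_op_ge0 => q; exact: ler01.
Qed.

Lemma resolvent_sum_bounded s N : 0 < s -> exists m, forall p, resolvent_sum s N p <= m.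
Proof.
move=> s0; elim: N => [|N [m Hm]]; first by exists 1.
have m0 : 0 <= m by apply: le_trans (Hm p0); exact: le_trans (resolvent_sum_ge1 N s0 p0).
exists (1 + s^-1 * (2 * E * m)) => p /=; rewrite lerD2l ler_wpM2l ?invr_ge0 ?(ltW s0)//.
have H x : W x * resolvent_sum s N x <= E * m.
  by apply: ler_pM => //; exact: le_trans (resolvent_sum_ge1 N s0 x).
rewrite /branch_op; case: ifP => _.
  by have := H (b1 p); have := H (b3 p); lra.
have : 0 <= E * m by apply: mulr_ge0 => //; exact: ltW.
by have := H (b2 p); lra.
Qed.

(** B solves 2 C0 c m + B b lam = B lam, the fixed point of the Doeblin-Fortet
recursion; as the sums increase with N, one bound m serves at all stages. *)
Lemma resolvent_sum_lipschitz s N m : lam <= s ->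
  (forall p, resolvent_sum s N p <= m) ->
  forall k p q, A p = A q -> P k p -> P k q ->
  `|resolvent_sum s N p - resolvent_sum s N q| <=
    2 * C0 * c * m / (lam * (1 - b)) * U q k * d p q.
Proof.
move=> ls Hm; have s0 : 0 < s := lt_le_trans lam_gt0 ls.
have m0 : 0 <= m by apply: le_trans (Hm p0); exact: le_trans (resolvent_sum_ge1 N s0 p0).
set B := _ / _.
have c0 : 0 <= c by exact: ltW.
have b10 : 0 < 1 - b by rewrite subr_gt0.
have B0 : 0 <= B by rewrite /B divr_ge0 ?mulr_ge0 ?(ltW lam_gt0) ?(ltW b10).
have BE : 2 * C0 * c * m = B * (lam * (1 - b)).
  by rewrite /B divfK// gt_eqF// mulr_gt0.
have H n : (n <= N)%N -> forall k p q, A p = A q -> P k p -> P k q ->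
    `|resolvent_sum s n p - resolvent_sum s n q| <= B * U q k * d p q.
  elim: n => [|n IH] nN k p q App Pp Pq /=.
    by rewrite subrr normr0; apply: mulr_ge0 => //; exact: mulr_ge0.
  have -> : 1 + s^-1 * L (resolvent_sum s n) p - (1 + s^-1 * L (resolvent_sum s n) q)
    = s^-1 * (L (resolvent_sum s n) p - L (resolvent_sum s n) q) by ring.
  rewrite normrM ger0_norm ?invr_ge0 ?(ltW s0)//.
  rewrite ler_pdivrMl//.
  have um x : `|resolvent_sum s n x| <= m.
    rewrite ger0_norm; last exact: le_trans (resolvent_sum_ge1 n s0 x).
    exact: le_trans (resolvent_sum_mono s0 (ltnW nN) x) (Hm x).
  apply: le_trans (branch_op_lipschitz B0 um (IH (ltnW nN)) App Pp Pq) _.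
  rewrite [leRHS]mulrA; apply: ler_wpM2r => //; rewrite BE.
  have BU : B * (lam * (1 - b)) <= B * (lam * (1 - b)) * U q k.
    rewrite -[leLHS]mulr1; apply: ler_wpM2l => //.
    by apply: mulr_ge0 => //; apply: mulr_ge0; exact: ltW.
  apply: le_trans (lerD BU (lexx _)) _.
  have -> : B * (lam * (1 - b)) * U q k + B * (b * lam * U q k) = lam * (B * U q k).
    by ring.
  by apply: ler_wpM2r => //; exact: mulr_ge0.
exact: H.
Qed.

Definition lipschitz_bound : R := 2 * C0 * c * S / (lam * (1 - b)).

Lemma lipschitz_bound_ge0 : 0 <= lipschitz_bound.
Proof.
have b10 : 0 < 1 - b by rewrite subr_gt0.
have S0 : 0 <= S := le_trans ler01 S_ge1.
by rewrite /lipschitz_bound divr_ge0 ?mulr_ge0 ?(ltW lam_gt0) ?(ltW c_gt0) ?(ltW b10).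
Qed.

(** If all sums stayed below M, then L r_N <= s (1 - 1/M) r_{N+1}, so that L^n 1 would
grow at most like (s (1 - 1/M))^n, more slowly than lam^n. *)
Lemma resolvent_sum_unbounded s M : 1 < M -> lam < s -> s * (1 - M^-1) < lam ->
  exists N p, M < resolvent_sum s N p.
Proof.
move=> M1 ls sM; apply: contrapT => nM.
have s0 : 0 < s := lt_trans lam_gt0 ls.
have M0 : 0 < M := lt_trans ltr01 M1.
have rM N p : resolvent_sum s N p <= M.
  by rewrite leNgt; apply/negP => h; apply: nM; exists N, p.
pose s' := s * (1 - M^-1).
have s'0 : 0 < s' by rewrite mulr_gt0// subr_gt0 invf_lt1.
have Lr N p : L (resolvent_sum s N) p <= s' * resolvent_sum s N.+1 p.
  have -> : L (resolvent_sum s N) p = s * (resolvent_sum s N.+1 p - 1).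
    by rewrite /= addrC addKr mulVKf ?gt_eqF.
  rewrite /s' -mulrA ler_wpM2l ?(ltW s0)// mulrBl mul1r lerB//.
  by rewrite ler_pdivrMl// mulr1.
have : growth_bound s'.
  split=> //; exists M => n p.
  apply: (@le_trans _ _ (s' ^+ n * resolvent_sum s n p)); last first.
    by rewrite mulrC ler_wpM2r ?exprn_ge0 ?(ltW s'0).
  elim: n p => [|n IH] p; first by rewrite mul1r.
  rewrite iterS; apply: le_trans (branch_op_le IH p) _.
  rewrite branch_opZ exprSr -mulrA ler_wpM2l ?exprn_ge0 ?(ltW s'0)//.
by move=> /growth_rate_le; rewrite leNgt sM.
Qed.

(** With r = r_N one has L r - lam r = (s - lam) r + s (x - 1), where
x = s^-(N+1) L^(N+1) 1 is at most 1 for N large. Dividing by m = sup r makes the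
first term at most s - lam and the second at most s / m, and m is large. *)
Lemma approximate_eigenfunction eps : 0 < eps -> exists g : T -> R,
  [/\ forall p, 0 <= g p <= 1, exists p, 1 / 2 <= g p,
    forall p q, A p = A q -> `|g p - g q| <= lipschitz_bound * d p q &
    forall p, `|L g p - lam * g p| <= eps].
Proof.
move=> eps0.
pose M := 2 * (lam + 1) / eps + 1.
have M1 : 1 < M by rewrite ltrDr divr_gt0// mulr_gt0// ltr_wpDr// addr_gt0.
have M0 : 0 < M := lt_trans ltr01 M1.
pose del := Num.min 1 (Num.min (eps / 2) (lam / (2 * M))).
have del0 : 0 < del.
  by rewrite !lt_min ltr01 divr_gt0//= divr_gt0// mulr_gt0.
have del1 : del <= 1 by rewrite ge_min lexx.
have del2 : del <= eps / 2 by rewrite !ge_min lexx orbT.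
have del3 : del * (2 * M) <= lam.
  by rewrite -ler_pdivlMr ?mulr_gt0// !ge_min lexx !orbT.
pose s := lam + del.
have ls : lam < s by rewrite ltrDl.
have s0 : 0 < s := lt_trans lam_gt0 ls.
have sM : s * (1 - M^-1) < lam.
  rewrite -(ltr_pM2r M0) -mulrA mulrBl mul1r mulVf ?gt_eqF// /s.
  have : 0 < lam * M by rewrite mulr_gt0.
  have : 0 < lam := lam_gt0.
  by lra.
have sMe : s / M <= eps / 2.
  rewrite ler_pdivrMr// /M mulrDr mulr1.
  have -> : eps / 2 * (2 * (lam + 1) / eps) = lam + 1 by field; rewrite gt_eqF.
  by rewrite /s; lra.
have [N1 [p1 Np1]] := resolvent_sum_unbounded M1 ls sM.
have l2 : lam < lam + del / 2 by rewrite ltrDl divr_gt0.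
have [C C_ge0 HC] := growth_rate_lt l2.
have q0 : 0 <= (lam + del / 2) / s by rewrite divr_ge0 ?(ltW s0)// (ltW (lt_trans lam_gt0 l2)).
have q1 : (lam + del / 2) / s < 1 by rewrite ltr_pdivrMr// mul1r /s; lra.
have C1 : 0 < (C + 1)^-1 by rewrite invr_gt0 ltr_wpDl.
have [N2 HN2] := exists_expr_lt q0 q1 C1.
pose N := maxn N1 N2; pose r := resolvent_sum s N.
have r1 p : 1 <= r p by exact: resolvent_sum_ge1.
have tail p : s ^- N.+1 * iter N.+1 L (fun=> 1) p <= 1.
  apply: (@le_trans _ _ (s ^- N.+1 * (C * (lam + del / 2) ^+ N.+1))).
    by apply: ler_wpM2l (HC _ _); rewrite invr_ge0 exprn_ge0 ?(ltW s0).
  have -> : s ^- N.+1 * (C * (lam + del / 2) ^+ N.+1) =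
      C * ((lam + del / 2) / s) ^+ N.+1 by rewrite exprMn exprVn; ring.
  have /HN2/ltW : (N2 <= N.+1)%N by rewrite (leq_trans (leq_maxr N1 N2)).
  move=> /(ler_wpM2l C_ge0)/le_trans; apply.
  by rewrite ler_pdivrMr ?ltr_wpDl// mul1r lerDl.
have tail0 p : 0 <= s ^- N.+1 * iter N.+1 L (fun=> 1) p.
  rewrite mulr_ge0 ?invr_ge0 ?exprn_ge0 ?(ltW s0)//.
  by apply: iter_branch_op_ge0 => q; exact: ler01.
have [m0 Hm0] := resolvent_sum_bounded N s0.
have r_sup : has_sup (range r).
  by split; [exists (r p1), p1|exists m0 => _ [p _ <-]; exact: Hm0].
pose m := sup (range r).
have rm p : r p <= m by apply: sup_upper_bound => //; exists p.
have Mm : M < m.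
  apply: lt_le_trans Np1 (le_trans _ (rm p1)).
  by apply: resolvent_sum_mono => //; exact: leq_maxl.
have m_gt0 : 0 < m := lt_trans M0 Mm.
have m20 : 0 < m / 2 by rewrite divr_gt0.
have [_ [p2 _ <-] rp2] := sup_adherent m20 r_sup.
exists (fun p => m^-1 * r p); split.
- move=> p; rewrite mulr_ge0 ?invr_ge0 ?(ltW m_gt0)//=; last first.
    exact: le_trans (r1 p).
  by rewrite ler_pdivrMl// mulr1.
- exists p2; rewrite ler_pdivlMl//; apply/ltW; move: rp2; rewrite -/m.
  by apply: le_lt_trans; lra.
- move=> p q App; rewrite -mulrBr normrM ger0_norm ?invr_ge0 ?(ltW m_gt0)//.
  rewrite ler_pdivrMl//.
  apply: le_trans (resolvent_sum_lipschitz (ltW ls) rm App (P_all p) (P_all q)) _.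
  have -> : m * (lipschitz_bound * d p q) =
    2 * C0 * c * m / (lam * (1 - b)) * S * d p q by rewrite /lipschitz_bound; ring.
  apply: ler_wpM2r => //; apply: ler_wpM2l => //.
  have b10 : 0 < 1 - b by rewrite subr_gt0.
  by rewrite divr_ge0 ?mulr_ge0 ?(ltW lam_gt0) ?(ltW c_gt0) ?(ltW b10) ?(ltW m_gt0).
move=> p; rewrite branch_opZ.
have -> : L r p = s * (resolvent_sum s N.+1 p - 1).
  by rewrite /= addrC addKr mulVKf ?gt_eqF.
rewrite resolvent_sumS// -/r.
set x := _ * iter _ _ _ _; have := tail p; have := tail0 p; rewrite -/x => x0 x1.
have -> : m^-1 * (s * (r p + x - 1)) - lam * (m^-1 * r p) =
  del * (m^-1 * r p) + s / m * (x - 1) by rewrite /s; ring.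
apply: le_trans (ler_normD _ _) _.
rewrite [eps]splitr; apply: lerD.
  rewrite ger0_norm; last first.
    by rewrite !mulr_ge0 ?invr_ge0 ?(ltW m_gt0) ?(ltW del0)// (le_trans ler01).
  apply: le_trans del2; rewrite -[leRHS]mulr1; apply: ler_wpM2l; first exact: ltW.
  by rewrite ler_pdivrMl// mulr1.
rewrite normrM ger0_norm ?divr_ge0 ?(ltW s0) ?(ltW m_gt0)//.
apply: le_trans sMe; rewrite -[leRHS]mulr1; apply: ler_pM => //.
- by rewrite divr_ge0 ?(ltW s0) ?(ltW m_gt0).
- by rewrite ler_wpM2l ?(ltW s0)// lef_pV2 ?posrE// ltW.
- by rewrite ler0_norm; lra.
Qed.

(** Up to a factor (e/E)^n the weights of corresponding branches at p and q agree,
and the error made in comparing h at the endpoints is at most C (b lam)^n U d.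
Since L^n h p = lam^n h p and b < 1, this error is beaten for n large, whatever
the size of (e/E)^n. *)
Lemma eigenfunction_positivity (h : T -> R) (C : R) :
  (forall p, 0 <= h p) -> (forall p, L h p = lam * h p) -> 0 <= C ->
  (forall p q, A p = A q -> `|h p - h q| <= C * d p q) ->
  forall p q, A p = A q -> 0 < h p -> 0 < h q.
Proof.
move=> h0 Lh Cge0 hC.
pose kap := e / E.
have kap0 : 0 < kap by rewrite divr_gt0.
have WW p q : kap * W p <= W q.
  apply: le_trans (e_le_W q); rewrite /kap mulrAC ler_pdivrMr//.
  by rewrite ler_wpM2l ?(ltW e_gt0).
have bl0 : 0 <= b * lam by rewrite mulr_ge0 ?(ltW lam_gt0).
have main n : forall k p q, A p = A q -> P k p -> P k q ->
    kap ^+ n * (iter n L h p - C * (b * lam) ^+ n * U p k * d p q) <= iter n L h q.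
  elim: n => [|n IH] k p q App Pp Pq.
    rewrite !mul1r mulr1 /= lerBlDr -lerBlDl.
    apply: le_trans (ler_norm _) _; apply: le_trans (hC _ _ App) _.
    by rewrite mulrAC -[leLHS]mulr1; apply: ler_wpM2l => //; exact: mulr_ge0.
  rewrite !iterS; set F := C * (b * lam) ^+ n.
  have F0 : 0 <= F by rewrite mulr_ge0 ?exprn_ge0.
  set v := iter n L h.
  have v0 x : 0 <= v x by apply: iter_branch_op_ge0.
  have branch p' q' s k' : A p' = A q' -> P k' p' -> P k' q' ->
      d p' q' <= c * s * d p q ->
      kap ^+ n.+1 * (W p' * v p' - F * (c * (s * (W p' * U p' k'))) * d p q) <=
      W q' * v q'.
    move=> App' Pp' Pq' dpq; have := IH k' p' q' App' Pp' Pq'; rewrite -/F -/v => H.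
    rewrite exprS -mulrA.
    have -> : W p' * v p' - F * (c * (s * (W p' * U p' k'))) * d p q =
      W p' * (v p' - F * U p' k' * (c * s * d p q)) by ring.
    rewrite mulrCA mulrA [X in X <= _](_ : _ =
      kap * W p' * (kap ^+ n * (v p' - F * U p' k' * (c * s * d p q)))); last by ring.
    have H' : kap ^+ n * (v p' - F * U p' k' * (c * s * d p q)) <= v q'.
      apply: le_trans H; apply: ler_wpM2l; first by rewrite exprn_ge0 ?(ltW kap0).
      by rewrite lerD2l lerN2; apply: ler_wpM2l => //; rewrite mulr_ge0.
    apply: le_trans (ler_wpM2l _ H') _; first by rewrite mulr_ge0 ?(ltW kap0).
    by apply: ler_wpM2r.
  apply: (@le_trans _ _ (kap ^+ n.+1 * (L v p - F * (c * K k0 t U p k) * d p q))).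
    apply: ler_wpM2l; first by rewrite exprn_ge0 ?(ltW kap0).
    rewrite lerD2l lerN2; apply: ler_wpM2r => //.
    have -> : C * (b * lam) ^+ n.+1 * U p k = F * (b * lam * U p k).
      by rewrite /F exprSr; ring.
    exact: ler_wpM2l.
  rewrite /memory_op /branch_op -App; case: ifPn => Ap.
    have Aq : A q by rewrite -App.
    have A13 : A (b1 p) = A (b1 q) by rewrite !A_b1.
    have A33 : A (b3 p) = A (b3 q) by rewrite (negbTE (A_b3 Ap)) (negbTE (A_b3 Aq)).
    have H1 := branch _ _ 1 _ A13 (P_b1 Ap Pp) (P_b1 Aq Pq).
    have H3 := branch _ _ 1 _ A33 (P_b3 Ap Pp) (P_b3 Aq Pq).
    rewrite !mulr1 !mul1r in H1 H3.
    apply: le_trans (lerD (H1 (d_b1 Ap Aq)) (H3 (d_b3 Ap Aq))).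
    by rewrite le_eqVlt; apply/orP; left; apply/eqP; ring.
  have Aq : ~~ A q by rewrite -App.
  have A22 : A (b2 p) = A (b2 q) by rewrite !A_b2.
  exact: (branch _ _ _ _ A22 (P_b2 Ap) (P_b2 Aq) (d_b2 Ap Aq Pp Pq)).
move=> p q App hp.
pose X := C * S * d p q + 1.
have X0 : 0 < X by rewrite ltr_wpDl// !mulr_ge0// (le_trans ler01).
have [n /(_ n (leqnn _)) bn] := exists_expr_lt b_ge0 b_lt1 (divr_gt0 hp X0).
have := main n k0 p q App (P_all p) (P_all q).
rewrite (iter_branch_op_eigen n Lh) [(b * lam) ^+ n]exprMn => main_n.
have ln : 0 < lam ^+ n by rewrite exprn_gt0.
suff H : 0 < lam ^+ n * h p - C * (b ^+ n * lam ^+ n) * U p k0 * d p q.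
  rewrite -(pmulr_rgt0 _ ln); apply: lt_le_trans main_n.
  by apply: mulr_gt0; [exact: exprn_gt0|exact: H].
have -> : lam ^+ n * h p - C * (b ^+ n * lam ^+ n) * U p k0 * d p q =
  lam ^+ n * (h p - b ^+ n * (C * U p k0 * d p q)) by ring.
rewrite mulr_gt0// subr_gt0; move: bn; rewrite ltr_pdivlMr//; apply: le_lt_trans.
apply: ler_wpM2l; first exact: exprn_ge0.
rewrite /X -[leLHS]addr0; apply: lerD => //; apply: ler_wpM2r => //.
exact: ler_wpM2l.
Qed.

End two_state_operator.

(** * Limits along an ultrafilter *)

Section ultrafilter_limits.
Context {R : realType}.

Lemma fmap_ultra {I X : Type} (F : set_system I) (x : I -> X) :
  UltraFilter F -> UltraFilter (x @ F).
Proof.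
move=> FU; split => [|G GF FG]; first exact: fmap_proper_filter.
apply/seteqP; split => // A GA.
have [//|FnA] := in_ultra_setVsetC (x @^-1` A) FU.
have GnA : G (~` A) by apply: FG.
by have [] := filter_not_empty G; rewrite -(setICr A); exact: filterI.
Qed.

Lemma bounded_ultra_cvg {I : Type} (F : set_system I) (x : I -> R) (M : R) :
  UltraFilter F -> (forall i, `|x i| <= M) -> cvg (x @ F).
Proof.
move=> FU xM; have xU := fmap_ultra x FU.
have := @segment_compact R (- M) M; rewrite compact_ultra => /(_ _ xU).
case=> [|l [_ xl]]; last by apply/cvg_ex; exists l.
by apply: (@filterE _ F) => i; rewrite /= in_itv/= -ler_norml.
Qed.

Definition free_ultrafilter : set_system nat :=
  projT1 (cid (ultraFilterLemma (eventually_filter : ProperFilter eventually))).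

Lemma free_ultrafilter_ultra : UltraFilter free_ultrafilter.
Proof. by rewrite /free_ultrafilter; case: cid => ? []. Qed.

Lemma eventually_free_ultrafilter : eventually `<=` free_ultrafilter.
Proof. by rewrite /free_ultrafilter; case: cid => ? []. Qed.

Lemma cvgn_free (X : topologicalType) (u : nat -> X) (l : X) :
  u @ \oo --> l -> u @ free_ultrafilter --> l.
Proof. by move=> ul A /ul; exact: eventually_free_ultrafilter. Qed.

End ultrafilter_limits.
#[local] Existing Instance free_ultrafilter_ultra.

(** A bounded sequence of reals has a limit along an ultrafilter, so pointwise
limits of functions exist with no extraction of a subsequence, and the Lipschitz
bound passes to the limit. *)
Section eigenfunction_limit.
Context {R : realType} {T : topologicalType}.
Hypothesis T_compact : compact [set: T].
Variables (A : T -> bool) (b1 b2 b3 : T -> T) (W : T -> R) (lam C : R).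
Local Notation L := (branch_op A b1 b2 b3 W).
Variable d : T -> T -> R.
Hypothesis C_ge0 : 0 <= C.
Hypothesis d_near : forall p (eps : R), 0 < eps ->
  \forall q \near p, A q = A p /\ d q p < eps.
Hypothesis approximate : forall eps : R, 0 < eps -> exists g : T -> R,
  [/\ forall p, 0 <= g p <= 1, exists p, 1 / 2 <= g p,
    forall p q, A p = A q -> `|g p - g q| <= C * d p q &
    forall p, `|L g p - lam * g p| <= eps].

Local Notation F := free_ultrafilter.

Lemma eigenfunction_of_approximate : exists h : T -> R,
  [/\ forall p, 0 <= h p, exists p, 0 < h p,
    forall p q, A p = A q -> `|h p - h q| <= C * d p q &
    forall p, L h p = lam * h p].
Proof.
have [g Hg] : {g : nat -> T -> R & forall n,
  [/\ forall p, 0 <= g n p <= 1, exists p, 1 / 2 <= g n p,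
    forall p q, A p = A q -> `|g n p - g n q| <= C * d p q &
    forall p, `|L (g n) p - lam * g n p| <= n.+1%:R^-1]}.
  apply: (@choice _ _ (fun n g => [/\ forall p, 0 <= g p <= 1, exists p, 1 / 2 <= g p,
    forall p q, A p = A q -> `|g p - g q| <= C * d p q &
    forall p, `|L g p - lam * g p| <= n.+1%:R^-1])) => n.
  by apply: approximate; rewrite invr_gt0.
have g_cvg p : cvg (g n p @[n --> F]).
  apply: (@bounded_ultra_cvg _ _ _ _ 1 free_ultrafilter_ultra) => n.
  by have [/(_ p)/andP[g0 g1] _ _ _] := Hg n; rewrite ger0_norm.
pose h p : R := lim (g n p @[n --> F]).
have gh p : g n p @[n --> F] --> h p by exact: g_cvg.
have Lgh p : L (g n) p @[n --> F] --> L h p.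
  rewrite /branch_op; case: (A p).
    by apply: cvgD; apply: cvgM => //; exact: cvg_cst.
  by apply: cvgM => //; exact: cvg_cst.
exists h; split.
- move=> p; apply: (cvgr_to_ge (gh p)).
  by apply: nearW => n; have [/(_ p)/andP[]] := Hg n.
- have [p Hp] : {p : nat -> T & forall n, 1 / 2 <= g n (p n)}.
    apply: (@choice _ _ (fun n p => 1 / 2 <= g n p)) => n.
    by have [] := Hg n.
  (* the points where g n is at least 1/2 have a limit q, near which the Lipschitz
     bound keeps g n above 1/4 *)
  have pU := fmap_ultra p free_ultrafilter_ultra.
  move: T_compact; rewrite compact_ultra => /(_ _ pU (filterE _ (fun=> I))).
  move=> [q [_ pq]]; exists q.
  have C4 : 0 < (4 * (C + 1))^-1 by rewrite invr_gt0 mulr_gt0// ltr_wpDl.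
  suff : 1 / 4 <= h q by lra.
  apply: (cvgr_to_ge (gh q)).
  have /pq near_q := d_near q C4.
  apply: (@filterS _ F _ _ _ _ near_q) => n /= [Apq dpq].
  have [_ _ /(_ (p n) q Apq) + _] := Hg n.
  rewrite ler_distlC => /andP[+ _].
  have Cd : C * d (p n) q <= 1 / 4.
    apply: (@le_trans _ _ (C * (4 * (C + 1))^-1)); first by apply: ler_wpM2l => //; exact: ltW.
    by rewrite ler_pdivrMr ?mulr_gt0 ?ltr_wpDl//; lra.
  by have := Hp n; lra.
- move=> p q Apq.
  have gpq : `|g n p - g n q| @[n --> F] --> `|h p - h q|.
    by apply: cvg_norm; exact: cvgB.
  apply: (cvgr_to_le gpq).
  by apply: nearW => n; have [] := Hg n; auto.
move=> p; apply/eqP; rewrite -subr_eq0 -normr_eq0; apply/eqP.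
have lim1 : `|L (g n) p - lam * g n p| @[n --> F] --> `|L h p - lam * h p|.
  apply: cvg_norm; apply: cvgB => //; apply: cvgM => //; exact: cvg_cst.
have lim2 : `|L (g n) p - lam * g n p| @[n --> F] --> (0 : R).
  apply: (@squeeze_cvgr _ _ _ _ (fun=> 0) (fun n => n.+1%:R^-1)).
  - by apply: nearW => n; have [_ _ _ ->] := Hg n; rewrite normr_ge0.
  - exact: cvg_cst.
  - by apply: cvgn_free; exact: cvg_harmonic.
by rewrite -(cvg_lim _ lim1)// (cvg_lim _ lim2).
Qed.

End eigenfunction_limit.

(** * The eigenfunctional *)

Section eigenfunctional.
Context {R : realType} {T : topologicalType}.
Hypothesis T_compact : compact [set: T].
Variables (A : T -> bool) (b1 b2 b3 : T -> T) (W : T -> R) (e lam : R).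
Local Notation L := (branch_op A b1 b2 b3 W).
Hypothesis e_gt0 : 0 < e.
Hypothesis e_le_W : forall p, e <= W p.
Hypothesis lam_gt0 : 0 < lam.
Variable h : T -> R.
Hypothesis h_cont : continuous h.
Hypothesis h_gt0 : forall p, 0 < h p.
Hypothesis Lh : forall p, L h p = lam * h p.
Hypothesis L_cont : forall u : T -> R, continuous u -> continuous (L u).
Variable x0 : T.

Local Notation F := free_ultrafilter.

(** As h is bounded below, bounds can be taken relative to h, on which L acts as
multiplication by lam. *)
Lemma dominated_by_eigenfunction (u : T -> R) : continuous u ->
  exists2 C, 0 < C & forall x, `|u x| <= C * h x.
Proof.
move=> cu; have [M M0 uM] := continuous_compact_bounded T_compact cu.
have [c c0 hc] := positive_continuous_ge T_compact h_cont h_gt0.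
exists (M / c) => [|x]; first exact: divr_gt0.
apply: le_trans (uM x) _; rewrite mulrAC ler_pdivlMr//.
by apply: ler_wpM2l; [exact: ltW|].
Qed.

Definition normalized_iterate (n : nat) (u : T -> R) : R :=
  lam ^- n * iter n L u x0.

Lemma normalized_iterateD n (u v : T -> R) : normalized_iterate n (fun x => u x + v x) =
  normalized_iterate n u + normalized_iterate n v.
Proof.
rewrite /normalized_iterate -mulrDr; congr (_ * _).
have -> // : iter n L (fun x => u x + v x) =
  fun x => iter n L u x + iter n L v x.
by elim: n => // n /= ->; apply/funext => x; rewrite branch_opD.
Qed.

Lemma normalized_iterateZ n (c : R) (u : T -> R) : normalized_iterate n (fun x => c * u x) =
  c * normalized_iterate n u.
Proof. by rewrite /normalized_iterate iter_branch_opZ mulrCA. Qed.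

Lemma normalized_iterate_bounded n (u : T -> R) (C : R) : (forall x, `|u x| <= C * h x) ->
  `|normalized_iterate n u| <= C * h x0.
Proof.
move=> uC.
have l0 : 0 < lam ^- n by rewrite invr_gt0 exprn_gt0.
have CE : C * h x0 = lam ^- n * iter n L (fun x => C * h x) x0.
  rewrite iter_branch_opZ (iter_branch_op_eigen _ Lh) mulrCA mulKf//.
  by rewrite expf_neq0// gt_eqF.
rewrite normrM gtr0_norm// CE; apply: ler_wpM2l; first exact: ltW.
rewrite ler_norml; apply/andP; split; last first.
  by apply: (iter_branch_op_le _ _ _ _ e_gt0 e_le_W) => x; exact: le_trans (ler_norm _) (uC x).
have -> : - iter n L (fun x => C * h x) x0 = iter n L (fun x => (-1) * (C * h x)) x0.
  by rewrite [in RHS]iter_branch_opZ mulN1r.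
apply: (iter_branch_op_le _ _ _ _ e_gt0 e_le_W) => x.
by rewrite mulN1r lerNl; apply: le_trans (uC x); rewrite -normrN ler_norm.
Qed.

Definition cesaro (N : nat) (u : T -> R) : R :=
  N.+1%:R^-1 * \sum_(0 <= n < N.+1) normalized_iterate n u.

Lemma cesaro_bounded N (u : T -> R) (C : R) : (forall x, `|u x| <= C * h x) ->
  `|cesaro N u| <= C * h x0.
Proof.
move=> uC; rewrite /cesaro normrM ger0_norm ?invr_ge0// ler_pdivrMl//.
apply: le_trans (ler_norm_sum _ _ _) _.
apply: (@le_trans _ _ (\sum_(0 <= n < N.+1) C * h x0)).
  by apply: ler_sum => n _; exact: normalized_iterate_bounded.
by rewrite sumr_const_nat subn0 mulr_natl.
Qed.

Definition cesaro_limit (u : T -> R) : R := lim (cesaro N u @[N --> F]).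

Lemma cesaro_cvg (u : T -> R) : continuous u -> cesaro N u @[N --> F] --> cesaro_limit u.
Proof.
move=> /dominated_by_eigenfunction[C C0 uC].
have := @bounded_ultra_cvg _ _ F (fun N => cesaro N u) (C * h x0) free_ultrafilter_ultra.
by apply=> N; exact: cesaro_bounded.
Qed.

Lemma cesaro_limitE (u : T -> R) (l : R) : cesaro N u @[N --> F] --> l -> cesaro_limit u = l.
Proof. by move=> ul; exact: cvg_lim. Qed.

Lemma cesaro_limitD (u v : T -> R) : continuous u -> continuous v ->
  cesaro_limit (fun x => u x + v x) = cesaro_limit u + cesaro_limit v.
Proof.
move=> cu cv; apply: cesaro_limitE.
under eq_fun => N.
  rewrite /cesaro; under eq_bigr do rewrite normalized_iterateD.
  rewrite big_split/= mulrDr; over.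
by apply: cvgD; exact: cesaro_cvg.
Qed.

Lemma cesaroZ N (c : R) (u : T -> R) : cesaro N (fun x => c * u x) = c * cesaro N u.
Proof.
rewrite /cesaro; under eq_bigr do rewrite normalized_iterateZ.
by rewrite -mulr_sumr mulrCA.
Qed.

Lemma cesaro_limitZ (c : R) (u : T -> R) : continuous u ->
  cesaro_limit (fun x => c * u x) = c * cesaro_limit u.
Proof.
move=> cu; apply: cesaro_limitE; under eq_fun do rewrite cesaroZ.
by apply: cvgM; [exact: cvg_cst|exact: cesaro_cvg].
Qed.

Lemma cesaro_ge0 N (u : T -> R) : (forall x, 0 <= u x) -> 0 <= cesaro N u.
Proof.
move=> u0; apply: mulr_ge0; first by rewrite invr_ge0.
apply: sumr_ge0 => n _; apply: mulr_ge0.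
  by rewrite invr_ge0 exprn_ge0 ?ltW.
exact: (iter_branch_op_ge0 _ _ _ _ e_gt0 e_le_W).
Qed.

Lemma cesaro_limit_ge0 (u : T -> R) : continuous u -> (forall x, 0 <= u x) ->
  0 <= cesaro_limit u.
Proof.
move=> cu u0; apply: (cvgr_to_ge (cesaro_cvg cu)).
by apply: nearW => N; exact: cesaro_ge0.
Qed.

Lemma cesaro_eigen N : cesaro N h = h x0.
Proof.
rewrite /cesaro (eq_bigr (fun=> h x0)).
  rewrite sumr_const_nat subn0 -[h x0 *+ _]mulr_natl mulKf//.
move=> n _; rewrite /normalized_iterate (iter_branch_op_eigen _ Lh) mulKf//.
by rewrite expf_neq0// gt_eqF.
Qed.

(** Applying L shifts the sum by one term, so that only the two extreme terms
remain, with weight 1 / (N + 1). *)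
Lemma cesaro_branch_op N (u : T -> R) : cesaro N (L u) = lam * (cesaro N u +
  N.+1%:R^-1 * (normalized_iterate N.+1 u - normalized_iterate 0 u)).
Proof.
have H n : normalized_iterate n (L u) = lam * normalized_iterate n.+1 u.
  rewrite /normalized_iterate -iterSr exprS invfM mulrA mulVKf ?gt_eqF//.
rewrite /cesaro (eq_bigr (fun n => lam * normalized_iterate n.+1 u)); last first.
  by move=> n _; exact: H.
rewrite -mulr_sumr mulrCA -mulrDr; congr (_ * (_ * _)).
have := @big_nat_recl _ 0 +%R N.+1 0 (fun n => normalized_iterate n u) (leq0n _).
by rewrite big_nat_recr//= => h0; lra.
Qed.

Lemma cesaro_limit_branch_op (u : T -> R) : continuous u ->
  cesaro_limit (L u) = lam * cesaro_limit u.
Proof.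
move=> cu; apply: cesaro_limitE; under eq_fun do rewrite cesaro_branch_op.
apply: cvgM; first exact: cvg_cst.
rewrite -[X in _ --> X]addr0; apply: cvgD; first exact: cesaro_cvg.
have [C C0 uC] := dominated_by_eigenfunction cu.
pose K := 2 * (C * h x0).
have KF : K * N.+1%:R^-1 @[N --> F] --> (0 : R).
  rewrite -(mulr0 K); apply: cvgM; first exact: cvg_cst.
  by apply: cvgn_free; exact: cvg_harmonic.
apply: (@squeeze_cvgr _ _ _ _ (fun N => - (K * N.+1%:R^-1))
  (fun N => K * N.+1%:R^-1)) => //; last by rewrite -oppr0; exact: cvgN.
apply: nearW => N; rewrite -ler_norml normrM ger0_norm ?invr_ge0// mulrC.
apply: ler_wpM2r; first by rewrite invr_ge0.
apply: le_trans (ler_normB _ _) _; rewrite /K mulr_natl mulr2n.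
by apply: lerD; exact: normalized_iterate_bounded.
Qed.

Lemma exists_eigenfunctional : exists l : (T -> R) -> R,
  [/\ (forall u v : T -> R, continuous u -> continuous v ->
         l (fun x => u x + v x) = l u + l v),
      (forall (c : R) (u : T -> R), continuous u -> l (fun x => c * u x) = c * l u),
      (forall u : T -> R, continuous u -> (forall x, 0 <= u x) -> 0 <= l u),
      l (fun=> 1) = 1 &
      forall u : T -> R, continuous u -> l (L u) = lam * l u].
Proof.
have c1 : continuous (fun _ : T => 1 : R) by move=> x; exact: cvg_cst.
have k0 : 0 < cesaro_limit (fun=> 1).
  (* from h <= M, the means of 1 are at least those of h / M, equal to h x0 / M *)
  have [M M0 hM] := continuous_compact_bounded T_compact h_cont.
  have Mh : 0 < h x0 / M by rewrite divr_gt0.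
  apply: lt_le_trans Mh _; apply: (cvgr_to_ge (cesaro_cvg c1)).
  apply: nearW => N; rewrite ler_pdivrMr// -(cesaro_eigen N) mulrC -cesaroZ.
  rewrite -subr_ge0.
  have -> : cesaro N (fun x => M * 1) - cesaro N h =
      cesaro N (fun x => M * 1 + (-1) * h x).
    rewrite -[- cesaro N h]mulN1r -cesaroZ /cesaro -mulrDr -big_split/=.
    by congr (_ * _); apply: eq_bigr => n _; rewrite normalized_iterateD.
  apply: cesaro_ge0 => x; rewrite mulr1 mulN1r subr_ge0.
  exact: le_trans (ler_norm _) (hM x).
exists (fun u => (cesaro_limit (fun=> 1))^-1 * cesaro_limit u); split.
- by move=> u v cu cv; rewrite cesaro_limitD// mulrDr.
- by move=> c u cu; rewrite cesaro_limitZ// mulrCA.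
- move=> u cu u0; apply: mulr_ge0; first by rewrite invr_ge0 ltW.
  exact: cesaro_limit_ge0.
- by rewrite mulVf// gt_eqF.
- by move=> u cu; rewrite cesaro_limit_branch_op// mulrCA.
Qed.

End eigenfunctional.

(** * The spectral radius *)

Section geometric_limit.
Context {R : realType} {T : topologicalType}.
Variables (a : nat -> T -> R) (C q : R).
Hypothesis a_cont : forall n, continuous (a n).
Hypothesis q_ge0 : 0 <= q.
Hypothesis q_lt1 : q < 1.
Hypothesis C_ge0 : 0 <= C.
Hypothesis a_step : forall n x, `|a n.+1 x - a n x| <= C * q ^+ n.

Local Notation F := free_ultrafilter.

Let tail n := C * q ^+ n / (1 - q).

Lemma geometric_tail n k x : `|a (k + n)%N x - a n x| <= tail n.
Proof.
have q1 : 0 < 1 - q by rewrite subr_gt0.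
apply: (@le_trans _ _ (C * (q ^+ n - q ^+ (k + n)) / (1 - q))); last first.
  rewrite /tail ler_wpM2r ?invr_ge0 ?(ltW q1)// ler_wpM2l// gerBl.
  exact: exprn_ge0.
elim: k => [|k IH]; first by rewrite add0n !subrr normr0 mulr0 mul0r.
rewrite (_ : _ - _ = (a (k + n).+1 x - a (k + n)%N x) + (a (k + n)%N x - a n x));
  last by rewrite addSn; ring.
apply: le_trans (ler_normD _ _) _; apply: le_trans (lerD (a_step _ _) IH) _.
rewrite le_eqVlt; apply/orP; left; apply/eqP; rewrite addSn exprS.
by field; rewrite gt_eqF.
Qed.

Lemma geometric_limit : exists2 l : T -> R, continuous l &
  forall x, a n x @[n --> \oo] --> l x.
Proof.
have q1 : 0 < 1 - q by rewrite subr_gt0.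
have a_cvg x : cvg (a n x @[n --> F]).
  apply: (@bounded_ultra_cvg _ _ F (fun n => a n x) (tail 0 + `|a 0%N x|) free_ultrafilter_ultra) => n.
  have := geometric_tail 0 n x; rewrite addn0 => H.
  have -> : a n x = (a n x - a 0%N x) + a 0%N x by ring.
  by apply: le_trans (ler_normD _ _) _; rewrite lerD2r.
pose l x : R := lim (a n x @[n --> F]).
have al x : a n x @[n --> F] --> l x by exact: a_cvg.
have l_tail n x : `|l x - a n x| <= tail n.
  have lim1 : `|a m x - a n x| @[m --> F] --> `|l x - a n x|.
    by apply: cvg_norm; apply: cvgB => //; exact: cvg_cst.
  apply: (cvgr_to_le lim1); apply: eventually_free_ultrafilter.
  by exists n => // m /= nm; rewrite -(subnK nm); exact: geometric_tail.
have tail_lt eps : 0 < eps -> exists n, forall m, (n <= m)%N -> tail m < eps.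
  move=> eps0; have e1 : 0 < eps * (1 - q) / (C + 1).
    by rewrite divr_gt0 ?mulr_gt0// ltr_wpDl.
  have [n Hn] := exists_expr_lt q_ge0 q_lt1 e1.
  exists n => m nm; rewrite /tail ltr_pdivrMr//.
  have := Hn m nm; rewrite ltr_pdivlMr ?ltr_wpDl//; apply: le_lt_trans.
  by rewrite mulrC ler_wpM2l ?exprn_ge0// lerDl.
exists l => x.
  apply/cvgrPdist_lt => eps eps0.
  have e3 : 0 < eps / 3 by rewrite divr_gt0.
  have [n /(_ n (leqnn n)) tn] := tail_lt _ e3.
  have ax : a n y @[y --> x] --> a n x by exact: a_cont.
  move/cvgrPdist_lt: ax => /(_ _ e3).
  apply: filterS => y /= axy.
  have -> : l x - l y = (l x - a n x) + (a n x - a n y) - (l y - a n y) by ring.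
  have := l_tail n x; have := l_tail n y; move: axy tn.
  rewrite ltr_norml => /andP[? ?] ?.
  rewrite !ler_norml => /andP[? ?] /andP[? ?].
  by rewrite ltr_norml; apply/andP; split; lra.
apply/cvgrPdist_lt => eps eps0; have [n Hn] := tail_lt _ eps0.
by exists n => // m /= nm; exact: le_lt_trans (l_tail m x) (Hn m nm).
Qed.

End geometric_limit.

Section complex_modulus.
Context {R : realType}.
Local Open Scope complex_scope.
Implicit Types z w : R[i].

(** The norm of R[i] takes its values in R[i]; this is the real number behind it. *)
Definition cmod z : R := complex.Re `|z|.

Lemma normc_cmod z : `|z| = (cmod z)%:C.
Proof. by rewrite /cmod normc_def. Qed.

Lemma cmodE z : cmod z = Num.sqrt (complex.Re z ^+ 2 + complex.Im z ^+ 2).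
Proof. by rewrite /cmod normc_def. Qed.

Lemma cmod_ge0 z : 0 <= cmod z.
Proof. by rewrite cmodE sqrtr_ge0. Qed.

Lemma cmodM z w : cmod (z * w) = cmod z * cmod w.
Proof. by apply: (@complexI R); rewrite rmorphM/= -!normc_cmod normrM. Qed.

Lemma cmodV z : cmod z^-1 = (cmod z)^-1.
Proof. by apply: (@complexI R); rewrite fmorphV/= -!normc_cmod normfV. Qed.

Lemma cmodD z w : cmod (z + w) <= cmod z + cmod w.
Proof. by rewrite -lecR rmorphD/= -!normc_cmod ler_normD. Qed.

Lemma cmod_real (r : R) : cmod r%:C = `|r|.
Proof. by rewrite cmodE/= expr0n/= addr0 sqrtr_sqr. Qed.

Lemma cmod_eq0 z : cmod z = 0 -> z = 0.
Proof. by move=> z0; apply/normr0_eq0; rewrite normc_cmod z0. Qed.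

Lemma Re_le_cmod z : `|complex.Re z| <= cmod z.
Proof. by rewrite cmodE -sqrtr_sqr ler_wsqrtr// lerDl sqr_ge0. Qed.

Lemma Im_le_cmod z : `|complex.Im z| <= cmod z.
Proof. by rewrite cmodE -sqrtr_sqr ler_wsqrtr// lerDr sqr_ge0. Qed.

Lemma cmod_le_ReIm z : cmod z <= `|complex.Re z| + `|complex.Im z|.
Proof.
rewrite cmodE -[leRHS]ger0_norm ?addr_ge0// -sqrtr_sqr ler_wsqrtr//.
rewrite -(real_normK (num_real (complex.Re z))).
rewrite -(real_normK (num_real (complex.Im z))) sqrrD lerD2r lerDl.
by rewrite mulrn_wge0// mulr_ge0.
Qed.

End complex_modulus.

Section spectral_radius_of_positive_operator.
Context {R : realType} {T : topologicalType}.
Hypothesis T_compact : compact [set: T].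
Variables (A : T -> bool) (b1 b2 b3 : T -> T) (W : T -> R) (e lam : R).
Local Notation L := (branch_op A b1 b2 b3 W).
Hypothesis e_gt0 : 0 < e.
Hypothesis e_le_W : forall p, e <= W p.
Hypothesis lam_gt0 : 0 < lam.
Variable h : T -> R.
Hypothesis h_cont : continuous h.
Hypothesis h_gt0 : forall p, 0 < h p.
Hypothesis Lh : forall p, L h p = lam * h p.
Hypothesis L_cont : forall u : T -> R, continuous u -> continuous (L u).
Variable x0 : T.

Let W_ge0 p : 0 <= W p. Proof. exact: le_trans (ltW e_gt0) (e_le_W p). Qed.

Lemma complexify_branch_op (u : T -> R[i]) x : complexify L u x =
  if A x then (W (b1 x))%:C%C * u (b1 x) + (W (b3 x))%:C%C * u (b3 x)
  else (W (b2 x))%:C%C * u (b2 x).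
Proof.
rewrite /complexify /branch_op; case: (A x).
  case: (u (b1 x)) => r1 i1; case: (u (b3 x)) => r3 i3.
  by apply/eqP; rewrite eq_complex /= !mul0r !subr0 !addr0 !eqxx.
by case: (u (b2 x)) => r i; apply/eqP; rewrite eq_complex /= !mul0r !subr0 !addr0 !eqxx.
Qed.

Lemma complexifyB (u v : T -> R[i]) x :
  complexify L (fun y => u y - v y) x = complexify L u x - complexify L v x.
Proof. by rewrite !complexify_branch_op; case: (A x); ring. Qed.

Lemma cmod_complexify (u : T -> R[i]) x :
  cmod (complexify L u x) <= L (fun y => cmod (u y)) x.
Proof.
have H y : cmod ((W y)%:C%C * u y) = W y * cmod (u y).
  by rewrite cmodM cmod_real ger0_norm.
rewrite complexify_branch_op /branch_op; case: (A x); last by rewrite H.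
by apply: le_trans (cmodD _ _) _; rewrite !H.
Qed.

Lemma cmod_dominated (u : T -> R[i]) : complex_continuous u ->
  exists2 C, 0 < C & forall x, cmod (u x) <= C * h x.
Proof.
move=> [/(dominated_by_eigenfunction T_compact h_cont h_gt0)[C1 C10 H1]].
move=> /(dominated_by_eigenfunction T_compact h_cont h_gt0)[C2 C20 H2].
exists (C1 + C2) => [|x]; first exact: addr_gt0.
by apply: le_trans (cmod_le_ReIm _) _; rewrite mulrDl; apply: lerD.
Qed.

Lemma complex_continuousB (u v : T -> R[i]) : complex_continuous u ->
  complex_continuous v -> complex_continuous (fun x => u x - v x).
Proof.
move=> [cu1 cu2] [cv1 cv2]; split => x.
  have -> : (fun y => complex.Re (u y - v y)) =
      (fun y => complex.Re (u y) - complex.Re (v y)).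
    by apply/funext => y; case: (u y) => ? ?; case: (v y).
  by apply: cvgB; [exact: cu1|exact: cv1].
have -> : (fun y => complex.Im (u y - v y)) =
    (fun y => complex.Im (u y) - complex.Im (v y)).
  by apply/funext => y; case: (u y) => ? ?; case: (v y).
by apply: cvgB; [exact: cu2|exact: cv2].
Qed.

Lemma complex_continuousZ (w : R[i]) (u : T -> R[i]) : complex_continuous u ->
  complex_continuous (fun x => w * u x).
Proof.
case: w => w1 w2; move=> [cu1 cu2]; split => x.
  have -> : (fun y => complex.Re (Complex w1 w2 * u y)) =
      (fun y => w1 * complex.Re (u y) - w2 * complex.Im (u y)).
    by apply/funext => y; case: (u y).
  apply: cvgB; apply: cvgM; [exact: cvg_cst|exact: cu1|exact: cvg_cst|exact: cu2].
have -> : (fun y => complex.Im (Complex w1 w2 * u y)) =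
    (fun y => w1 * complex.Im (u y) + w2 * complex.Re (u y)).
  by apply/funext => y; case: (u y).
apply: cvgD; apply: cvgM; [exact: cvg_cst|exact: cu2|exact: cvg_cst|exact: cu1].
Qed.

Lemma complex_continuous_complexify (u : T -> R[i]) : complex_continuous u ->
  complex_continuous (complexify L u).
Proof. by move=> [cu1 cu2]; split; exact: L_cont. Qed.

Lemma growth_in_spectrum : spectrum L lam%:C%C.
Proof.
move=> [_ inj _].
have c0 : continuous (fun _ : T => 0 : R) by move=> x; exact: cvg_cst.
have hc : complex_continuous (fun x => (h x)%:C%C) by split.
have zc : complex_continuous (fun _ : T => 0 : R[i]) by split.
have := inj _ _ (mem_set hc) (mem_set zc).
suff H : (fun x => complexify L (fun x => (h x)%:C%C) x - lam%:C%C * (h x)%:C%C) =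
  (fun x => complexify L (fun _ : T => 0 : R[i]) x - lam%:C%C * 0).
  move=> /(_ H)/(congr1 (fun u => complex.Re (u x0)))/=.
  by move/eqP; rewrite gt_eqF.
have lamh x : lam%:C%C * (h x)%:C%C = (L h x)%:C%C by rewrite Lh rmorphM.
apply/funext => x; rewrite !complexify_branch_op lamh !mulr0 addr0 /branch_op.
rewrite if_same subr0; case: (A x); last by rewrite rmorphM subrr.
by rewrite rmorphD !rmorphM subrr.
Qed.

Section resolvent_set.
Variable z : R[i].
Hypothesis z_gt : lam < cmod z.

Let z_gt0 : 0 < cmod z. Proof. exact: lt_trans z_gt. Qed.
Let z_neq0 : z != 0.
Proof. by apply: contraTneq z_gt0 => ->; rewrite /cmod normr0 ltxx. Qed.
Let q := lam / cmod z.
Let q_ge0 : 0 <= q. Proof. by rewrite /q divr_ge0 ?ltW. Qed.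
Let q_lt1 : q < 1. Proof. by rewrite /q ltr_pdivrMr// mul1r. Qed.

(** The norm of u relative to h is the least C with |u| <= C h; for this norm
L / z contracts by q = lam / |z|. *)
Lemma resolvent_step (C : R) (u w : T -> R[i]) :
  (forall x, z * w x = complexify L u x) ->
  (forall x, cmod (u x) <= C * h x) ->
  forall x, cmod (w x) <= q * C * h x.
Proof.
move=> zw uC x.
have -> : w x = z^-1 * complexify L u x by rewrite -zw mulKf.
rewrite cmodM cmodV ler_pdivrMl//; apply: le_trans (cmod_complexify _ _) _.
apply: le_trans (branch_op_le _ _ _ _ e_gt0 e_le_W uC x) _.
rewrite branch_opZ Lh /q le_eqVlt; apply/orP; left; apply/eqP.
by field; rewrite gt_eqF.
Qed.

Lemma resolvent_injective : set_inj complex_continuous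
  (fun (u : T -> R[i]) x => complexify L u x - z * u x).
Proof.
move=> u v /set_mem cu /set_mem cv uv.
pose w x := u x - v x.
have cw : complex_continuous w by exact: complex_continuousB.
have zw x : z * w x = complexify L w x.
  have := congr1 (fun f => f x) uv; rewrite /= complexifyB /w => /eqP.
  rewrite -subr_eq0 => /eqP E; apply/eqP; rewrite -subr_eq0 -oppr_eq0 -E.
  by apply/eqP; ring.
have [C C0 wC] := cmod_dominated cw.
have wn n x : cmod (w x) <= q ^+ n * C * h x.
  elim: n x => [|n IH] x; first by rewrite mul1r.
  by rewrite exprS -[q * _ * C]mulrA; exact: resolvent_step IH x.
apply/funext => x; apply/eqP; rewrite -subr_eq0; apply/eqP; apply: cmod_eq0.
apply/eqP; rewrite eq_le cmod_ge0 andbT leNgt; apply/negP => w0.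
have Ch : 0 < C * h x by rewrite mulr_gt0.
have c0 : 0 < cmod (w x) / (C * h x) by rewrite divr_gt0.
have [n /(_ n (leqnn n))] := exists_expr_lt q_ge0 q_lt1 c0.
by rewrite ltr_pdivlMr// mulrA ltNge wn.
Qed.

(** Banach's fixed point theorem for u -> z^-1 (L u - v), in which q-contraction in
the norm relative to h gives uniformly convergent real and imaginary parts. *)
Lemma resolvent_surjective : set_surj complex_continuous complex_continuous
  (fun (u : T -> R[i]) x => complexify L u x - z * u x).
Proof.
move=> v cv.
pose Phi (u : T -> R[i]) (x : T) := z^-1 * (complexify L u x - v x).
pose U n := iter n Phi (fun=> 0).
have cU n : complex_continuous (U n).
  elim: n => [|n IH]; first by split => x; exact: cvg_cst.
  rewrite /U iterS -/(U n); apply: complex_continuousZ.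
  by apply: complex_continuousB => //; exact: complex_continuous_complexify.
have zU n x : z * U n.+1 x = complexify L (U n) x - v x.
  by rewrite /U iterS -/(U n) /Phi mulVKf.
pose D n x := U n.+1 x - U n x.
have [C C0 D0] : exists2 C, 0 < C & forall x, cmod (D 0%N x) <= C * h x.
  by apply: cmod_dominated; exact: complex_continuousB.
have Dn n x : cmod (D n x) <= q ^+ n * C * h x.
  elim: n x => [|n IH] x; first by rewrite mul1r.
  rewrite exprS -[q * _ * C]mulrA; apply: resolvent_step IH x => x.
  by rewrite /D mulrBr !zU complexifyB; ring.
have [M M0 hM] := continuous_compact_bounded T_compact h_cont.
have CM : 0 <= C * M by rewrite mulr_ge0 ?ltW.
have DnM n x : cmod (D n x) <= C * M * q ^+ n.
  apply: le_trans (Dn n x) _; have -> : q ^+ n * C * h x = C * h x * q ^+ n by ring.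
  apply: ler_wpM2r; first exact: exprn_ge0.
  apply: ler_wpM2l; first exact: ltW.
  exact: le_trans (ler_norm _) (hM x).
have ReB x y : complex.Re (x - y : R[i]) = complex.Re x - complex.Re y.
  by case: x => ? ?; case: y.
have ImB x y : complex.Im (x - y : R[i]) = complex.Im x - complex.Im y.
  by case: x => ? ?; case: y.
have [a ca Ua] := @geometric_limit _ _ (fun n x => complex.Re (U n x)) (C * M) q
  (fun n => (cU n).1) q_ge0 q_lt1 CM (fun n x =>
   le_trans (eq_ind _ (fun r => `|r| <= cmod (D n x)) (Re_le_cmod _) _ (ReB _ _)) (DnM n x)).
have [b cb Ub] := @geometric_limit _ _ (fun n x => complex.Im (U n x)) (C * M) q
  (fun n => (cU n).2) q_ge0 q_lt1 CM (fun n x =>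
   le_trans (eq_ind _ (fun r => `|r| <= cmod (D n x)) (Im_le_cmod _) _ (ImB _ _)) (DnM n x)).
exists (fun x => Complex (a x) (b x)) => //; apply/funext => x.
have L_cvg (f : nat -> T -> R) (g : T -> R) : (forall y, f n y @[n --> \oo] --> g y) ->
    L (f n) x @[n --> \oo] --> L g x.
  move=> fg; rewrite /branch_op; case: (A x).
    by apply: cvgD; apply: cvgM => //; exact: cvg_cst.
  by apply: cvgM => //; exact: cvg_cst.
have La := L_cvg _ _ Ua; have Lb := L_cvg _ _ Ub.
have Ua1 : complex.Re (U n.+1 x) @[n --> \oo] --> a x.
  by rewrite (cvg_shiftS (fun n => complex.Re (U n x))); exact: Ua.
have Ub1 : complex.Im (U n.+1 x) @[n --> \oo] --> b x.
  by rewrite (cvg_shiftS (fun n => complex.Im (U n x))); exact: Ub.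
have lim_eq (f g : nat -> R) (s t : R) : f =1 g -> f n @[n --> \oo] --> s ->
    g n @[n --> \oo] --> t -> s = t.
  by move=> /funext -> fs gt; apply: (cvg_unique _ fs gt).
have ReM x' y : complex.Re (x' * y : R[i]) =
    complex.Re x' * complex.Re y - complex.Im x' * complex.Im y.
  by case: x' => ? ?; case: y.
have ImM x' y : complex.Im (x' * y : R[i]) =
    complex.Re x' * complex.Im y + complex.Im x' * complex.Re y.
  by case: x' => ? ?; case: y.
have ReE : complex.Re z * a x - complex.Im z * b x = L a x - complex.Re (v x).
  apply: (lim_eq (fun n => complex.Re z * complex.Re (U n.+1 x) -
      complex.Im z * complex.Im (U n.+1 x))
    (fun n => L (fun y => complex.Re (U n y)) x - complex.Re (v x))).
  - move=> n; have := congr1 (@complex.Re R) (zU n x); rewrite ReB /= => <-.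
    by rewrite ReM.
  - by apply: cvgB; apply: cvgM => //; exact: cvg_cst.
  - by apply: cvgB => //; exact: cvg_cst.
have ImE : complex.Re z * b x + complex.Im z * a x = L b x - complex.Im (v x).
  apply: (lim_eq (fun n => complex.Re z * complex.Im (U n.+1 x) +
      complex.Im z * complex.Re (U n.+1 x))
    (fun n => L (fun y => complex.Im (U n y)) x - complex.Im (v x))).
  - move=> n; have := congr1 (@complex.Im R) (zU n x); rewrite ImB /= => <-.
    by rewrite ImM.
  - by apply: cvgD; apply: cvgM => //; exact: cvg_cst.
  - by apply: cvgB => //; exact: cvg_cst.
apply/eqP; rewrite eq_complex ReB ImB /=; apply/andP.
by rewrite ReM ImM /= ReE ImE; split; apply/eqP; ring.
Qed.

Lemma resolvent_notin_spectrum : ~ spectrum L z.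
Proof.
apply; split; [|exact: resolvent_injective|exact: resolvent_surjective].
move=> u cu; apply: complex_continuousB; first exact: complex_continuous_complexify.
exact: complex_continuousZ.
Qed.

End resolvent_set.

(** h itself is an eigenvector for lam, and no z with |z| > lam is in the
spectrum. *)
Theorem spectral_radius_eigenvalue : spectral_radius L = lam.
Proof.
have ub z : spectrum L z -> complex.Re `|z| <= lam.
  move=> sz; rewrite leNgt; apply/negP => lz.
  exact: resolvent_notin_spectrum lz sz.
apply/eqP; rewrite eq_le; apply/andP; split.
  apply: ge_sup.
    by exists (complex.Re `|lam%:C%C|), lam%:C%C => //; exact: growth_in_spectrum.
  by move=> _ [z sz <-]; exact: ub.
have -> : lam = complex.Re `|lam%:C%C|.
  by have := cmod_real lam; rewrite /cmod => ->; rewrite gtr0_norm.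
apply: sup_upper_bound; last by exists lam%:C%C => //; exact: growth_in_spectrum.
split; first by exists (complex.Re `|lam%:C%C|), lam%:C%C => //; exact: growth_in_spectrum.
by exists lam => _ [z sz <-]; exact: ub.
Qed.

End spectral_radius_of_positive_operator.

(** * The inverse branches of the horseshoe *)

Section inverse_branches.
Context {R : realType}.
Variables rho sigma : R.
Hypothesis hrho : 0 < rho < 3^-1.
Hypothesis hsigma : 0 < sigma < 3^-1.

Let rho_gt0 : 0 < rho. Proof. by case/andP: hrho. Qed.
Let rho_lt : rho < 1 / 3. Proof. by case/andP: hrho; rewrite div1r. Qed.
Let sigma_gt0 : 0 < sigma. Proof. by case/andP: hsigma. Qed.
Let sigma_lt : sigma < 1 / 3. Proof. by case/andP: hsigma; rewrite div1r. Qed.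

Local Notation e1 := (expR 1 : R).

Let e1_gt1 : 1 < e1. Proof. by rewrite expR_gt1. Qed.

(** The map f on the unit interval, written as a projective map fixing 0 and 1, so
that it is defined and continuous at 0 without a case distinction. *)
Definition mobius (y : R) : R := e1 * y / (1 + (e1 - 1) * y).
Definition mobius_inv (y : R) : R := y / (y + e1 * (1 - y)).

Lemma mobius_den_gt0 y : 0 <= y -> 0 < 1 + (e1 - 1) * y.
Proof. by move=> y0; rewrite ltr_wpDr// mulr_ge0// subr_ge0 ltW. Qed.

Lemma mobius_den_ge1 y : 0 <= y -> 1 <= 1 + (e1 - 1) * y.
Proof. by move=> y0; rewrite lerDl mulr_ge0// subr_ge0 ltW. Qed.

Lemma mobius_inv_den_gt0 y : 0 <= y -> y <= 1 -> 0 < y + e1 * (1 - y).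
Proof.
move=> y0 y1; have : 0 <= (e1 - 1) * (1 - y).
  by rewrite mulr_ge0// subr_ge0// ltW.
by lra.
Qed.

Lemma mobius_ge0 y : 0 <= y -> 0 <= mobius y.
Proof.
move=> y0; rewrite /mobius divr_ge0 ?(ltW (mobius_den_gt0 y0))//.
by rewrite mulr_ge0// expR_ge0.
Qed.

Lemma mobius_le1 y : 0 <= y -> y <= 1 -> mobius y <= 1.
Proof.
move=> y0 y1; rewrite /mobius ler_pdivrMr ?mobius_den_gt0// mul1r.
by have := e1_gt1; lra.
Qed.

Lemma mobiusK y : 0 <= y -> y <= 1 -> mobius_inv (mobius y) = y.
Proof.
move=> y0 y1; have d := mobius_den_gt0 y0; rewrite /mobius_inv /mobius.
have e0 : 0 < e1 by exact: expR_gt0.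
by field; rewrite !gt_eqF//; have := e1_gt1; nra.
Qed.

Lemma mobius_invK y : 0 <= y -> y <= 1 -> mobius (mobius_inv y) = y.
Proof.
move=> y0 y1; have d := mobius_inv_den_gt0 y0 y1; rewrite /mobius_inv /mobius.
by field; rewrite !gt_eqF//; have := e1_gt1; nra.
Qed.

Lemma mobius_inv_itv y : 0 <= y -> y <= 1 -> 0 <= mobius_inv y <= 1.
Proof.
move=> y0 y1; have d := mobius_inv_den_gt0 y0 y1; rewrite /mobius_inv.
rewrite divr_ge0 ?(ltW d)//= ler_pdivrMr// mul1r lerDl mulr_ge0 ?expR_ge0//.
by rewrite subr_ge0.
Qed.

Lemma f_mobius y : 0 <= y -> y <= 1 -> f y = mobius y.
Proof.
move=> y0 y1; rewrite /f; case: eqVneq => [->|yN0].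
  by rewrite /mobius !mulr0 mul0r.
have d := mobius_den_gt0 y0; have e0 : 0 < e1 by exact: expR_gt0.
by rewrite /mobius; field; rewrite !gt_eqF//; have := e1_gt1; nra.
Qed.

Lemma g0_mobius y : 0 <= y -> y <= 1 -> g0 y = mobius_inv y.
Proof.
move=> y0 y1; have /andP[m0 m1] := mobius_inv_itv y0 y1.
rewrite -{1}(mobius_invK y0 y1) -f_mobius// /g0.
apply: pinvKV; last by rewrite inE/= in_itv/= m0.
move=> a b; rewrite !inE/= !in_itv/= => /andP[a0 a1] /andP[b_0 b_1].
by rewrite !f_mobius// => /(congr1 mobius_inv); rewrite !mobiusK.
Qed.

Definition beta1 (v : R * R * R) : R * R * R := (rho * v.1.1, mobius v.1.2, 0).
Definition beta2 (v : R * R * R) : R * R * R :=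
  (3 / 4 - rho * v.1.1, sigma * (1 - v.1.2), 0).
Definition beta3 (v : R * R * R) : R * R * R := (rho * v.1.1, mobius v.1.2, 5 / 6).

Local Notation Lam := (Lambda rho sigma).
Local Notation Rect := (R1 rho `|` R2 rho sigma `|` R3 rho).

Lemma Lambda_unfold v : Lam v <-> Rect v /\ Lam (G rho sigma v).
Proof.
split=> [Lv|[Rv LG] [|n] _] /=.
- by split; [exact: (Lv 0%N)|exact: Lambda_G].
- exact: Rv.
- by rewrite -iterS iterSr; exact: (LG n).
Qed.

Lemma Rect_bounds v : Rect v -> 0 <= v.1.2 <= 1 /\
  ((v.2 = 0 /\ 0 <= v.1.1 <= 3 / 4) \/ (v.2 = 5 / 6 /\ 0 <= v.1.1 <= rho)).
Proof.
case: v => [[x y] z]; rewrite /R1 /R2 /R3 /=.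
have r0 := rho_gt0; have r1 := rho_lt; have s0 := sigma_gt0; have s1 := sigma_lt.
by case=> [[|]|] [] [] /=; rewrite !in_itv/= => /andP[? ?] /andP[? ?] ->;
  (split; first by apply/andP; split; lra); [left|left|right];
  (split; first by []); apply/andP; split; lra.
Qed.

Lemma Lambda_bounds v : Lam v -> 0 <= v.1.2 <= 1 /\
  ((v.2 = 0 /\ 0 <= v.1.1 <= 3 / 4) \/ (v.2 = 5 / 6 /\ 0 <= v.1.1 <= rho)).
Proof. by move=> /Lambda_unfold[/Rect_bounds]. Qed.

Lemma G_R13 x y z : (R1 rho `|` R3 rho) (x, y, z) ->
  G rho sigma (x, y, z) = (rho^-1 * x, mobius_inv y, 0).
Proof.
move=> H; rewrite /G (mem_set H).
by rewrite g0_mobius//; case: H => -[[/= _]]; rewrite in_itv/= => /andP[].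
Qed.

Lemma G_R2 x y z : R2 rho sigma (x, y, z) ->
  G rho sigma (x, y, z) = (rho^-1 * (3 / 4 - x), 1 - sigma^-1 * y, 5 / 6).
Proof.
move=> H; rewrite /G (mem_set H) ifF//; apply/negP => /set_mem.
case: H => -[/=]; rewrite /R1 /R3 !in_itv/= => /andP[x1 x2] _ z0.
case=> -[[/=]]; rewrite !in_itv/= => /andP[x3 x4] _; last by rewrite z0; lra.
by have := rho_lt; lra.
Qed.

Lemma G_beta1 v : Lam v -> v.2 = 0 -> Lam (beta1 v) /\ G rho sigma (beta1 v) = v.
Proof.
move=> Lv z0; have [/andP[y0 y1] H] := Lambda_bounds Lv.
have /andP[x0 x1] : 0 <= v.1.1 <= 3 / 4.
  by case: H => -[z /andP[? ?]]; have := rho_lt; lra.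
have B : (R1 rho `|` R3 rho) (beta1 v).
  left; split; last by []; split => /=; rewrite in_itv/=.
    by rewrite mulr_ge0 ?(ltW rho_gt0)//=; have := rho_gt0; nra.
  by rewrite mobius_ge0// mobius_le1.
have GB : G rho sigma (beta1 v) = v.
  rewrite /beta1 G_R13// mobiusK// mulKf ?gt_eqF//.
  by case: v z0 {Lv H y0 y1 x0 x1 B} => [[? ?] ?] /= ->.
split=> //; apply/Lambda_unfold; rewrite GB; split => //.
by case: B => B; [left; left|right].
Qed.

Lemma G_beta3 v : Lam v -> v.2 = 0 -> Lam (beta3 v) /\ G rho sigma (beta3 v) = v.
Proof.
move=> Lv z0; have [/andP[y0 y1] H] := Lambda_bounds Lv.
have /andP[x0 x1] : 0 <= v.1.1 <= 3 / 4.
  by case: H => -[z /andP[? ?]]; have := rho_lt; lra.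
have B : (R1 rho `|` R3 rho) (beta3 v).
  right; split; last by []; split => /=; rewrite in_itv/=.
    by rewrite mulr_ge0 ?(ltW rho_gt0)//=; have := rho_gt0; nra.
  by rewrite mobius_ge0// mobius_le1.
have GB : G rho sigma (beta3 v) = v.
  rewrite /beta3 G_R13// mobiusK// mulKf ?gt_eqF//.
  by case: v z0 {Lv H y0 y1 x0 x1 B} => [[? ?] ?] /= ->.
split=> //; apply/Lambda_unfold; rewrite GB; split => //.
by case: B => B; [left; left|right].
Qed.

Lemma G_beta2 v : Lam v -> v.2 <> 0 -> Lam (beta2 v) /\ G rho sigma (beta2 v) = v.
Proof.
move=> Lv z0; have [/andP[y0 y1] [[//]|[z56 /andP[x0 x1]]]] := Lambda_bounds Lv.
have B : R2 rho sigma (beta2 v).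
  split; last by []; split => /=; rewrite in_itv/=; apply/andP; split.
  - by have := rho_gt0; have := rho_lt; nra.
  - by have := rho_gt0; nra.
  - by rewrite mulr_ge0 ?(ltW sigma_gt0)// subr_ge0.
  - by have := sigma_gt0; nra.
have GB : G rho sigma (beta2 v) = v.
  rewrite /beta2 G_R2// subKr !mulKf ?gt_eqF// subKr.
  by case: v z56 {Lv z0 y0 y1 x0 x1 B} => [[? ?] ?] /= ->.
split=> //; apply/Lambda_unfold; rewrite GB; split => //.
by left; right.
Qed.

Lemma G_preimage w v : Lam w -> G rho sigma w = v ->
  (v.2 = 0 -> w = beta1 v \/ w = beta3 v) /\ (v.2 <> 0 -> w = beta2 v).
Proof.
move=> /Lambda_unfold[+ _]; case: w => [[x y] z] H.
have [H13|H2] : (R1 rho `|` R3 rho) (x, y, z) \/ R2 rho sigma (x, y, z).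
  by case: H => [[|]|]; [left; left|right|left; right].
  have yb : 0 <= y <= 1 by case: H13 => -[[/= _]]; rewrite in_itv/=.
  case/andP: yb => y0 y1.
  rewrite G_R13// => <- /=; split => // _.
  rewrite /beta1 /beta3/= mobius_invK// mulVKf ?gt_eqF//.
  by case: H13 => -[_ /= ->]; [left|right].
rewrite G_R2// => <- /=; split => [|_]; first by move=> /eqP; rewrite gt_eqF// divr_gt0.
rewrite /beta2/= mulVKf ?gt_eqF// !subKr mulVKf ?gt_eqF//.
by case: H2 => _ /= ->.
Qed.

End inverse_branches.

Lemma cvg_triple {R : realType} {I : Type} (F : set_system I) {FF : Filter F}
    (x y z : I -> R) (a b c : R) : x @ F --> a -> y @ F --> b -> z @ F --> c ->
  (x i, y i, z i) @[i --> F] --> (a, b, c).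
Proof.
move=> xa yb zc.
apply: (@cvg_pair _ _ _ F (nbhs (a, b)) (nbhs c) _ _ _ (fun i => (x i, y i)) z) => //.
exact: (@cvg_pair _ _ _ F (nbhs a) (nbhs b)).
Qed.

(** * Compactness of the invariant set *)

(** G is discontinuous as a total map, but an ultrafilter concentrates on one of the
three rectangles, on which G is continuous. *)
Section closure_of_Lambda.
Context {R : realType}.
Variables rho sigma : R.
Hypothesis hrho : 0 < rho < 3^-1.
Hypothesis hsigma : 0 < sigma < 3^-1.
Local Notation Lam := (Lambda rho sigma).
Local Notation Rect := (R1 rho `|` R2 rho sigma `|` R3 rho).
Variables (F : set_system (R * R * R)) (v : R * R * R).
Hypothesis F_ultra : UltraFilter F.
Hypothesis F_cvg : F --> v.

Lemma coordinates_cvg : [/\ w.1.1 @[w --> F] --> v.1.1,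
  w.1.2 @[w --> F] --> v.1.2 & w.2 @[w --> F] --> v.2].
Proof.
have F1 : w.1 @[w --> F] --> v.1.
  by apply: (cvg_comp _ _ F_cvg); exact: cvg_fst.
split; last by apply: (cvg_comp _ _ F_cvg); exact: cvg_snd.
  by apply: (cvg_comp _ _ F1); exact: cvg_fst.
by apply: (cvg_comp _ _ F1); exact: cvg_snd.
Qed.

Lemma box_limit (a b c d e : R) :
  F (`[a, b] `*` `[c, d] `*` [set e]) -> (`[a, b] `*` `[c, d] `*` [set e]) v.
Proof.
move=> FB; have [cx cy cz] := coordinates_cvg; split; [split|] => /=.
- rewrite in_itv/=; apply/andP; split.
    apply: (cvgr_to_ge cx); apply: filterS FB => -[[x y] z] [[/= + _] _].
    by rewrite in_itv/= => /andP[].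
  apply: (cvgr_to_le cx); apply: filterS FB => -[[x y] z] [[/= + _] _].
  by rewrite in_itv/= => /andP[].
- rewrite in_itv/=; apply/andP; split.
    apply: (cvgr_to_ge cy); apply: filterS FB => -[[x y] z] [[/= _ +] _].
    by rewrite in_itv/= => /andP[].
  apply: (cvgr_to_le cy); apply: filterS FB => -[[x y] z] [[/= _ +] _].
  by rewrite in_itv/= => /andP[].
- apply/eqP; rewrite eq_le; apply/andP; split.
    by apply: (cvgr_to_le cz); apply: filterS FB => -[[x y] z] [_ /= ->].
  by apply: (cvgr_to_ge cz); apply: filterS FB => -[[x y] z] [_ /= ->].
Qed.

Lemma Rect_G_limit : F Rect -> Rect v /\ G rho sigma @ F --> G rho sigma v.
Proof.
have [cx cy cz] := coordinates_cvg.
have r0 : 0 < rho by case/andP: hrho.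
have H13 : F (R1 rho `|` R3 rho) -> (R1 rho `|` R3 rho) v -> 
    G rho sigma @ F --> G rho sigma v.
  move=> F13 v13.
  have vE : v = (v.1.1, v.1.2, v.2) by case: v => -[].
  have yb : 0 <= v.1.2 <= 1.
    by case: v13 => -[[_]]; rewrite /= in_itv.
  rewrite vE G_R13 -?vE//.
  apply: (@cvg_trans _ ((rho^-1 * w.1.1, mobius_inv w.1.2, 0 : R) @[w --> F])).
    apply: near_eq_cvg; apply: filterS F13 => -[[x y] z] H.
    by rewrite (G_R13 sigma H).
  have /andP[y0 y1] := yb; have d := mobius_inv_den_gt0 y0 y1.
  apply: cvg_triple; last exact: cvg_cst.
    by apply: cvgM => //; exact: cvg_cst.
  apply: cvgM => //; apply: cvgV; first by rewrite gt_eqF.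
  apply: cvgD => //; apply: cvgM; first exact: cvg_cst.
  by apply: cvgB => //; exact: cvg_cst.
move=> FR.
have [F1|nF1] := in_ultra_setVsetC (R1 rho) F_ultra.
  have v1 : R1 rho v by exact: box_limit.
  split; first by left; left.
  by apply: (H13 (@filterS _ F _ _ _ _ F1)) => [w ?|]; left.
have [F3|nF3] := in_ultra_setVsetC (R3 rho) F_ultra.
  have v3 : R3 rho v by exact: box_limit.
  split; first by right.
  by apply: (H13 (@filterS _ F _ _ _ _ F3)) => [w ?|]; right.
have F2 : F (R2 rho sigma).
  apply: (@filterS _ F _ _ _ _ (filterI FR (filterI nF1 nF3))) => w.
  by move=> [[[H1|H2]|H3] [n1 n3]].
have v2 : R2 rho sigma v by exact: box_limit.
split; first by left; right.
have vE : v = (v.1.1, v.1.2, v.2) by case: v => -[].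
rewrite vE (G_R2 hrho) -?vE//.
apply: (@cvg_trans _ ((rho^-1 * (3 / 4 - w.1.1), 1 - sigma^-1 * w.1.2, 5 / 6 : R) @[w --> F])).
  apply: near_eq_cvg; apply: filterS F2 => -[[x y] z] H.
  by rewrite (G_R2 hrho H).
apply: cvg_triple; last exact: cvg_cst.
  by apply: cvgM; [exact: cvg_cst|apply: cvgB => //; exact: cvg_cst].
by apply: cvgB; [exact: cvg_cst|apply: cvgM => //; exact: cvg_cst].
Qed.

End closure_of_Lambda.

Section compactness_of_Lambda.
Context {R : realType}.
Variables rho sigma : R.
Hypothesis hrho : 0 < rho < 3^-1.
Hypothesis hsigma : 0 < sigma < 3^-1.
Local Notation Lam := (Lambda rho sigma).
Local Notation T := (LambdaT sigma hrho).

Lemma Lambda_limit (F : set_system (R * R * R)) v :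
  UltraFilter F -> F --> v -> F Lam -> Lam v.
Proof.
move=> FU Fv FL n _ /=; elim: n F v FU Fv FL => [|n IH] F v FU Fv FL.
  have FR : F (R1 rho `|` R2 rho sigma `|` R3 rho).
    by apply: (@filterS _ F _ _ _ _ FL) => w /Lambda_unfold[].
  by have [] := Rect_G_limit hrho FU Fv FR.
have FR : F (R1 rho `|` R2 rho sigma `|` R3 rho).
  by apply: (@filterS _ F _ _ _ _ FL) => w /Lambda_unfold[].
have [_ FG] := Rect_G_limit hrho FU Fv FR.
have GFL : (G rho sigma @ F) Lam.
  by apply: (@filterS _ F _ _ _ _ FL) => w; exact: Lambda_G.
by have := IH _ _ (fmap_ultra (G rho sigma) FU) FG GFL; rewrite -iterSr.
Qed.

Lemma cvg_LambdaT (F : set_system T) (p : T) : Filter F ->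
  (val : T -> R * R * R) @ F --> val p -> F --> p.
Proof.
move=> FF Fp U; rewrite nbhsE => -[V [oV Vp] VU]; apply: filterS VU _.
case: oV => O oO OV; rewrite -OV; apply: Fp.
by apply: open_nbhs_nbhs; split => //; rewrite -OV in Vp.
Qed.

Lemma val_continuous : continuous (val : T -> R * R * R).
Proof. exact: initial_continuous. Qed.

Lemma LambdaT_compact : compact [set: T].
Proof.
rewrite compact_ultra => F FU _.
have VU := fmap_ultra (val : T -> R * R * R) FU.
have cB : compact (`[0, 1] `*` `[0, 1] `*` `[0, 1] : set (R * R * R)).
  by do ?apply: compact_setX; exact: segment_compact.
move: cB; rewrite compact_ultra => /(_ _ VU)[].
  apply: (@filterE _ F) => p /=; have := Lambda_bounds hrho hsigma (set_mem (valP p)).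
  move=> [/andP[y0 y1] H].
  have rho3 : rho < 1 / 3 by case/andP: hrho; rewrite div1r.
  split; [split|]; rewrite /= in_itv/=; apply/andP; split => //.
  - by case: H => -[_ /andP[]].
  - by case: H => -[_ /andP[? ?]]; lra.
  - by case: H => -[-> _]; lra.
  - by case: H => -[-> _]; lra.
move=> v [_ Fv].
have Lv : Lam v.
  apply: (Lambda_limit VU) => //.
  by apply: (@filterE _ F) => p; exact: set_mem (valP p).
exists (exist _ v (mem_set Lv)); split => //.
exact: cvg_LambdaT.
Qed.

Definition distance_to (C : set (R * R * R)) (v : R * R * R) : R :=
  inf [set `|v - w| | w in C].

Lemma distance_to_lipschitz C v v' : C !=set0 ->
  distance_to C v <= `|v - v'| + distance_to C v'.
Proof.
move=> [c Cc]; rewrite addrC -lerBlDr; apply: lb_le_inf.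
  by exists `|v' - c|, c.
move=> _ [w Cw <-]; rewrite lerBlDr.
apply: (@le_trans _ _ `|v - w|).
  apply: ge_inf; last by exists w.
  by exists 0 => _ [w' _ <-].
have -> : v - w = (v' - w) + (v - v') by rewrite [RHS]addrC subrKA.
exact: ler_normD.
Qed.

Lemma distance_to_continuous C : C !=set0 -> continuous (distance_to C).
Proof.
move=> C0 v; apply/cvgrPdist_lt => eps eps0.
have : \forall w \near v, `|v - w| < eps.
  exact: (@cvgr_dist_lt _ _ _ _ _ id v cvg_id).
apply: filterS => w vw; apply: le_lt_trans vw.
rewrite ler_norml; apply/andP; split.
  by rewrite lerNl opprB lerBlDr [`|v - w|]distrC distance_to_lipschitz.
by rewrite lerBlDr distance_to_lipschitz.
Qed.

(** The function is the distance to the complement of an open set of the ambient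
space. *)
Lemma LambdaT_open_cozero (U : set T) : open U ->
  exists2 g : T -> R, continuous g /\ (forall x, 0 <= g x) &
    U = [set x | 0 < g x].
Proof.
case=> O oO OU.
have [C0|/set0P] := eqVneq (~` O) set0.
  exists (fun=> 1); first by split=> x; [exact: cst_continuous|exact: ler01].
  rewrite -OU -(setCK O) C0 setC0 preimage_setT; apply/seteqP; split => // x _ /=.
  exact: ltr01.
move=> C0.
exists (fun p => distance_to (~` O) (val p)).
  split=> [p|p].
    apply: (@continuous_comp _ _ _ (val : T -> R * R * R) (distance_to (~` O))).
      exact: val_continuous.
    exact: distance_to_continuous.
  apply: lb_le_inf => [|_ [w _ <-]//].
  by have [c Cc] := C0; exists `|val p - c|, c.
rewrite -OU; apply/seteqP; split => p /=.
  move=> Op.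
  have /nbhs_ballP[r /= r0 Hr] : nbhs (val p) O by exact: open_nbhs_nbhs.
  apply: (lt_le_trans r0); apply: lb_le_inf.
    by have [c Cc] := C0; exists `|val p - c|, c.
  move=> _ [w Cw <-]; rewrite leNgt; apply/negP => pw; apply: Cw; apply: Hr.
  by rewrite -ball_normE.
move=> d0; apply: contrapT => nOp; move: d0; rewrite ltNge => /negP; apply.
apply: ge_inf; last by exists (val p); rewrite ?subrr ?normr0.
by exists 0 => _ [w' _ <-].
Qed.

End compactness_of_Lambda.

(** * The transfer operator as a two-state operator *)

Section lifted_branches.
Context {R : realType}.
Variables rho sigma : R.
Hypothesis hrho : 0 < rho < 3^-1.
Hypothesis hsigma : 0 < sigma < 3^-1.
Local Notation Lam := (Lambda rho sigma).
Local Notation T := (LambdaT sigma hrho).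

(** The value p is a default, never met on the level where B is an inverse branch. *)
Definition lift_branch (B : R * R * R -> R * R * R) (p : T) : T :=
  match pselect (Lam (B (val p))) with
  | left LB => exist _ (B (val p)) (mem_set LB)
  | right _ => p
  end.

Lemma val_lift_branch B (p : T) : Lam (B (val p)) ->
  val (lift_branch B p) = B (val p).
Proof. by rewrite /lift_branch; case: pselect. Qed.

Definition on_ground (p : T) : bool := (val p).2 == 0.

Local Notation b1 := (lift_branch (beta1 rho)).
Local Notation b2 := (lift_branch (beta2 rho sigma)).
Local Notation b3 := (lift_branch (beta3 rho)).

Lemma Lam_val (p : T) : Lam (val p).
Proof. exact: set_mem (valP p). Qed.

Lemma val_b1 p : on_ground p -> val (b1 p) = beta1 rho (val p).
Proof.
move=> /eqP p0; apply: val_lift_branch.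
by have [] := G_beta1 hrho hsigma (Lam_val p) p0.
Qed.

Lemma val_b3 p : on_ground p -> val (b3 p) = beta3 rho (val p).
Proof.
move=> /eqP p0; apply: val_lift_branch.
by have [] := G_beta3 hrho hsigma (Lam_val p) p0.
Qed.

Lemma val_b2 p : ~~ on_ground p -> val (b2 p) = beta2 rho sigma (val p).
Proof.
move=> /eqP p0; apply: val_lift_branch.
by have [] := G_beta2 hrho hsigma (Lam_val p) p0.
Qed.

Lemma ground_b1 p : on_ground p -> on_ground (b1 p).
Proof. by move=> p0; rewrite /on_ground val_b1. Qed.

Lemma ground_b2 p : ~~ on_ground p -> on_ground (b2 p).
Proof. by move=> p0; rewrite /on_ground val_b2. Qed.

Lemma ground_b3 p : on_ground p -> ~~ on_ground (b3 p).
Proof. by move=> p0; rewrite /on_ground val_b3//= gt_eqF// divr_gt0. Qed.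

Lemma transfer_branch_op (phi u : T -> R) :
  transfer phi u = branch_op on_ground b1 b2 b3 (fun p => expR (phi p)) u.
Proof.
apply/funext => x; rewrite /transfer /branch_op; case: ifPn => x0.
  have b13 : b1 x <> b3 x.
    by move=> /(congr1 on_ground); rewrite ground_b1// (negbTE (ground_b3 x0)).
  have -> : GL @^-1` [set x] = [set b1 x] `|` [set b3 x].
    apply/seteqP; split => [w /= wx|w [] /= ->].
    - have wx' : G rho sigma (val w) = val x by rewrite -wx.
      have [/(_ (eqP x0))H _] := G_preimage hrho hsigma (Lam_val w) wx'.
      by case: H => H; [left|right]; apply: val_inj; rewrite H ?val_b1 ?val_b3.
    - apply: val_inj => /=; rewrite val_b1//.
      by have [] := G_beta1 hrho hsigma (Lam_val x) (eqP x0).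
    - apply: val_inj => /=; rewrite val_b3//.
      by have [] := G_beta3 hrho hsigma (Lam_val x) (eqP x0).
  rewrite fsbigU0 ?fsbig_set1//; try exact: finite_set1.
  by move=> w [/= -> /b13].
have -> : GL @^-1` [set x] = [set b2 x].
  apply/seteqP; split => [w /= wx|w /= ->].
  - have wx' : G rho sigma (val w) = val x by rewrite -wx.
    have [_ /(_ (elimN eqP x0))H] := G_preimage hrho hsigma (Lam_val w) wx'.
    by apply: val_inj; rewrite H val_b2.
  - apply: val_inj => /=; rewrite val_b2//.
    by have [] := G_beta2 hrho hsigma (Lam_val x) (elimN eqP x0).
by rewrite fsbig_set1.
Qed.

Lemma val_coordinates_cvg (F : set_system T) (p : T) : F --> p ->
  [/\ (val q).1.1 @[q --> F] --> (val p).1.1,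
      (val q).1.2 @[q --> F] --> (val p).1.2 &
      (val q).2 @[q --> F] --> (val p).2].
Proof.
move=> Fp.
have vp : (val q : R * R * R) @[q --> F] --> (val p : R * R * R).
  by apply: (cvg_comp _ _ Fp); exact: val_continuous.
have v1 : (val q).1 @[q --> F] --> (val p).1.
  by apply: (cvg_comp _ _ vp); exact: cvg_fst.
split; last by apply: (cvg_comp _ _ vp); exact: cvg_snd.
  by apply: (cvg_comp _ _ v1); exact: cvg_fst.
by apply: (cvg_comp _ _ v1); exact: cvg_snd.
Qed.

Lemma val_bounds (p : T) : 0 <= (val p).1.2 <= 1.
Proof. by case: (Lambda_bounds hrho hsigma (Lam_val p)). Qed.

Lemma val_level (p q : T) : on_ground p = on_ground q -> (val p).2 = (val q).2.
Proof.
have [_ Hp] := Lambda_bounds hrho hsigma (Lam_val p).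
have [_ Hq] := Lambda_bounds hrho hsigma (Lam_val q).
rewrite /on_ground; case: Hp => -[-> _]; case: Hq => -[-> _] //; rewrite eqxx.
  by move/esym; rewrite gt_eqF// divr_gt0.
by rewrite gt_eqF// divr_gt0.
Qed.

Lemma on_ground_near (F : set_system T) (p : T) : Filter F -> F --> p ->
  \forall q \near F, on_ground q = on_ground p.
Proof.
move=> FF /val_coordinates_cvg[_ _ /cvgrPdist_lt/(_ (5 / 6))].
have h : 0 < 5 / 6 :> R by rewrite divr_gt0.
move=> /(_ h); apply: filterS => q.
have [_ Hp] := Lambda_bounds hrho hsigma (Lam_val p).
have [_ Hq] := Lambda_bounds hrho hsigma (Lam_val q).
rewrite /on_ground; case: Hp => -[-> _]; case: Hq => -[-> _] //.
  by rewrite sub0r normrN gtr0_norm// ltxx.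
by rewrite subr0 gtr0_norm// ltxx.
Qed.

Lemma mobius_cvg {I : Type} (F : set_system I) {FF : Filter F} (u : I -> R) (y : R) :
  0 <= y -> u @ F --> y -> mobius (u i) @[i --> F] --> mobius y.
Proof.
move=> y0 uy; apply: cvgM; first by apply: cvgM => //; exact: cvg_cst.
apply: cvgV; first by rewrite gt_eqF// mobius_den_gt0.
by apply: cvgD; [exact: cvg_cst|apply: cvgM => //; exact: cvg_cst].
Qed.

Lemma lift_branch_cvg (B : R * R * R -> R * R * R) (F : set_system T) (p : T) :
  Filter F -> val (lift_branch B p) = B (val p) ->
  (\forall q \near F, val (lift_branch B q) = B (val q)) ->
  B (val q) @[q --> F] --> B (val p) -> lift_branch B q @[q --> F] --> lift_branch B p.
Proof.
move=> FF vE nB; rewrite -vE => cB; apply: cvg_LambdaT; apply: cvg_trans cB.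
apply: (@near_eq_cvg _ _ F _ (fun q => B (val q))
  (fun q => val (lift_branch B q))).
by apply: filterS nB => q ->.
Qed.

Lemma branch_op_cvg (W u : T -> R) (F : set_system T) (p : T) : Filter F ->
  continuous W -> continuous u -> F --> p ->
  branch_op on_ground b1 b2 b3 W u q @[q --> F] -->
    branch_op on_ground b1 b2 b3 W u p.
Proof.
move=> FF cW cu Fp; have [cx cy cz] := val_coordinates_cvg Fp.
have /andP[y0 y1] := val_bounds p.
have comp (b : T -> T) : b q @[q --> F] --> b p ->
    W (b q) * u (b q) @[q --> F] --> W (b p) * u (b p).
  move=> bp; apply: cvgM.
    exact: (@cvg_comp _ _ _ b W _ _ _ bp (cW (b p))).
  exact: (@cvg_comp _ _ _ b u _ _ _ bp (cu (b p))).
have near_p := on_ground_near FF Fp.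
rewrite {2}/branch_op; case: ifPn => p0.
  apply: (@cvg_trans _ ((W (b1 q) * u (b1 q) + W (b3 q) * u (b3 q)) @[q --> F])).
    by apply: near_eq_cvg; apply: filterS near_p => q qp; rewrite /branch_op qp p0.
  apply: cvgD; apply: comp; apply: lift_branch_cvg.
  - exact: val_b1.
  - by apply: filterS near_p => q qp; rewrite val_b1// qp.
  - apply: cvg_triple; [|exact: mobius_cvg|exact: cvg_cst].
    by apply: cvgM => //; exact: cvg_cst.
  - exact: val_b3.
  - by apply: filterS near_p => q qp; rewrite val_b3// qp.
  - apply: cvg_triple; [|exact: mobius_cvg|exact: cvg_cst].
    by apply: cvgM => //; exact: cvg_cst.
apply: (@cvg_trans _ ((W (b2 q) * u (b2 q)) @[q --> F])).
  apply: near_eq_cvg; apply: filterS near_p => q qp.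
  by rewrite /branch_op qp (negbTE p0).
apply: comp; apply: lift_branch_cvg.
- exact: val_b2.
- by apply: filterS near_p => q qp; rewrite val_b2// qp.
apply: cvg_triple; last exact: cvg_cst.
  by apply: cvgB; [exact: cvg_cst|apply: cvgM => //; exact: cvg_cst].
apply: cvgM; first exact: cvg_cst.
by apply: cvgB => //; exact: cvg_cst.
Qed.

Lemma branch_op_continuous (W u : T -> R) : continuous W -> continuous u ->
  continuous (branch_op on_ground b1 b2 b3 W u).
Proof. by move=> cW cu p; exact: (branch_op_cvg (nbhs_filter p)). Qed.

End lifted_branches.

(** * The gauge and its contraction *)

Section cross_ratio.
Context {R : realType}.
Local Notation e1 := (expR 1 : R).
Implicit Types y w s Y : R.

(** The quantity 1 - (y/(1-y)) / (w/(1-w)) for y < w, a function of the cross ratio of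
y, w, 0 and 1. It is an increasing function of the hyperbolic distance on the
unit interval but, unlike that distance, it is bounded. *)
Definition cross_ratio y w : R :=
  `|y - w| / (Num.max y w * (1 - Num.min y w)).

Lemma cross_ratioC y w : cross_ratio y w = cross_ratio w y.
Proof. by rewrite /cross_ratio distrC maxC minC. Qed.

Lemma cross_ratioxx y : cross_ratio y y = 0.
Proof. by rewrite /cross_ratio subrr normr0 mul0r. Qed.

Lemma cross_ratio_lt y w : y < w -> cross_ratio y w = (w - y) / (w * (1 - y)).
Proof.
by move=> yw; rewrite /cross_ratio distrC gtr0_norm ?subr_gt0// max_r ?min_l ?ltW.
Qed.

Lemma cross_ratio_ge0 y w : 0 <= y <= 1 -> 0 <= w <= 1 -> 0 <= cross_ratio y w.
Proof.
move=> /andP[y0 y1] /andP[w0 w1]; rewrite /cross_ratio divr_ge0// mulr_ge0//.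
  by rewrite le_max y0.
by rewrite subr_ge0 ge_min y1.
Qed.

Lemma unit_interval_wlog (Q : R -> R -> Prop) :
  (forall y w, Q y w -> Q w y) -> (forall y, 0 <= y <= 1 -> Q y y) ->
  (forall y w, 0 <= y -> y < w -> w <= 1 -> Q y w) ->
  forall y w, 0 <= y <= 1 -> 0 <= w <= 1 -> Q y w.
Proof.
move=> QC Qxx Qlt y w /andP[y0 y1] /andP[w0 w1].
have [yw|wy|<-] := ltgtP y w; [exact: Qlt|apply: QC; exact: Qlt|].
by apply: Qxx; rewrite y0.
Qed.

Lemma cross_ratio_bounds y w : 0 <= y <= 1 -> 0 <= w <= 1 ->
  `|y - w| <= cross_ratio y w <= 1.
Proof.
move: y w; apply: unit_interval_wlog => [y w|y _|y w y0 yw w1].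
- by rewrite distrC cross_ratioC.
- by rewrite cross_ratioxx subrr normr0 lexx ler01.
have w0 : 0 < w := le_lt_trans y0 yw.
have d0 : 0 < w * (1 - y) by rewrite mulr_gt0// subr_gt0 (lt_le_trans yw).
rewrite cross_ratio_lt// distrC gtr0_norm ?subr_gt0//; apply/andP; split.
  rewrite ler_pdivlMr// -[leRHS]mulr1; apply: ler_wpM2l.
    by rewrite subr_ge0 ltW.
  by rewrite mulr_ile1 ?subr_ge0 ?(ltW w0)// ?(ltW (lt_le_trans yw w1))// gerBl.
rewrite ler_pdivrMr// mul1r mulrBr mulr1 lerD2l lerN2 -[leRHS]mul1r.
exact: ler_wpM2r.
Qed.

Lemma mobius_sub y w : 0 <= y -> 0 <= w -> mobius w - mobius y =
  e1 * (w - y) / ((1 + (e1 - 1) * y) * (1 + (e1 - 1) * w)).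
Proof.
move=> y0 w0; have dy := mobius_den_gt0 y0; have dw := mobius_den_gt0 w0.
by rewrite /mobius; field; rewrite !gt_eqF.
Qed.

Lemma mobius_lt y w : 0 <= y -> y < w -> mobius y < mobius w.
Proof.
move=> y0 yw; have w0 := ltW (le_lt_trans y0 yw).
by rewrite -subr_gt0 mobius_sub// divr_gt0// ?mulr_gt0 ?mobius_den_gt0 ?subr_gt0.
Qed.

Lemma mobius_le y w : 0 <= y -> y <= w -> mobius y <= mobius w.
Proof.
by move=> y0; rewrite le_eqVlt => /orP[/eqP->//|yw]; apply/ltW/mobius_lt.
Qed.

Lemma mobius_lipschitz y w : 0 <= y <= 1 -> 0 <= w <= 1 ->
  `|mobius y - mobius w| <= e1 * `|y - w|.
Proof.
move: y w; apply: unit_interval_wlog => [y w|y _|y w y0 yw w1].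
- by rewrite distrC [`|w - y|]distrC.
- by rewrite !subrr !normr0 mulr0.
have w0 := ltW (le_lt_trans y0 yw).
rewrite distrC gtr0_norm ?subr_gt0 ?mobius_lt// distrC gtr0_norm ?subr_gt0//.
have ey0 : 0 <= e1 * (w - y) by rewrite mulr_ge0 ?expR_ge0// subr_ge0 ltW.
have d1 : 1 <= (1 + (e1 - 1) * y) * (1 + (e1 - 1) * w).
  by rewrite mulr_ege1// mobius_den_ge1.
rewrite mobius_sub// ler_pdivrMr ?(lt_le_trans _ d1)// -[leLHS]mulr1.
exact: ler_wpM2l.
Qed.

(** The map f multiplies y / (1 - y) by e, for every y. *)
Lemma cross_ratio_mobius y w : 0 <= y <= 1 -> 0 <= w <= 1 ->
  cross_ratio (mobius y) (mobius w) = cross_ratio y w.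
Proof.
move: y w; apply: unit_interval_wlog => [y w|y _|y w y0 yw w1].
- by rewrite cross_ratioC [cross_ratio w y]cross_ratioC.
- by rewrite !cross_ratioxx.
have w0 : 0 < w := le_lt_trans y0 yw.
have y1 : y < 1 := lt_le_trans yw w1.
have dy := mobius_den_gt0 y0; have dw := mobius_den_gt0 (ltW w0).
rewrite !cross_ratio_lt ?mobius_lt// mobius_sub ?(ltW w0)//.
have -> : 1 - mobius y = (1 - y) / (1 + (e1 - 1) * y).
  by rewrite /mobius; field; rewrite gt_eqF.
have e0 : 0 < e1 by exact: expR_gt0.
rewrite /mobius; field.
by rewrite !gt_eqF// subr_gt0.
Qed.

(** The cross ratio is symmetric under y -> 1 - y, and multiplication by s brings
the interval away from 1: the exact factor is w / (1 - s + s w), w being the larger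
of the two points, which is below 1 unless w = 1. *)
Lemma cross_ratio_flip s Y y w : 0 < s -> s < 1 -> 0 <= y <= 1 -> 0 <= w <= 1 ->
  y <= Y -> w <= Y ->
  cross_ratio (s * (1 - y)) (s * (1 - w)) <= Y / (1 - s + s * Y) * cross_ratio y w.
Proof.
move=> s0 s1; move: y w.
apply: unit_interval_wlog => [y w H wY yY|y _ _ _|y w y0 yw w1 yY wY].
- by rewrite cross_ratioC [cross_ratio w y]cross_ratioC; exact: H.
- by rewrite !cross_ratioxx mulr0.
have w0 : 0 < w := le_lt_trans y0 yw.
have y1 : y < 1 := lt_le_trans yw w1.
have dw : 0 < 1 - s + s * w by rewrite addr_gt0 ?subr_gt0// mulr_gt0.
have Y0 : 0 < Y := lt_le_trans w0 wY.
have dY : 0 < 1 - s + s * Y by rewrite addr_gt0 ?subr_gt0// mulr_gt0.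
have swy : s * (1 - w) < s * (1 - y) by rewrite ltr_pM2l// ltrD2l ltrN2.
rewrite cross_ratioC !cross_ratio_lt//.
have -> : (s * (1 - y) - s * (1 - w)) / (s * (1 - y) * (1 - s * (1 - w))) =
  w / (1 - s + s * w) * ((w - y) / (w * (1 - y))).
  by field; rewrite !gt_eqF ?subr_gt0.
apply: ler_wpM2r.
  by rewrite divr_ge0 ?mulr_ge0 ?subr_ge0 ?(ltW w0) ?(ltW y1) ?(ltW yw).
by rewrite ler_pdivrMr// mulrAC ler_pdivlMr//; nra.
Qed.

End cross_ratio.

(** The exponent of the gauge in the second coordinate is a in total, as needed to
dominate the Euclidean distance to the power a, since the cross ratio is at least
|y - w|. Only the part b of the exponent is subject to expansion, by the factor
e^b, and the part a - b, at least a/2, is contracted by the flip. *)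
Section horseshoe_gauge.
Context {R : realType}.
Variables rho sigma : R.
Hypothesis hrho : 0 < rho < 3^-1.
Hypothesis hsigma : 0 < sigma < 3^-1.
Local Notation T := (LambdaT sigma hrho).
Local Notation b1 := (lift_branch (beta1 rho)).
Local Notation b2 := (lift_branch (beta2 rho sigma)).
Local Notation b3 := (lift_branch (beta3 rho)).
Local Notation A := (@on_ground R rho sigma hrho).
Local Notation e1 := (expR 1 : R).
Variables (a b : R) (k0 : nat).
Hypothesis a_gt0 : 0 < a.
Hypothesis a_le1 : a <= 1.
Hypothesis b_gt0 : 0 < b.
Hypothesis b_le : b <= a / 2.

Let sigma_gt0 : 0 < sigma. Proof. by case/andP: hsigma. Qed.
Let sigma_lt1 : sigma < 1.
Proof. by case/andP: hsigma => _ /lt_trans; apply; rewrite invf_lt1// ltr1n. Qed.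
Let rho_gt0 : 0 < rho. Proof. by case/andP: hrho. Qed.
Let rho_lt1 : rho < 1.
Proof. by case/andP: hrho => _ /lt_trans; apply; rewrite invf_lt1// ltr1n. Qed.
Let b_lt_a : b < a. Proof. by have := a_gt0; have := b_le; lra. Qed.

(** Bound on y after k steps of f from the image of a flip, which lies in
[0, sigma]. *)
Definition height_level (k : nat) : R := iter k mobius sigma.

Definition below_level (k : nat) (p : T) : Prop :=
  (k < k0)%N -> (val p).1.2 <= height_level k.

Definition gauge (p q : T) : R :=
  `|(val p).1.1 - (val q).1.1| `^ a +
  `|(val p).1.2 - (val q).1.2| `^ b *
    cross_ratio (val p).1.2 (val q).1.2 `^ (a - b).

Definition flip_ratio : R :=
  height_level k0 / (1 - sigma + sigma * height_level k0).

Definition gauge_contraction : R :=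
  Num.max (rho `^ a) (flip_ratio `^ (a / 2)).

Lemma height_level_bounds k : 0 < height_level k < 1.
Proof.
elim: k => [|k /andP[h0 h1]]; first by rewrite /height_level /= sigma_gt0.
rewrite /height_level iterS -/(height_level k).
have m0 := mobius_lt (lexx 0) h0; have m1 := mobius_lt (ltW h0) h1.
have e0 : 0 < e1 by exact: expR_gt0.
have M0 : mobius 0 = 0 :> R by rewrite /mobius mulr0 mul0r.
have M1 : mobius 1 = 1 :> R by rewrite /mobius !mulr1 addrC subrK divff// gt_eqF.
by move: m0 m1; rewrite M0 M1 => -> ->.
Qed.

Lemma le_mobius (y : R) : 0 <= y <= 1 -> y <= mobius y.
Proof.
move=> /andP[y0 y1]; rewrite /mobius ler_pdivlMr ?mobius_den_gt0// mulrC.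
rewrite ler_wpM2r//; have e0 : 1 < e1 by rewrite expR_gt1.
have : 0 <= (e1 - 1) * (1 - y) by rewrite mulr_ge0 ?subr_ge0 ?(ltW e0).
by lra.
Qed.

Lemma height_level_mono k j : (k <= j)%N -> height_level k <= height_level j.
Proof.
move=> /subnK <-; elim: (j - k)%N => [//|n IH]; apply: le_trans IH _.
rewrite addSn /height_level iterS -/(height_level (n + k)); apply: le_mobius.
by have /andP[? ?] := height_level_bounds (n + k); rewrite !ltW.
Qed.

Lemma flip_ratio_bounds : 0 < flip_ratio < 1.
Proof.
have /andP[h0 h1] := height_level_bounds k0.
have d0 : 0 < 1 - sigma + sigma * height_level k0.
  by rewrite addr_gt0 ?subr_gt0// mulr_gt0.
rewrite /flip_ratio divr_gt0//= ltr_pdivrMr// mul1r.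
have : 0 < (1 - sigma) * (1 - height_level k0) by rewrite mulr_gt0 ?subr_gt0.
by lra.
Qed.

Lemma powR_lt1 (x r : R) : 0 < x -> x < 1 -> 0 < r -> x `^ r < 1.
Proof.
move=> x0 x1 r0; have := @gt0_ltr_powR _ r r0 x 1; rewrite powR1 !nnegrE.
by apply => //; rewrite ltW.
Qed.

Lemma gauge_contraction_bounds : 0 < gauge_contraction < 1.
Proof.
have /andP[f0 f1] := flip_ratio_bounds.
rewrite /gauge_contraction lt_max powR_gt0//= gt_max !powR_lt1// divr_gt0//.
Qed.

Lemma ler_powRr (x y r : R) : 0 <= r -> 0 <= x -> x <= y -> x `^ r <= y `^ r.
Proof.
by move=> r0 x0 xy; apply: ge0_ler_powR => //; rewrite nnegrE// (le_trans x0).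
Qed.

Let ab0 : 0 <= a - b. Proof. by rewrite subr_ge0 ltW. Qed.
Let unit_y (p : T) : 0 <= (val p).1.2 <= 1. Proof. exact: val_bounds. Qed.

Lemma gauge_ge0 p q : 0 <= gauge p q.
Proof. by rewrite /gauge addr_ge0 ?mulr_ge0 ?powR_ge0. Qed.

Lemma powR_le1 (x r : R) : 0 <= x -> x <= 1 -> 0 <= r -> x `^ r <= 1.
Proof. by move=> x0 x1 r0; have := ler_powRr r0 x0 x1; rewrite powR1. Qed.

Lemma powR_ge1 (x r : R) : 1 <= x -> 0 <= r -> 1 <= x `^ r.
Proof. by move=> x1 r0; have := ler_powRr r0 ler01 x1; rewrite powR1. Qed.

Lemma gauge_le_powers p q : gauge p q <=
  `|(val p).1.1 - (val q).1.1| `^ a + `|(val p).1.2 - (val q).1.2| `^ b.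
Proof.
have /andP[_ c1] := cross_ratio_bounds (unit_y p) (unit_y q).
rewrite /gauge lerD2l -[leRHS]mulr1 ler_wpM2l ?powR_ge0//.
by rewrite powR_le1// cross_ratio_ge0.
Qed.

(** The map f expands distances by at most e and leaves the cross ratio alone. *)
Lemma gauge_mobius (p q p' q' : T) :
  (val p').1.1 = rho * (val p).1.1 -> (val q').1.1 = rho * (val q).1.1 ->
  (val p').1.2 = mobius (val p).1.2 -> (val q').1.2 = mobius (val q).1.2 ->
  gauge p' q' <= e1 `^ b * gauge p q.
Proof.
move=> px qx py qy; rewrite /gauge px qx py qy cross_ratio_mobius//.
have eb1 : 1 <= e1 `^ b.
  by apply: powR_ge1; rewrite ltW// expR_gt1.
rewrite mulrDr; apply: lerD.
  rewrite -mulrBr normrM (ger0_norm (ltW rho_gt0)) powRM ?(ltW rho_gt0)//.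
  apply: ler_wpM2r; first exact: powR_ge0.
  by apply: le_trans eb1; rewrite powR_le1 ?ltW.
rewrite mulrA; apply: ler_wpM2r; first exact: powR_ge0.
rewrite -powRM ?expR_ge0//; apply: ler_powRr => //; first exact: ltW.
exact: mobius_lipschitz.
Qed.

Lemma gauge_b1 p q : A p -> A q -> gauge (b1 p) (b1 q) <= e1 `^ b * gauge p q.
Proof. by move=> Ap Aq; apply: gauge_mobius; rewrite val_b1. Qed.

Lemma gauge_b3 p q : A p -> A q -> gauge (b3 p) (b3 q) <= e1 `^ b * gauge p q.
Proof. by move=> Ap Aq; apply: gauge_mobius; rewrite val_b3. Qed.

(** For k < k0 both heights are below the level k0, which is less than 1, and
[cross_ratio_flip] applies with that level; otherwise it applies with height 1 and
factor 1. *)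
Lemma gauge_b2 k p q : ~~ A p -> ~~ A q -> below_level k p -> below_level k q ->
  gauge (b2 p) (b2 q) <=
    e1 `^ b * (if (k < k0)%N then gauge_contraction else 1) * gauge p q.
Proof.
move=> Ap Aq pk qk; rewrite -mulrA.
have eb1 : 1 <= e1 `^ b.
  by apply: powR_ge1; rewrite ltW// expR_gt1.
set s := if _ then _ else _.
have /andP[t0 t1] := gauge_contraction_bounds.
have s0 : 0 <= s by rewrite /s; case: ifP => _ //; rewrite ltW.
suff H : gauge (b2 p) (b2 q) <= s * gauge p q.
  apply: le_trans H _; rewrite -[leLHS]mul1r ler_wpM2r//.
  by rewrite mulr_ge0// gauge_ge0.
have rs : rho `^ a <= s.
  rewrite /s; case: ifP => _; first by rewrite le_max lexx.
  by rewrite powR_le1 ?ltW.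
set yp := (val p).1.2; set yq := (val q).1.2.
have [Y [Yp Yq Ys]] : exists Y, [/\ yp <= Y, yq <= Y &
    0 <= Y / (1 - sigma + sigma * Y) /\
    (Y / (1 - sigma + sigma * Y)) `^ (a - b) <= s].
  rewrite /s; case: ifPn => kk0.
    have kk := height_level_mono (ltnW kk0).
    exists (height_level k0); split.
    - exact: le_trans (pk kk0) kk.
    - exact: le_trans (qk kk0) kk.
    have /andP[f0 f1] := flip_ratio_bounds; split; first exact: ltW.
    rewrite /gauge_contraction le_max; apply/orP; right.
    by apply: ger_powR; [rewrite f0 ltW|have := b_le; lra].
  exists 1; rewrite mulr1 subrK divr1 powR1 ler01 lexx.
  by case/andP: (unit_y p) => _ ->; case/andP: (unit_y q) => _ ->.
case: Ys => Y0 Ys.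
rewrite /gauge !val_b2//= [leRHS]mulrDr; apply: lerD.
  have -> : 3 / 4 - rho * (val p).1.1 - (3 / 4 - rho * (val q).1.1) =
    - (rho * ((val p).1.1 - (val q).1.1)) by ring.
  rewrite normrN normrM (ger0_norm (ltW rho_gt0)) powRM ?(ltW rho_gt0)//.
  by apply: ler_wpM2r => //; exact: powR_ge0.
have yE : sigma * (1 - yp) - sigma * (1 - yq) = - (sigma * (yp - yq)) by ring.
rewrite -/yp -/yq yE normrN normrM (ger0_norm (ltW sigma_gt0)) mulrCA.
have fl (y : R) : 0 <= y <= 1 -> 0 <= sigma * (1 - y) <= 1.
  move=> /andP[y0 y1]; rewrite mulr_ge0 ?subr_ge0 ?(ltW sigma_gt0)//=.
  by rewrite mulr_ile1 ?subr_ge0 ?(ltW sigma_gt0) ?(ltW sigma_lt1)// gerBl.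
apply: ler_pM; rewrite ?powR_ge0//.
  apply: ler_powRr; rewrite ?mulr_ge0 ?(ltW b_gt0) ?(ltW sigma_gt0)//.
  by rewrite -[leRHS]mul1r ler_wpM2r// ltW.
have K := cross_ratio_flip sigma_gt0 sigma_lt1 (unit_y p) (unit_y q) Yp Yq.
have K0 := cross_ratio_ge0 (fl _ (unit_y p)) (fl _ (unit_y q)).
apply: le_trans (ler_powRr ab0 K0 K) _.
rewrite powRM ?cross_ratio_ge0//.
by apply: ler_wpM2r => //; exact: powR_ge0.
Qed.

Lemma below_level_all p : below_level k0 p.
Proof. by rewrite /below_level ltnn. Qed.

Lemma below_level_mobius k (p p' : T) : (val p').1.2 = mobius (val p).1.2 ->
  below_level k p -> below_level k.+1 p'.
Proof.
move=> pp' kp kk0; rewrite pp' /height_level iterS; apply: mobius_le.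
  by case/andP: (unit_y p).
exact: kp (ltnW kk0).
Qed.

Lemma below_level_b1 k p : A p -> below_level k p -> below_level k.+1 (b1 p).
Proof. by move=> Ap; apply: below_level_mobius; rewrite val_b1. Qed.

Lemma below_level_b3 k p : A p -> below_level k p -> below_level k.+1 (b3 p).
Proof. by move=> Ap; apply: below_level_mobius; rewrite val_b3. Qed.

Lemma below_level_b2 p : ~~ A p -> below_level 0 (b2 p).
Proof.
move=> Ap _; rewrite val_b2// /height_level /= -[leRHS]mulr1.
apply: ler_wpM2l; first exact: ltW.
by rewrite gerBl; case/andP: (unit_y p).
Qed.

Lemma power_sum_le (u v : R) : 0 <= u -> 0 <= v ->
  (u + v) `^ a <= 2 * (u `^ a + v `^ a).
Proof.
move=> u0 v0.
have H (m : R) : 0 <= m -> (2 * m) `^ a <= 2 * m `^ a.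
  move=> m0; rewrite powRM//; apply: ler_wpM2r; first exact: powR_ge0.
  by apply: ler1_powR => //; rewrite ler1n.
have [uv|/ltW vu] := leP u v.
  apply: (@le_trans _ _ ((2 * v) `^ a)).
    by apply: ler_powRr; [exact: ltW|exact: addr_ge0|lra].
  by apply: le_trans (H _ v0) _; rewrite ler_wpM2l// lerDr powR_ge0.
apply: (@le_trans _ _ ((2 * u) `^ a)).
  by apply: ler_powRr; [exact: ltW|exact: addr_ge0|lra].
by apply: le_trans (H _ u0) _; rewrite ler_wpM2l// lerDl powR_ge0.
Qed.

(** From |y - w| <= cross_ratio, |y - w|^a <= |y - w|^b cross_ratio^(a-b). *)
Lemma euclidean_dist_gauge (p q : T) : A p = A q ->
  euclidean_dist (val p) (val q) `^ a <= 2 * gauge p q.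
Proof.
move=> Apq; set x := (val p).1.1 - (val q).1.1; set y := (val p).1.2 - (val q).1.2.
have dE : euclidean_dist (val p) (val q) <= `|x| + `|y|.
  rewrite /euclidean_dist (val_level hsigma Apq) subrr expr0n addr0 -/x -/y.
  rewrite -[leRHS]ger0_norm ?addr_ge0// -sqrtr_sqr ler_wsqrtr//.
  rewrite -(real_normK (num_real x)) -(real_normK (num_real y)) sqrrD.
  by rewrite lerD2r lerDl mulrn_wge0// mulr_ge0.
apply: (@le_trans _ _ ((`|x| + `|y|) `^ a)).
  by apply: ler_powRr; rewrite ?(ltW a_gt0)// /euclidean_dist sqrtr_ge0.
apply: le_trans (power_sum_le (normr_ge0 x) (normr_ge0 y)) _.
rewrite ler_wpM2l// /gauge lerD2l -/y.
have /andP[yc _] := cross_ratio_bounds (unit_y p) (unit_y q).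
have -> : `|y| `^ a = `|y| `^ b * `|y| `^ (a - b).
  rewrite -powRD; first by rewrite addrC subrK.
  by rewrite addrC subrK gt_eqF.
by apply: ler_wpM2l; [exact: powR_ge0|exact: ler_powRr].
Qed.

(** Stated for an arbitrary filter converging to p, and instantiated below with the
neighborhoods of p. *)
Lemma gauge_near_filter (F : set_system T) (p : T) (eps : R) : Filter F ->
  F --> p -> 0 < eps -> \forall q \near F, A q = A p /\ gauge q p < eps.
Proof.
move=> FF Fp eps0.
have pow_lt (r : R) : 0 < r -> exists2 d, 0 < d &
    forall t, 0 <= t -> t < d -> t `^ r < eps / 2.
  move=> r0; exists ((eps / 2) `^ r^-1); first by rewrite powR_gt0// divr_gt0.
  move=> t t0 td.
  have -> : eps / 2 = ((eps / 2) `^ r^-1) `^ r.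
    by rewrite -powRrM mulVf ?gt_eqF// powRr1// ltW// divr_gt0.
  by apply: gt0_ltr_powR => //; rewrite nnegrE// powR_ge0.
have [d1 d10 H1] := pow_lt a a_gt0; have [d2 d20 H2] := pow_lt b b_gt0.
have [cx cy _] := val_coordinates_cvg Fp.
have near_A := on_ground_near hsigma FF Fp.
move/cvgrPdist_lt: cx => /(_ _ d10) near_x.
move/cvgrPdist_lt: cy => /(_ _ d20) near_y.
apply: filterS (filterI near_A (filterI near_x near_y)).
move=> q [Aq [/= qx qy]]; split => //.
apply: le_lt_trans (gauge_le_powers q p) _.
by rewrite [eps]splitr ltrD// ?H1 ?H2// distrC.
Qed.

Lemma gauge_near (p : T) (eps : R) : 0 < eps ->
  \forall q \near p, A q = A p /\ gauge q p < eps.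
Proof. exact: (gauge_near_filter (nbhs_filter p) (fun _ => id)). Qed.

Lemma gauge_lipschitz_continuous (u : T -> R) (C : R) : 0 <= C ->
  (forall p q, A p = A q -> `|u p - u q| <= C * gauge p q) -> continuous u.
Proof.
move=> C0 uC p.
apply/(@cvgrPdist_lt _ _ _ (nbhs p) (nbhs_filter p)) => eps eps0.
have e0 : 0 < eps / (C + 1) by rewrite divr_gt0// ltr_wpDl.
apply: (@filterS _ (nbhs p) (nbhs_filter p) _ _ _ (gauge_near p e0)).
move=> q [Aq gq] /=.
rewrite distrC; apply: le_lt_trans (uC _ _ Aq) _.
move: gq; rewrite ltr_pdivlMr ?ltr_wpDl//; apply: le_lt_trans.
by rewrite mulrC ler_wpM2l ?gauge_ge0// lerDl.
Qed.

End horseshoe_gauge.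

(** * Eigenfunction and eigenmeasure of the transfer operator *)

Lemma expR_lipschitz {R : realType} (M u v : R) : u <= M -> v <= M ->
  `|expR u - expR v| <= expR M * `|u - v|.
Proof.
wlog vu : u v / v <= u.
  move=> H uM vM; have [vu|/ltW uv] := leP v u; first exact: H.
  by rewrite distrC [`|u - v|]distrC; exact: H.
move=> uM vM; rewrite !ger0_norm ?subr_ge0 ?ler_expR//.
have -> : expR u - expR v = expR u * (1 - expR (v - u)).
  by rewrite mulrBr mulr1 -expRD [u + _]addrC subrK.
have H : 1 - expR (v - u) <= u - v.
  by have := expR_ge1Dx (v - u); lra.
apply: ler_pM; rewrite ?expR_ge0 ?ler_expR// subr_ge0 -expR0 ler_expR.
by rewrite subr_le0.
Qed.

Theorem theorem2 (R : realType) (rho sigma : R)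
    (hrho : 0 < rho < 3^-1) (hsigma : 0 < sigma < 3^-1)
    (phi : LambdaT sigma hrho -> R)
    (hphi : holder_continuous phi)
    (hosc : sup (range phi) - inf (range phi) < ln (golden_ratio R) / 2)
    (lambda : R) (hlambda : lambda = spectral_radius (transfer phi)) :
  exists (nu : probability (borel sigma hrho) R) (h : LambdaT sigma hrho -> R),
    [/\ continuous h,
        (forall x, 0 < h x),
        (exists2 mu : {finite_measure set (borel sigma hrho) -> \bar R},
           dual_transfer phi nu mu &
           forall A, measurable A -> mu A = (lambda%:E * nu A)%E) &
        transfer phi h = (fun x => lambda * h x)].
Proof.
have [C [a [C_ge0 /andP[a_gt0 a_le1] phi_holder]]] := hphi.
have T_compact : compact [set: LambdaT sigma hrho] by exact: LambdaT_compact.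
pose A := @on_ground R rho sigma hrho.
pose p0 : LambdaT sigma hrho := point.
have phi_gauge b : 0 < b -> b <= a / 2 -> forall p q, A p = A q ->
    `|phi p - phi q| <= C * 2 * gauge a b p q.
  move=> b0 ba p q Apq; apply: le_trans (phi_holder p q) _.
  by rewrite -mulrA ler_wpM2l//; exact: euclidean_dist_gauge.
have a2 : 0 < a / 2 by rewrite divr_gt0.
have phi_cont : continuous phi.
  apply: (gauge_lipschitz_continuous hsigma a_gt0 a2 (lexx _)
    (mulr_ge0 C_ge0 (ler0n _ 2))).
  exact: phi_gauge.
have [M M_gt0 phiM] := continuous_compact_bounded T_compact phi_cont.
have phi_sup : has_sup (range phi).
  split; first by exists (phi p0), p0.
  by exists M => _ [p _ <-]; exact: le_trans (ler_norm _) (phiM p).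
have phi_inf : has_inf (range phi).
  split; first by exists (phi p0), p0.
  by exists (- M) => _ [p _ <-]; have := phiM p; rewrite ler_norml => /andP[].
set smax := sup (range phi) in hosc; set smin := inf (range phi) in hosc.
have phi_le p : phi p <= smax by apply: sup_upper_bound => //; exists p.
have phi_ge p : smin <= phi p by apply: ge_inf; [case: phi_inf|exists p].
pose W p := expR (phi p).
have e_gt0 : 0 < expR smin := expR_gt0 _.
have e_le p : expR smin <= W p by rewrite ler_expR.
have W_le p : W p <= expR smax by rewrite ler_expR.
pose b1 := @lift_branch R rho sigma hrho (beta1 rho).
pose b2 := @lift_branch R rho sigma hrho (beta2 rho sigma).
pose b3 := @lift_branch R rho sigma hrho (beta3 rho).
have A_b1 p : A p -> A (b1 p) by exact: ground_b1.
have A_b2 p : ~~ A p -> A (b2 p) by exact: ground_b2.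
have A_b3 p : A p -> ~~ A (b3 p) by exact: ground_b3.
pose lam := growth_rate A b1 b2 b3 W.
have lam_gt0 : 0 < lam := growth_rate_gt0 A_b1 A_b2 A_b3 e_gt0 e_le W_le p0.
(* the oscillation of phi is less than log(golden_ratio) *)
have E_lt : expR smax < lam.
  apply: (@lt_le_trans _ _ (expR smin * golden_ratio R)); last first.
    exact: (growth_rate_ge A_b1 A_b2 A_b3 e_gt0 e_le W_le p0).
  have w0 : 0 < golden_ratio R := golden_ratio_gt0.
  have w1 : 1 < golden_ratio R.
    by have := @golden_ratio_sqr R; rewrite expr2 => ww; nra.
  rewrite -(lnK w0) -expRD ltr_expR.
  have : 0 < ln (golden_ratio R) by rewrite ln_gt0.
  by lra.
have [k0 Hk0] := exists_memory_supersolution A_b1 A_b2 A_b3 e_gt0 e_le W_le p0 E_lt.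
pose t := gauge_contraction rho sigma a k0.
have /andP[t_gt0 t_lt1] : 0 < t < 1 by exact: gauge_contraction_bounds.
have [c1 c1_gt1 Hc1] := Hk0 t t_gt0 t_lt1.
(* the expansion e^b of the gauge in one step must not exceed c1 *)
pose b := Num.min (a / 2) (ln c1).
have b_gt0 : 0 < b by rewrite lt_min a2 ln_gt0.
have b_le : b <= a / 2 by rewrite ge_min lexx.
pose c := expR 1 `^ b.
have c_gt0 : 0 < c by rewrite powR_gt0// expR_gt0.
have c_le : c <= c1.
  rewrite /c -expRM mul1r -[leRHS]lnK ?posrE ?(lt_trans ltr01)// ler_expR.
  by rewrite /b ge_min lexx orbT.
have [U [S [beta [U_ge1 U_le beta01 KU]]]] := Hc1 c (ltW c_gt0) c_le.
pose C0 := expR smax * (C * 2).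
have C0_ge0 : 0 <= C0 by rewrite !mulr_ge0// expR_ge0.
pose d := gauge a b : LambdaT sigma hrho -> LambdaT sigma hrho -> R.
have W_lip p q : A p = A q -> `|W p - W q| <= C0 * d p q.
  move=> Apq; apply: le_trans (expR_lipschitz (phi_le p) (phi_le q)) _.
  by rewrite -mulrA ler_wpM2l ?expR_ge0//; exact: phi_gauge.
have d_ge0 p q : 0 <= d p q by exact: gauge_ge0.
pose P := @below_level R rho sigma hrho k0.
have P_all p : P k0 p by exact: below_level_all.
have P_b1 k p : A p -> P k p -> P k.+1 (b1 p) by exact: below_level_b1.
have P_b3 k p : A p -> P k p -> P k.+1 (b3 p) by exact: below_level_b3.
have P_b2 p : ~~ A p -> P 0%N (b2 p) by exact: below_level_b2.
have d_b1 p q : A p -> A q -> d (b1 p) (b1 q) <= c * d p q by exact: gauge_b1.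
have d_b3 p q : A p -> A q -> d (b3 p) (b3 q) <= c * d p q by exact: gauge_b3.
have d_b2 k p q : ~~ A p -> ~~ A q -> P k p -> P k q ->
    d (b2 p) (b2 q) <= c * (if (k < k0)%N then t else 1) * d p q.
  exact: gauge_b2.
have d_near p eps : 0 < eps -> \forall q \near p, A q = A p /\ d q p < eps.
  exact: gauge_near.
have approx eps : 0 < eps -> exists g, [/\ forall p, 0 <= g p <= 1,
    exists p, 1 / 2 <= g p,
    forall p q, A p = A q -> `|g p - g q| <=
      lipschitz_bound A b1 b2 b3 W c C0 S beta * d p q &
    forall p, `|branch_op A b1 b2 b3 W g p - lam * g p| <= eps].
  move=> eps_gt0.
  exact: (approximate_eigenfunction A_b1 A_b2 A_b3 e_gt0 e_le W_le p0 c_gt0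
    (ltW t_gt0) (ltW t_lt1) C0_ge0 U_ge1 U_le beta01 KU d_ge0 P_all P_b1 P_b3
    P_b2 d_b1 d_b3 d_b2 W_lip eps_gt0).
have bound_ge0 := lipschitz_bound_ge0 A_b1 A_b2 A_b3 e_gt0 e_le W_le p0 c_gt0 C0_ge0
  U_ge1 U_le beta01.
have [h [h_ge0 [p hp] h_lip Lh]] :=
  eigenfunction_of_approximate T_compact bound_ge0 d_near approx.
have h_same := eigenfunction_positivity A_b1 A_b2 A_b3 e_gt0 e_le W_le p0 U_ge1 U_le
  beta01 KU d_ge0 P_all P_b1 P_b3 P_b2 d_b1 d_b3 d_b2 h_ge0 Lh bound_ge0 h_lip.
(* [eigenfunction_positivity] compares points of the same level only; the branch b2
   links the two levels *)
have h_upper q : ~~ A q -> lam * h q = W (b2 q) * h (b2 q).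
  by move=> Aq; rewrite -Lh /branch_op (negbTE Aq).
have h_gt0 q : 0 < h q.
  have [p' Ap' hp'] : exists2 p', A p' & 0 < h p'.
    have [Ap|nAp] := boolP (A p); first by exists p.
    exists (b2 p); first exact: A_b2.
    by rewrite -(pmulr_rgt0 _ (expR_gt0 (phi (b2 p)))) -/(W _) -h_upper// mulr_gt0.
  have ground_gt0 q' : A q' -> 0 < h q'.
    by move=> Aq'; apply: h_same hp'; rewrite Ap' Aq'.
  have [Aq|nAq] := boolP (A q); first exact: ground_gt0.
  rewrite -(pmulr_rgt0 _ lam_gt0) h_upper// mulr_gt0 ?expR_gt0// ground_gt0//.
  exact: A_b2.
have h_cont : continuous h.
  exact: (gauge_lipschitz_continuous hsigma a_gt0 b_gt0 b_le bound_ge0 h_lip).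
have W_cont : continuous W.
  exact: (gauge_lipschitz_continuous hsigma a_gt0 b_gt0 b_le C0_ge0 W_lip).
have L_cont (u : LambdaT sigma hrho -> R) : continuous u ->
    continuous (branch_op A b1 b2 b3 W u).
  exact: branch_op_continuous.
have transferE : transfer phi = branch_op A b1 b2 b3 W.
  by apply/funext => u; exact: transfer_branch_op.
have lambdaE : lambda = lam.
  rewrite hlambda transferE.
  exact: (spectral_radius_eigenvalue T_compact e_gt0 e_le lam_gt0 h_cont h_gt0 Lh
    L_cont p0).
have [l [lD lZ l_ge0 l1 lL]] :=
  exists_eigenfunctional T_compact e_gt0 e_le lam_gt0 h_cont h_gt0 Lh p0.
have [nu nuE] := riesz_representation T_compact (@LambdaT_open_cozero R rho sigma hrho)
  lD lZ l_ge0 l1.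
exists nu, h; split => //.
- have lam_ge0 : 0 <= lambda by rewrite lambdaE ltW.
  pose m := mscale (NngNum lam_ge0) nu.
  have m_fin : fin_num_fun m.
    by move=> B mB; rewrite /m /mscale/= fin_numM// fin_num_measure.
  pose fm := Measure_isFinite.Build _ _ _ m m_fin.
  pose mu : {finite_measure set (borel sigma hrho) -> \bar R} := HB.pack m fm.
  exists mu => [psi psi_cont|B mB]; last by [].
  have psi_int : nu.-integrable setT (EFin \o psi).
    exact: continuous_integrable.
  rewrite (integrable_mscale _ psi_int)/= nuE//.
  rewrite (_ : (fun x => _) = (fun x => (branch_op A b1 b2 b3 W psi x)%:E)).
    by rewrite nuE ?lL ?lambdaE//; exact: L_cont.
  by apply/funext => x; rewrite transferE.
- by apply/funext => x; rewrite transferE lambdaE Lh.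
Qed.
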